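(* Let $(R,\mathfrak m,K)$ be an F-finite local ring (of prime characteristic $p>0$) of Krull dimension $d$, and let $M$ be any finitely generated $R$-module of Krull dimension $d$. Then $\mathcal M:=\{F^n_*(M)\}_n$ is a strongly lim Cohen-Macaulay sequence of $R$-modules.
   Context: A local ring is Noetherian. F-finite means that the Frobenius endomorphism is module-finite. $F^n_*(M)$ is $M$ regarded as an $R$-module by restriction of scalars along the $n$-fold Frobenius $F^n:R\to R$. $\nu(M)=\dim_K(K\otimes_RM)$ and $H^j_{\mathfrak m}$ is local cohomology. For a family $\mathcal V$ of $R$-modules and an $R$-module $H$, $\ell_{\mathcal V}(H)$ is $0$ if $H=0$, and otherwise the shortest length of a finite filtration of $H$ all of whose factors are isomorphic to modules in $\mathcal V$ ($+\infty$ if none exists). A sequence $\{M_n\}_n$ of finitely generated $R$-modules is strongly lim Cohen-Macaulay if every $M_n$ has Krull dimension $d=\dim R$ and there is a finite set $\mathcal V$ of Artinian $R$-modules such that $\ell_{\mathcal V}(H^j_{\mathfrak m}(M_n))=\mathrm o(\nu(M_n))$ as $n\to\infty$ for every $j<d$. *)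

(* Defs.v *)
From HB Require Import structures.
From mathcomp Require Import all_boot all_order all_algebra.
From mathcomp Require Import boolp classical_sets constructive_ereal.

Set Implicit Arguments.
Unset Strict Implicit.
Unset Printing Implicit Defensive.
Import Order.TTheory GRing.Theory Num.Theory.

Local Open Scope ring_scope.

(* Subsets of rings and modules are [{pred _}] or [set _]; as classical logic
   is assumed, either one ranges over all subsets. *)

(** Finiteness conditions *)

Definition fin_gen (R : comNzRingType) (M : lmodType R) : Prop :=
  exists (k : nat) (g : 'I_k -> M),
    forall x : M, exists c : 'I_k -> R, x = \sum_(i < k) c i *: g i.

Definition noetherian_ring (R : comNzRingType) : Prop :=
  forall I : {pred R^o}, submod_closed I ->
    exists (k : nat) (g : 'I_k -> R), forall x : R,
      x \in I <-> exists c : 'I_k -> R, x = \sum_(i < k) c i * g i.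

Definition artinian_module (R : comNzRingType) (M : lmodType R) : Prop :=
  forall N : nat -> {pred M},
    (forall i, submod_closed (N i)) ->
    (forall i, {subset N i.+1 <= N i}) ->
    exists k, forall i, (k <= i)%N -> N i =i N k.

(** Local rings; [idealr_closed] means "proper ideal". *)

Definition maximal_ideal (R : comNzRingType) (m : {pred R}) : Prop :=
  idealr_closed m /\
  forall J : {pred R}, idealr_closed J -> {subset m <= J} -> J =i m.

(* [(R, m, K)] is a (Noetherian) local ring, with [pi : R -> K] exhibiting [K]
   as the residue field [R / m]. *)
Record is_local_ring (R : comNzRingType) (m : {pred R})
    (K : fieldType) (pi : {rmorphism R -> K}) : Prop := IsLocalRing {
  local_noetherian : noetherian_ring R;
  local_maximal : maximal_ideal m;
  local_unique : forall J : {pred R}, maximal_ideal J -> J =i m;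
  residue_surj : forall y : K, exists x : R, pi x = y;
  residue_ker : forall x : R, (x \in m) = (pi x == 0)
}.

(** Krull dimension *)

Definition prime_ideal (R : comNzRingType) (P : {pred R}) : Prop :=
  idealr_closed P /\ prime_idealr_closed P.

(* [P 0 < ... < P l] is a strict chain of primes containing [I], i.e. a chain
   of length [l] of primes of [R / I]. *)
Definition prime_chain (R : comNzRingType) (I : set R) (l : nat)
    (P : nat -> {pred R}) : Prop :=
  [/\ forall i, (i <= l)%N -> prime_ideal (P i),
      forall x, I x -> x \in P 0%N
    & forall i, (i < l)%N ->
        {subset P i <= P i.+1} /\ exists x, x \in P i.+1 /\ x \notin P i].

(* [R / I] has Krull dimension [d]. *)
Definition quot_has_dim (R : comNzRingType) (I : set R) (d : nat) : Prop :=
  (exists P, prime_chain I d P) /\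
  (forall l P, prime_chain I l P -> (l <= d)%N).

Definition ring_has_dim (R : comNzRingType) (d : nat) : Prop :=
  quot_has_dim [set x : R | x = 0]%classic d.

Definition annihilator (R : comNzRingType) (M : lmodType R) : set R :=
  [set a | forall x : M, a *: x = 0]%classic.

Definition module_has_dim (R : comNzRingType) (M : lmodType R) (d : nat) : Prop :=
  quot_has_dim (annihilator M) d.

(** Restriction of scalars and Frobenius *)

Definition restrict (R S : comNzRingType) (f : {rmorphism R -> S})
  (M : lmodType S) : Type := M.

Section Restrict.
Variables (R S : comNzRingType) (f : {rmorphism R -> S}) (M : lmodType S).

HB.instance Definition _ := GRing.Zmodule.on (restrict f M).

Definition restrict_scale (a : R) (x : restrict f M) : restrict f M :=
  f a *: (x : M).

Fact restrict_scaleA a b x :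
  restrict_scale a (restrict_scale b x) = restrict_scale (a * b) x.
Proof. by rewrite /restrict_scale scalerA rmorphM. Qed.

Fact restrict_scale1 : left_id 1 restrict_scale.
Proof. by move=> x; rewrite /restrict_scale rmorph1 scale1r. Qed.

Fact restrict_scaleDr : right_distributive restrict_scale +%R.
Proof. by move=> a x y; rewrite /restrict_scale scalerDr. Qed.

Fact restrict_scaleDl x : {morph restrict_scale^~ x : a b / a + b}.
Proof. by move=> a b; rewrite /restrict_scale rmorphD scalerDl. Qed.

HB.instance Definition _ := GRing.Zmodule_isLmodule.Build R (restrict f M)
  restrict_scaleA restrict_scale1 restrict_scaleDr restrict_scaleDl.
End Restrict.

Section Frobenius.
Variables (p : nat) (R : comNzRingType) (charRp : p \in [pchar R]).

Definition frobenius_iter (n : nat) : R -> R := iter n (pFrobenius_aut charRp).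

Fact frobenius_iter_zmod n : zmod_morphism (frobenius_iter n).
Proof.
by elim: n => [|n IHn] x y //; rewrite /frobenius_iter !iterS -rmorphB -IHn.
Qed.

Fact frobenius_iter_monoid n : monoid_morphism (frobenius_iter n).
Proof.
elim: n => [|n [IH1 IHM]]; first by split.
split=> [|x y]; rewrite /frobenius_iter !iterS -?rmorphM.
  by rewrite [iter _ _ _]IH1 rmorph1.
by congr (_ _); apply: IHM.
Qed.

HB.instance Definition _ n :=
  GRing.isZmodMorphism.Build R R (frobenius_iter n) (frobenius_iter_zmod n).
HB.instance Definition _ n :=
  GRing.isMonoidMorphism.Build R R (frobenius_iter n) (frobenius_iter_monoid n).

Definition F_finite : Prop := fin_gen (restrict (pFrobenius_aut charRp) R^o).

Definition frobenius_push (n : nat) (M : lmodType R) : lmodType R :=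
  restrict (frobenius_iter n) M.
End Frobenius.

(** The invariant nu *)

(* [iota : M -> T] exhibits the [K]-vector space [T] as the extension of
   scalars of [M] along [pi : R -> K] (universal property). *)
Definition is_base_change (R : comNzRingType) (K : fieldType)
    (pi : {rmorphism R -> K}) (M : lmodType R) (T : lmodType K)
    (iota : {linear M -> T | pi \; *:%R}) : Prop :=
  forall (W : lmodType K) (g : {linear M -> W | pi \; *:%R}),
    exists h : {linear T -> W},
      (forall x, h (iota x) = g x) /\
      (forall h' : {linear T -> W}, (forall x, h' (iota x) = g x) -> h' =1 h).

Definition base_change_dim (R : comNzRingType) (K : fieldType)
    (pi : {rmorphism R -> K}) (M : lmodType R) (r : nat) : Prop :=
  exists (T : vectType K) (iota : {linear M -> T | pi \; *:%R}),
    is_base_change iota /\ \dim {: T} = r.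

(* The default value [0] is only relevant when [K (x)_R M] has infinite
   dimension, hence never for finitely generated [M]. *)
Definition nu (R : comNzRingType) (K : fieldType) (pi : {rmorphism R -> K})
    (M : lmodType R) : nat := xget 0%N (base_change_dim pi M).

(** Subquotients *)

(* For submodules [B] and [Z] of [E] with [B] contained in [Z]:
   [Z / B] is isomorphic to [N]. Only the values of [f] on [Z] matter. *)
Definition subquot_iso (R : comNzRingType) (E : lmodType R) (Z B : set E)
    (N : lmodType R) : Prop :=
  exists f : E -> N,
    [/\ forall a x y, Z x -> Z y -> f (a *: x + y) = a *: f x + f y,
        forall y, exists x, Z x /\ f x = y
      & forall x, Z x -> (f x = 0 <-> B x)].

(** Local cohomology, as the right derived functors of [Gamma_m] *)

Definition injective_module (R : comNzRingType) (E : lmodType R) : Prop :=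
  forall (A B : lmodType R) (i : {linear A -> B}) (f : {linear A -> E}),
    injective i -> exists g : {linear B -> E}, forall a, g (i a) = f a.

Record injective_resolution (R : comNzRingType) (M : lmodType R) := InjRes {
  res_obj : nat -> lmodType R;
  res_aug : {linear M -> res_obj 0};
  res_diff : forall i, {linear res_obj i -> res_obj i.+1};
  res_injective : forall i, injective_module (res_obj i);
  res_exact_aug : injective res_aug;
  res_exact0 : forall x, res_diff 0 x = 0 <-> exists y, res_aug y = x;
  res_exactS : forall i x,
    res_diff i.+1 x = 0 <-> exists y, res_diff i y = x
}.

(* The elements killed by a power of [m]; [m ^ t] is generated by the products
   of [t] elements of [m]. *)
Definition torsion (R : comNzRingType) (m : {pred R}) (E : lmodType R) : set E :=
  [set x | exists t : nat, forall a : 'I_t -> R,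
     (forall i, a i \in m) -> (\prod_(i < t) a i) *: x = 0]%classic.

Definition cocycles (R : comNzRingType) (m : {pred R}) (M : lmodType R)
    (I : injective_resolution M) (j : nat) : set (res_obj I j) :=
  [set x | torsion m x /\ res_diff I j x = 0]%classic.

Definition coboundaries (R : comNzRingType) (m : {pred R}) (M : lmodType R)
    (I : injective_resolution M) (j : nat) : set (res_obj I j) :=
  match j with
  | 0 => [set x | x = 0]%classic
  | i.+1 => [set x | exists y, torsion m y /\ res_diff I i y = x]%classic
  end.

(* [H] is (isomorphic to) the [j]-th local cohomology module of [M]. *)
Definition is_local_cohomology (R : comNzRingType) (m : {pred R}) (j : nat)
    (M H : lmodType R) : Prop :=
  exists I : injective_resolution M,
    subquot_iso (@cocycles R m M I j) (@coboundaries R m M I j) H.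

(** Length with respect to a finite family of modules *)

Definition has_filtration (R : comNzRingType) (k : nat)
    (V : 'I_k -> lmodType R) (H : lmodType R) (l : nat) : Prop :=
  exists N : nat -> {pred H},
    [/\ forall i, (i <= l)%N -> submod_closed (N i),
        forall x, (x \in N 0%N) = (x == 0),
        forall x, x \in N l
      & forall i, (i < l)%N -> {subset N i <= N i.+1} /\
          exists v : 'I_k, subquot_iso [set x | x \in N i.+1]%classic
                                       [set x | x \in N i]%classic (V v)].

(* Filtrations of length [0] exist exactly when [H = 0]. *)
Definition ell (R : comNzRingType) (k : nat) (V : 'I_k -> lmodType R)
    (H : lmodType R) : \bar rat :=
  match pselect (exists l, `[< has_filtration V H l >]) with
  | left ex => (ex_minn ex)%:R%:E
  | right _ => +oo%E
  end.

(** Strongly lim Cohen-Macaulay sequences *)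

(* [a n = o(b n)] for [a] with values in the extended line. *)
Definition is_little_o (a : nat -> \bar rat) (b : nat -> nat) : Prop :=
  forall eps : rat, 0 < eps ->
    exists n0 : nat, forall n, (n0 <= n)%N -> (a n <= (eps * (b n)%:R)%:E)%E.

Definition strongly_lim_CM (R : comNzRingType) (m : {pred R}) (K : fieldType)
    (pi : {rmorphism R -> K}) (Ms : nat -> lmodType R) : Prop :=
  exists d : nat,
    [/\ ring_has_dim R d,
        forall n, fin_gen (Ms n),
        forall n, module_has_dim (Ms n) d
      & exists (k : nat) (V : 'I_k -> lmodType R),
          (forall v, artinian_module (V v)) /\
          forall j, (j < d)%N -> forall H : nat -> lmodType R,
            (forall n, is_local_cohomology m j (Ms n) (H n)) ->
            is_little_o (fun n => ell V (H n)) (fun n => nu pi (Ms n))].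

(* Main.v *)
(** A pushforward along F^n commutes with local cohomology, so the task is to
bound F^n_* H for H = H^j_m(M), j < d, against nu(F^n_* M). Let alpha = [K : K^p].

Lower bound: nu(F^n_* M) is at least the rank of F^n_* M at a prime P in the
support of M with dim R/P = d, and comparing lengths along a saturated chain of
primes (Kunz) shows that this rank is at least (p^d alpha)^n.

Upper bound: by devissage of M and multiplication by parameters, every
subquotient Y of H is m-torsion and the socle of F^n_* Y has length
O((p^j alpha)^n); in particular H is Artinian. Let E be the hull of K among the
m-torsion modules. Call a nonzero submodule W of E coprime when every
endomorphism of E kills W or maps W onto W; these are the annihilators of the
primes of the completion of R. Every Artinian m-torsion module is filtered by
coprimes, and if W is a subquotient of H then F_* W is
filtered by r copies of W and by strictly smaller coprimes. The r^n copies of W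
in F^n_* W contribute to its socle, so r <= p^j alpha; by induction on W finitely
many modules and O((3/2 p^j alpha)^n) factors suffice for F^n_* H, while
3/2 p^j < p^d. *)

Require Import Defs.
From HB Require Import structures.
From mathcomp Require Import all_boot all_order all_algebra.
From mathcomp Require Import boolp classical_sets constructive_ereal.
From mathcomp Require Import zify ring.

Set Implicit Arguments.
Unset Strict Implicit.
Unset Printing Implicit Defensive.
Import Order.TTheory GRing.Theory Num.Theory.

Local Open Scope ring_scope.

(** * Linear relations and submodules *)

(** A prime filtration of M does not pass to local cohomology, which is not exact, so the
    filtrations are built on the fixed module H: a finite set of modules closed, up to filtration,
    under F_* serves all n at once. The completion enters only as the endomorphism ring of E, whose
    elements act on any two elements of E like one scalar of R, and scalars are what F_* can handle.
    The length at a prime and the corank along a coprime are counted alike, as the number of steps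
    in a chain of submodules that have a given S as a subquotient. The count is subadditive because
    S cannot be cut by an extension, so nothing is localized or completed. The factors strictly
    inside W may grow as fast as the copies of W, which could add polynomial factors in n to the
    rate p^j alpha; the slack 3/2 absorbs them, and p >= 2 leaves room for it. F^n_* need not
    preserve injectivity, so resolutions are compared within a wider class of modules, which it does
    preserve. *)

Section LinearRelations.
Variable R : comNzRingType.
Implicit Types X Y Z : lmodType R.

Definition lsub X (U : set X) : Prop :=
  U 0 /\ forall (a : R) x y, U x -> U y -> U (a *: x + y).

(** A submodule of the product. Maps defined on a submodule or modulo one are handled as relations,
    so that the intermediate modules need not be formed; by linearity, being single-valued has to be
    tested at 0 only. *)
Definition lrel X Y (r : X -> Y -> Prop) : Prop :=
  r 0 0 /\ forall (a : R) x x' y y',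
    r x y -> r x' y' -> r (a *: x + x') (a *: y + y').

Definition univalent X Y (r : X -> Y -> Prop) := forall y, r 0 y -> y = 0.

Lemma lsubZ X (U : set X) a x : lsub U -> U x -> U (a *: x).
Proof. by move=> [U0 UD] Ux; rewrite -[a *: x]addr0; apply: UD. Qed.

Lemma lsubD X (U : set X) x y : lsub U -> U x -> U y -> U (x + y).
Proof. by move=> [U0 UD] Ux Uy; rewrite -[x]scale1r; apply: UD. Qed.

Lemma lsubN X (U : set X) x : lsub U -> U x -> U (- x).
Proof. by rewrite -scaleN1r; apply: lsubZ. Qed.

Lemma lsubB X (U : set X) x y : lsub U -> U x -> U y -> U (x - y).
Proof. by move=> UU Ux Uy; apply: lsubD => //; apply: lsubN. Qed.

Lemma lsub_sum X (U : set X) (I : Type) (s : seq I) (F : I -> X) :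
  lsub U -> (forall i, U (F i)) -> U (\sum_(i <- s) F i).
Proof.
move=> UU UF; elim/big_rec: _ => [|i x _ Ux]; first by case: UU.
exact: lsubD.
Qed.

Lemma lsubT X : lsub (fun _ : X => True). Proof. by []. Qed.

Lemma lsub0 X : lsub (fun x : X => x = 0).
Proof. by split=> // a x y -> ->; rewrite scaler0 addr0. Qed.

Lemma lsubI X (U V : set X) : lsub U -> lsub V -> lsub (fun x => U x /\ V x).
Proof.
by move=> [U0 UD] [V0 VD]; split=> // a x y [? ?] [? ?]; split; auto.
Qed.

Lemma lsub_im X Y (f : {linear X -> Y}) (U : set X) :
  lsub U -> lsub (fun y => exists2 x, U x & f x = y).
Proof.
move=> [U0 UD]; split; first by exists 0; rewrite ?linear0.
by move=> a _ _ [x Ux <-] [y Uy <-]; exists (a *: x + y); rewrite ?linearP; auto.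
Qed.

Lemma lsub_pre X Y (f : {linear X -> Y}) (U : set Y) :
  lsub U -> lsub (fun x => U (f x)).
Proof.
by move=> [U0 UD]; split=> [|a x y Ux Uy]; rewrite ?linear0 ?linearP //; apply: UD.
Qed.

Lemma lsub_ker X Y (f : {linear X -> Y}) : lsub (fun x => f x = 0).
Proof. exact: lsub_pre (@lsub0 Y). Qed.

Lemma lsub_cyc X (g : X) : lsub (fun x => exists r : R, x = r *: g).
Proof.
split; first by exists 0; rewrite scale0r.
by move=> a _ _ [r ->] [s ->]; exists (a * r + s); rewrite scalerDl scalerA.
Qed.

Lemma lrelZ X Y (r : X -> Y -> Prop) a x y : lrel r -> r x y -> r (a *: x) (a *: y).
Proof.
by move=> [r0 rD] rxy; rewrite -[a *: x]addr0 -[a *: y]addr0; apply: rD.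
Qed.

Lemma lrelD X Y (r : X -> Y -> Prop) x x' y y' :
  lrel r -> r x y -> r x' y' -> r (x + x') (y + y').
Proof.
by move=> [r0 rD] r1 r2; rewrite -[x]scale1r -[y]scale1r; apply: rD.
Qed.

Lemma lrelB X Y (r : X -> Y -> Prop) x x' y y' :
  lrel r -> r x y -> r x' y' -> r (x - x') (y - y').
Proof.
move=> rr r1 r2; apply: lrelD => //.
by rewrite -[- x']scaleN1r -[- y']scaleN1r; apply: lrelZ.
Qed.

Lemma lrel_uniq X Y (r : X -> Y -> Prop) x y y' :
  lrel r -> univalent r -> r x y -> r x y' -> y = y'.
Proof.
move=> rr u r1 r2; apply/eqP; rewrite -subr_eq0; apply/eqP/u.
by rewrite -(subrr x); apply: lrelB.
Qed.

Lemma lin_exists X Y (f : X -> Y) :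
  (forall (a : R) x y, f (a *: x + y) = a *: f x + f y) ->
  exists g : {linear X -> Y}, g =1 f.
Proof.
move=> Hf; pose L := GRing.isLinear.Build R X Y *:%R f Hf.
by pose g : {linear X -> Y} := HB.pack f L; exists g.
Qed.

Lemma lrel_fun X Y (r : X -> Y -> Prop) :
  lrel r -> (forall x, exists y, r x y) -> univalent r ->
  exists g : {linear X -> Y}, forall x y, r x y <-> g x = y.
Proof.
move=> rr tot u; have [f fP] := boolp.choice tot.
have fl a x y : f (a *: x + y) = a *: f x + f y.
  apply: (lrel_uniq rr u (fP _)).
  by case: rr => _; apply; apply: fP.
have [g gE] := lin_exists fl; exists g => x y; rewrite gE; split; last by move=> <-.
exact: lrel_uniq (fP x).
Qed.

Lemma linB X Y (f : {linear X -> Y}) x y : f x = f y -> f (x - y) = 0.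
Proof. by rewrite linearB => ->; rewrite subrr. Qed.

Lemma lin_inj X Y (f : {linear X -> Y}) : (forall x, f x = 0 -> x = 0) -> injective f.
Proof.
by move=> f0 x y /linB /f0 /eqP; rewrite subr_eq0 => /eqP.
Qed.

End LinearRelations.

(** * Submodules as modules *)

Section Submodule.
Variables (R : comNzRingType) (X : lmodType R) (U : set X) (UU : lsub U).

Record subm := Subm { subm_val : X; subm_prop : U subm_val }.

Lemma subm_inj (x y : subm) : subm_val x = subm_val y -> x = y.
Proof.
by case: x y => [x Ux] [y Uy] /= E; subst y; rewrite (Prop_irrelevance Ux Uy).
Qed.

HB.instance Definition _ := gen_eqMixin subm.
HB.instance Definition _ := gen_choiceMixin subm.

Definition subm0 := Subm (proj1 UU).
Definition submD (x y : subm) := Subm (lsubD UU (subm_prop x) (subm_prop y)).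
Definition submN (x : subm) := Subm (lsubN UU (subm_prop x)).
Definition submZ (a : R) (x : subm) := Subm (lsubZ a UU (subm_prop x)).

Fact submDA : associative submD.
Proof. by move=> x y z; apply: subm_inj; rewrite /= addrA. Qed.
Fact submDC : commutative submD.
Proof. by move=> x y; apply: subm_inj; rewrite /= addrC. Qed.
Fact subm0D : left_id subm0 submD.
Proof. by move=> x; apply: subm_inj; rewrite /= add0r. Qed.
Fact submND : left_inverse subm0 submN submD.
Proof. by move=> x; apply: subm_inj; rewrite /= addNr. Qed.

(** The proof that [U] is a submodule becomes a parameter of the type because the module operations
    depend on it. *)
Definition subm_of (_ : lsub U) := subm.
HB.instance Definition _ := Choice.on (subm_of UU).
HB.instance Definition _ :=
  GRing.isZmodule.Build (subm_of UU) submDA submDC subm0D submND.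

Fact submZA (a b : R) (x : subm_of UU) : submZ a (submZ b x) = submZ (a * b) x.
Proof. by apply: subm_inj; rewrite /= scalerA. Qed.
Fact subm1Z : left_id 1 (submZ : R -> subm_of UU -> subm_of UU).
Proof. by move=> x; apply: subm_inj; rewrite /= scale1r. Qed.
Fact submZDr : right_distributive (submZ : R -> subm_of UU -> subm_of UU) +%R.
Proof. by move=> a x y; apply: subm_inj; rewrite /= scalerDr. Qed.
Fact submZDl (x : subm_of UU) :
  {morph (fun a => submZ a x : subm_of UU) : a b / a + b}.
Proof. by move=> a b; apply: subm_inj; rewrite /= scalerDl. Qed.
HB.instance Definition _ := GRing.Zmodule_isLmodule.Build R (subm_of UU)
  submZA subm1Z submZDr submZDl.

End Submodule.

Section SubExists.
Variable R : comNzRingType.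
Implicit Types X Y Z : lmodType R.

Lemma sub_exists X (U : set X) : lsub U ->
  exists (Y : lmodType R) (i : {linear Y -> X}),
    injective i /\ forall x, U x <-> exists y, i y = x.
Proof.
move=> UU; exists (subm_of UU).
have Hl (a : R) (x y : subm_of UU) : subm_val (a *: x + y) = a *: subm_val x + subm_val y.
  by [].
have [i iE] := lin_exists Hl; exists i; split.
  by move=> x y; rewrite !iE; apply: subm_inj.
move=> x; split => [Ux|[y <-]]; first by exists (Subm Ux); rewrite iE.
by rewrite iE; apply: subm_prop.
Qed.

End SubExists.

(** * Injective modules in characteristic p *)

Section Coinduced.
Variables (R : comNzRingType) (X : zmodType).

(* The coinduced module: additive maps [R -> X], on which [R] acts by
   precomposition. *)
Record coind := Coind { cofun : R -> X;
  coadd : forall a b, cofun (a + b) = cofun a + cofun b }.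

Lemma coind_inj (f g : coind) : (forall a, cofun f a = cofun g a) -> f = g.
Proof.
case: f g => [f fD] [g gD] /= /funext E; subst g.
by rewrite (Prop_irrelevance fD gD).
Qed.

HB.instance Definition _ := gen_eqMixin coind.
HB.instance Definition _ := gen_choiceMixin coind.

Program Definition coind0 := @Coind (fun _ => 0) _.
Next Obligation. by rewrite addr0. Qed.
Program Definition coindD f g := @Coind (fun a => cofun f a + cofun g a) _.
Next Obligation. by rewrite !coadd addrACA. Qed.
Program Definition coindN f := @Coind (fun a => - cofun f a) _.
Next Obligation. by rewrite !coadd opprD. Qed.
Program Definition coindZ (r : R) f := @Coind (fun a => cofun f (a * r)) _.
Next Obligation. by rewrite mulrDl coadd. Qed.

Fact coindDA : associative coindD.
Proof. by move=> x y z; apply: coind_inj => a /=; rewrite addrA. Qed.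
Fact coindDC : commutative coindD.
Proof. by move=> x y; apply: coind_inj => a /=; rewrite addrC. Qed.
Fact coind0D : left_id coind0 coindD.
Proof. by move=> x; apply: coind_inj => a /=; rewrite add0r. Qed.
Fact coindND : left_inverse coind0 coindN coindD.
Proof. by move=> x; apply: coind_inj => a /=; rewrite addNr. Qed.
HB.instance Definition _ :=
  GRing.isZmodule.Build coind coindDA coindDC coind0D coindND.

Fact coindZA a b x : coindZ a (coindZ b x) = coindZ (a * b) x.
Proof. by apply: coind_inj => c /=; rewrite mulrA. Qed.
Fact coind1Z : left_id 1 coindZ.
Proof. by move=> x; apply: coind_inj => a /=; rewrite mulr1. Qed.
Fact coindZDr : right_distributive coindZ +%R.
Proof. by move=> a x y; apply: coind_inj. Qed.
Fact coindZDl x : {morph coindZ^~ x : a b / a + b}.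
Proof. by move=> a b; apply: coind_inj => c /=; rewrite mulrDr coadd. Qed.
HB.instance Definition _ := GRing.Zmodule_isLmodule.Build R coind
  coindZA coind1Z coindZDr coindZDl.

Lemma cofunD (f g : coind) a : cofun (f + g) a = cofun f a + cofun g a.
Proof. by []. Qed.
Lemma cofunZ r (f : coind) a : cofun (r *: f) a = cofun f (a * r).
Proof. by []. Qed.
End Coinduced.

(** * Maximal extensions of partial maps *)

Section MaximalRelations.
Variables (X Y : zmodType) (I : Type) (sX : I -> X -> X) (sY : I -> Y -> Y).

(** The operators are left general so that the same Zorn argument serves additive relations, with no
    operator, and linear ones, with the scalars as operators. *)
Definition orel (r : X -> Y -> Prop) : Prop :=
  [/\ r 0 0,
      forall x x' y y', r x y -> r x' y' -> r (x - x') (y - y')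
    & forall i x y, r x y -> r (sX i x) (sY i y)].

Lemma Zorn_rel (r0 : X -> Y -> Prop) :
  orel r0 -> (forall y, r0 0 y -> y = 0) ->
  exists r, [/\ orel r, forall y, r 0 y -> y = 0, forall x y, r0 x y -> r x y
    & forall r', orel r' -> (forall y, r' 0 y -> y = 0) ->
        (forall x y, r x y -> r' x y) -> forall x y, r' x y -> r x y].
Proof.
move=> o0 u0.
pose good (A : set (X * Y)) := [/\ orel (fun x y => A (x, y)),
  forall y, A (0, y) -> y = 0 & forall x y, r0 x y -> A (x, y)].
pose P (A : set (X * Y)) := (forall z, ~ A z) \/ good A.
have gP (A : set (X * Y)) z : P A -> A z -> good A.
  by case=> // nA Az; case: (nA z).
have [|A [PA mA]] := @Zorn_bigcup _ P.
  move=> F FP tot.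
  have [[A0 [F0 [z0 Az0]]]|nF] :=
      pselect (exists A, F A /\ exists z, A z); last first.
    by left=> z [A FA Az]; apply: nF; exists A; split=> //; exists z.
  have g0 := gP _ _ (FP _ F0) Az0.
  have common z z' : (\bigcup_(B in F) B)%classic z ->
      (\bigcup_(B in F) B)%classic z' -> exists B, [/\ F B, good B, B z & B z'].
    move=> [B FB Bz] [B' FB' Bz'].
    case: (tot _ _ FB FB') => sub.
      by exists B'; split; rewrite //; [apply: gP (FP _ FB') Bz'|apply: sub].
    by exists B; split; rewrite //; [apply: gP (FP _ FB) Bz|apply: sub].
  right; split.
  - split.
    + by exists A0 => //; case: g0 => [[]].
    + move=> x x' y y' h h'; have [B [FB [[_ DB _] _ _] Bz Bz']] := common _ _ h h'.
      by exists B => //; apply: DB.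
    + move=> i x y h; have [B [FB [[_ _ SB] _ _] Bz _]] := common _ _ h h.
      by exists B => //; apply: SB.
  - by move=> y h; have [B [FB [_ uB _] Bz _]] := common _ _ h h; apply: uB.
  - by move=> x y h; exists A0 => //; case: g0 => _ _; apply.
have gr0 : good (fun z => r0 z.1 z.2) by split.
have gA : good A.
  case: PA => // nA; exfalso; apply: (mA (fun z => r0 z.1 z.2)); last by right.
  split=> [z /nA //|] /(_ (0, 0)) H.
  by apply: (nA (0, 0)); apply: H; case: o0.
case: gA => oA uA sA; exists (fun x y => A (x, y)); split=> // r' o' u' AR x y rxy.
apply: contrapT => nAxy.
apply: (mA (fun z => r' z.1 z.2)); last first.
  by right; split=> // a b /sA; apply: AR.
split=> [[a b] /AR //|]; by move=> /(_ (x, y)) H; apply/nAxy/H.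
Qed.

End MaximalRelations.

(** [X] is a vector space over the prime field, so partial additive maps extend: in a maximal one,
    an element outside the domain could be sent to 0. *)
Lemma Fp_additive_extension (p : nat) (X Y : zmodType) (r0 : X -> Y -> Prop) :
  prime p -> (forall x : X, x *+ p = 0) ->
  r0 0 0 -> (forall x x' y y', r0 x y -> r0 x' y' -> r0 (x - x') (y - y')) ->
  (forall y, r0 0 y -> y = 0) ->
  exists f : X -> Y, (forall x x', f (x + x') = f x + f x') /\
    forall x y, r0 x y -> f x = y.
Proof.
move=> pp pX r00 r0B u0.
have [|r [[r_0 rB _] ur sr mr]] := @Zorn_rel X Y False (fun _ x => x)
  (fun _ y => y) r0 _ u0; first by split.
have rN x y : r x y -> r (- x) (- y).
  by move=> h; rewrite -[- x]add0r -[- y]add0r; apply: rB.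
have rD x x' y y' : r x y -> r x' y' -> r (x + x') (y + y').
  by move=> h /rN h'; have := rB _ _ _ _ h h'; rewrite !opprK.
have rMn x y n : r x y -> r (x *+ n) (y *+ n).
  move=> h; elim: n => [|n IH]; first by rewrite !mulr0n.
  by rewrite !mulrS; apply: rD.
have uniq x y y' : r x y -> r x y' -> y = y'.
  move=> h h'; apply/eqP; rewrite -subr_eq0; apply/eqP/ur.
  by rewrite -(subrr x); apply: rB.
have tot x : exists y, r x y.
  apply: contrapT => nx.
  pose r' z y := exists n z', z = z' + x *+ n /\ r z' y.
  have r'r z y : r z y -> r' z y by move=> h; exists 0%N, z; rewrite mulr0n addr0.
  suff : r x 0 by move=> h; apply: nx; exists 0.
  apply: (mr r') => //; last first.
  - by exists 1%N, 0; rewrite add0r mulr1n.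
  - move=> y [n [z' [E h]]].
    have [dpn|ndpn] := boolP (p %| n)%N.
      apply: ur; move: E; case/dvdnP: dpn => k ->.
      by rewrite mulnC mulrnA pX mul0rn addr0 => ->.
    (* If n x is in the domain with n prime to p, then so is x, by Bezout. *)
    have cop : coprime n p by rewrite coprime_sym prime_coprime.
    have n0 : (0 < n)%N by case: (n) ndpn; rewrite ?dvdn0.
    case: (egcdnP p n0) => km kn Ekm _; case: nx.
    have Ez : x *+ n = - z' by apply/eqP; rewrite -addr_eq0 addrC -E.
    exists (- (y *+ km)).
    have -> : x = (x *+ n) *+ km.
      rewrite -mulrnA mulnC Ekm mulrnDr (eqP cop) mulr1n.
      by rewrite mulnC mulrnA pX mul0rn add0r.
    by rewrite Ez mulNrn; apply/rN/rMn.
  - split; first exact: r'r.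
    + move=> z1 z2 y1 y2 [n1 [w1 [-> h1]]] [n2 [w2 [-> h2]]].
      (* As p x = 0, subtracting n2 x is adding n2 (p - 1) x, which keeps the multiple a natural
         number. *)
      exists (n1 + n2 * p.-1)%N, (w1 - w2); split; last exact: rB.
      have -> : x *+ (n1 + n2 * p.-1) = x *+ n1 - x *+ n2.
        rewrite mulrnDr; congr (_ + _); apply/eqP.
        rewrite -addr_eq0 -mulrnDr -{2}[n2]muln1 -mulnDr addn1.
        by rewrite prednK ?prime_gt0 // mulnC mulrnA pX mul0rn.
      by rewrite opprD addrACA.
    + by [].
have [f fP] := boolp.choice tot; exists f; split.
  by move=> x x'; apply: (uniq (x + x')) => //; apply: rD.
by move=> x y /sr; apply: uniq.
Qed.

(** * Injective modules, quotients and resolutions *)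

Section Injectives.
Variable R : comNzRingType.
Implicit Types X Y Z : lmodType R.

Definition extends X Y := forall r : X -> Y -> Prop,
  lrel r -> univalent r -> exists g : {linear X -> Y}, forall x y, r x y -> g x = y.

Lemma injective_moduleP (E : lmodType R) :
  injective_module E <-> forall X, extends X E.
Proof.
split=> [injE X r rr ur|H A B i f inji].
  have dU : lsub (fun x => exists y, r x y).
    split; first by exists 0; case: rr.
    by move=> a x x' [y ry] [y' ry']; exists (a *: y + y'); case: rr => _; apply.
  have [D [i [inji Di]]] := sub_exists dU.
  have [|||f fP] := @lrel_fun _ D E (fun d y => r (i d) y).
  - split; first by rewrite linear0; case: rr.
    by move=> a x x' y y' h h'; rewrite linearP; case: rr => _; apply.
  - by move=> d; apply/Di; exists d.
  - by move=> y; rewrite linear0; apply: ur.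
  - have [g gP] := injE D X i f inji.
    exists g => x y rxy.
    have [|d E'] := (Di x).1; first by exists y.
    by rewrite -E' gP; apply/fP; rewrite E'.
have [||g gP] := H B (fun b e => exists a, i a = b /\ f a = e).
- split; first by exists 0; rewrite !linear0.
  by move=> a _ _ _ _ [x [<- <-]] [y [<- <-]]; exists (a *: x + y); rewrite !linearP.
- by move=> e [a [+ <-]]; rewrite -(linear0 i) => /inji ->; rewrite linear0.
- by exists g => a; apply: gP; exists a.
Qed.

Section Char.
Variables (p : nat) (charRp : p \in [pchar R]).

Lemma char_lmod X (x : X) : x *+ p = 0.
Proof. by rewrite -scaler_nat (pcharf0 charRp) scale0r. Qed.

(** Evaluation at 1 identifies linear maps to the coinduced module with additive maps to [Y], and
    additive maps extend in characteristic p. *)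
Lemma coind_injective (Y : lmodType R) : injective_module (coind R Y : lmodType R).
Proof.
apply/injective_moduleP => X r rr ur.
have r1 x e a : r x e -> r (a *: x) (a *: e) by apply: lrelZ.
have [|||||f [fD fP]] := @Fp_additive_extension p X Y
  (fun x y => exists2 e, r x e & cofun e 1 = y).
- exact: pcharf_prime charRp.
- exact: char_lmod.
- by exists 0 => //; case: rr.
- move=> x x' _ _ [e h <-] [e' h' <-]; exists (e - e') => //.
  exact: lrelB.
- by move=> y [e /ur -> <-].
have gD x a b : f ((a + b) *: x) = f (a *: x) + f (b *: x).
  by rewrite scalerDl fD.
have [|g gE] := @lin_exists _ X (coind R Y) (fun x => Coind (gD x)).
  move=> a x y; apply: coind_inj => c.
  by rewrite cofunD cofunZ /= scalerDr fD scalerA.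
exists g => x e rxe; rewrite gE; apply: coind_inj => a /=.
apply: fP; exists (a *: e); first exact: r1.
by rewrite cofunZ mul1r.
Qed.

Lemma coind_unit X : exists f : {linear X -> coind R X},
  forall x a, cofun (f x) a = a *: x.
Proof.
have cD (x : X) a b : (a + b) *: x = a *: x + b *: x by rewrite scalerDl.
have [|f fE] := @lin_exists _ X (coind R X) (fun x => Coind (cD x)).
  by move=> a x y; apply: coind_inj => c; rewrite cofunD cofunZ /= scalerDr scalerA.
by exists f => x a; rewrite fE.
Qed.

(** With an additive retraction s of X onto U, the linear map x |-> (c |-> c x - s (c x)) has kernel
    U, as evaluation at 1 shows. Quotients are then images of such maps, and no cosets are
    formed. *)
Lemma coind_kernel X (U : set X) : lsub U ->
  exists (Y : lmodType R) (f : {linear X -> coind R Y}), forall x, f x = 0 <-> U x.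
Proof.
move=> UU; have [Y [i [inji Ui]]] := sub_exists UU.
have [|||||s [sD sP]] := @Fp_additive_extension p X Y (fun x y => i y = x).
- exact: pcharf_prime charRp.
- exact: char_lmod.
- by rewrite linear0.
- by move=> x x' y y' <- <-; rewrite linearB.
- by move=> y; rewrite -(linear0 i) => /inji.
have [h hE] := coind_unit X; exists X.
have qD x a b : (fun c : R => c *: x - i (s (c *: x))) (a + b) =
    (a *: x - i (s (a *: x))) + (b *: x - i (s (b *: x))).
  by rewrite /= scalerDl sD linearD opprD addrACA.
have [|f fE] := @lin_exists _ X (coind R X) (fun x => Coind (qD x)).
  move=> a x y; apply: coind_inj => c.
  by rewrite cofunD cofunZ /= scalerDr sD linearD opprD addrACA scalerA.
exists f => x; rewrite fE; split=> [E|Ux].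
  have := congr1 (fun g => cofun g 1) E; rewrite /= scale1r => /eqP.
  by rewrite subr_eq0 => /eqP ->; apply/Ui; eexists.
apply: coind_inj => a /=; have [|y Ey] := (Ui (a *: x)).1; first exact: lsubZ.
by rewrite (sP _ _ Ey) Ey subrr.
Qed.

Lemma quot_exists X (U : set X) : lsub U ->
  exists (Y : lmodType R) (f : {linear X -> Y}),
    (forall y, exists x, f x = y) /\ forall x, f x = 0 <-> U x.
Proof.
move=> UU; have [Y [f fE]] := coind_kernel UU.
have [Z [i [inji Zi]]] := sub_exists (lsub_im f (@lsubT _ X)).
have [||y|g gP] := @lrel_fun _ X Z (fun x z => i z = f x).
- split; first by rewrite !linear0.
  by move=> a x x' z z' Ez Ez'; rewrite !linearP Ez Ez'.
- by move=> x; apply/Zi; exists x.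
- by rewrite linear0 -(linear0 i) => /inji.
exists Z, g; split=> [z|x].
  by have [|x _ Ex] := (Zi (i z)).2; [exists z|exists x; apply/gP].
rewrite -fE; have := gP x 0; rewrite linear0 => -[h1 h2].
by split=> [/h2|/esym].
Qed.

(* An injective resolution exists since every module embeds in a coinduced
   one, and every submodule is the kernel of a map to a coinduced module. *)
Lemma injective_resolution_exists X : inhabited (injective_resolution X).
Proof.
have [aug augE] := coind_unit X.
have aug0 : injective aug.
  apply: lin_inj => x /(congr1 (fun g => cofun g 1)).
  by rewrite /= augE scale1r.
pose st := {A : lmodType R & {B : lmodType R & {linear A -> coind R B}}}.
have cok (A B : lmodType R) (f : {linear A -> coind R B}) :
  {C : lmodType R & {g : {linear coind R B -> coind R C} |
     forall x, g x = 0 <-> exists y, f y = x}}.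
  have := cid (coind_kernel (lsub_im f (@lsubT _ A))) => -[C /cid[g gP]].
  exists C; exists g => x; rewrite gP; split=> [[y _ <-]|[y <-]]; by exists y.
pose next (s : st) : st :=
  existT _ (coind R (projT1 (projT2 s)) : lmodType R)
    (existT _ (projT1 (cok _ _ (projT2 (projT2 s))))
      (sval (projT2 (cok _ _ (projT2 (projT2 s)))))).
pose s0 : st := existT _ X (existT _ X aug).
pose s n := iter n next s0.
pose obj n : lmodType R := coind R (projT1 (projT2 (s n))).
pose d n : {linear obj n -> obj n.+1} :=
  sval (projT2 (cok _ _ (projT2 (projT2 (s n))))).
have dP n x : d n x = 0 <-> exists y, projT2 (projT2 (s n)) y = x.
  exact: (svalP (projT2 (cok _ _ (projT2 (projT2 (s n)))))).
exists; apply: (@InjRes R X obj (aug : {linear X -> obj 0%N}) d) => //.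
by move=> i; apply: coind_injective.
Qed.

End Char.
End Injectives.

(** * Counting subquotients isomorphic to a given module *)

Section Jumps.
Variables (R : comNzRingType) (S : lmodType R).
Implicit Types X Y : lmodType R.

(* [S] is a subquotient of [U' / U]. *)
Definition jump X (U U' : set X) : Prop := exists r : X -> S -> Prop,
  [/\ lrel r, forall x s, r x s -> U' x, forall s, exists x, r x s
    & forall x s, U x -> r x s -> s = 0].

(** For S = R/Q with Q prime, the largest possible [k] is the length at Q of U'/U. *)
Inductive jumps X : set X -> set X -> nat -> Prop :=
| jumps0 U U' : lsub U -> lsub U' -> (forall x, U x -> U' x) -> jumps U U' 0
| jumpsS U U' U'' k : jumps U U' k -> lsub U'' -> (forall x, U' x -> U'' x) ->
    jump U' U'' -> jumps U U'' k.+1.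

Definition zero_set X : set X := fun x => x = 0.

Definition length_le X (Z : set X) (k : nat) : Prop := forall Z' l,
  (forall x, Z' x -> Z x) -> jumps (@zero_set X) Z' l -> (l <= k)%N.

Lemma jumps_lsub X (U U' : set X) k : jumps U U' k ->
  [/\ lsub U, lsub U' & forall x, U x -> U' x].
Proof.
elim=> {U U' k} [U U' lU lU' sub|U U' U'' k _ [lU lU' sub] lU'' sub' _]; split=> //.
by move=> x /sub/sub'.
Qed.

Lemma jump_mono X (U0 U U' U1 : set X) : (forall x, U0 x -> U x) ->
  (forall x, U' x -> U1 x) -> jump U U' -> jump U0 U1.
Proof.
move=> s0 s1 [r [rr d o k]]; exists r; split=> // x s; first by move/d/s1.
by move/s0; apply: k.
Qed.

Lemma jumps_weakr X (U U' U'' : set X) k : lsub U'' -> (forall x, U' x -> U'' x) ->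
  jumps U U' k -> jumps U U'' k.
Proof.
move=> l'' + h; case: h => {U U' k} [U U' lU lU' sub|U U' V k h lV sub j] sub'.
  by apply: jumps0 => // x /sub/sub'.
apply: jumpsS h _ _ _ => //; first by move=> x /sub/sub'.
exact: jump_mono j.
Qed.

Lemma jumps_weakl X (U0 U U' : set X) k : lsub U0 -> (forall x, U0 x -> U x) ->
  jumps U U' k -> jumps U0 U' k.
Proof.
move=> l0 + h; elim: h => {U U' k} [U U' lU lU' sub|U U' V k h IH lV sub j] s0.
  by apply: jumps0 => // x /s0/sub.
by apply: jumpsS lV sub j; apply: IH.
Qed.

Lemma jumps_trans X (U U' U'' : set X) k l :
  jumps U U' k -> jumps U' U'' l -> jumps U U'' (k + l).
Proof.
move=> h1 h2; elim: h2 h1 => {U' U'' l} [U' U'' l' l'' sub|U' V W l _ IH lW sub j] h1.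
  by rewrite addn0; apply: jumps_weakr h1.
by rewrite addnS; apply: jumpsS lW sub j; apply: IH.
Qed.

Lemma jumps1 X (U U' : set X) : lsub U -> lsub U' -> (forall x, U x -> U' x) ->
  jump U U' -> jumps U U' 1.
Proof. by move=> lU lU' sub j; apply: (@jumpsS _ _ U) => //; apply: jumps0. Qed.

Lemma length_leW X (Z Z' : set X) k k' : (forall x, Z x -> Z' x) -> (k' <= k)%N ->
  length_le Z' k' -> length_le Z k.
Proof.
by move=> sub kk h V l sV /h H; apply: leq_trans kk; apply: H => x /sV/sub.
Qed.

(* An object that cannot be cut: it remains a subquotient of one of the two
   pieces of any extension of which it is a subquotient. *)
Definition uncuttable : Prop := forall U : set S, lsub U ->
  jump (@zero_set S) U \/ jump U (fun _ => True).

(** Let S1 be the image in S of the elements congruent modulo U to elements of the kernel of f. Then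
    S1 is a subquotient of the kernel part of U'/U, and S/S1 one of its image under f; S sits in S1
    or in S/S1. *)
Lemma jump_split X Y (f : {linear X -> Y}) (U U' : set X) : uncuttable ->
  lsub U -> lsub U' -> (forall x, U x -> U' x) -> jump U U' ->
  jump (fun x => U x /\ f x = 0) (fun x => U' x /\ f x = 0) \/
  jump (fun y => exists2 x, U x & f x = y) (fun y => exists2 x, U' x & f x = y).
Proof.
move=> unc lU lU' sub [r [rr d o k]].
pose S1 s := exists x n, [/\ r x s, U n & f (x - n) = 0].
have lS1 : lsub S1.
  split; first by exists 0, 0; rewrite subrr linear0; split; [case: rr|case: lU|].
  move=> a s s' [x [n [h Un E]]] [x' [n' [h' Un' E']]].
  exists (a *: x + x'), (a *: n + n'); split.
  - by case: rr => _; apply.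
  - by case: lU => _; apply.
  - by rewrite opprD addrACA -scalerBr linearP E E' scaler0 addr0.
case: (unc _ lS1) => [[t [tr td to tk]]|[t [tr _ to tk]]]; [left|right].
  exists (fun w s' => exists x n s, [/\ r x s, U n, w = x - n, f w = 0 & t s s']).
  split.
  - split.
      exists 0, 0, 0; rewrite subrr linear0.
      by split=> //; [case: rr|case: lU|case: tr].
    move=> a w w' s s' [x [n [v [h Un -> E e]]]] [x' [n' [v' [h' Un' -> E' e']]]].
    exists (a *: x + x'), (a *: n + n'), (a *: v + v'); split.
    + by case: rr => _; apply.
    + by case: lU => _; apply.
    + by rewrite opprD addrACA -scalerBr.
    + by rewrite linearP E E' scaler0 addr0.
    + by case: tr => _; apply.
  - move=> w s' [x [n [s [h Un -> E _]]]]; split=> //.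
    by apply: lsubB => //; [apply: d h|apply: sub].
  - move=> s'; have [s e] := to s'; have [x [n [h Un E]]] := td _ _ e.
    by exists (x - n), x, n, s.
  - move=> w s' [Uw _] [x [n [s [h Un E _ e]]]]; apply: (tk s) => //.
    apply: k h; rewrite -[x](subrK n) -E; exact: lsubD.
exists (fun y s' => exists x s, [/\ r x s, f x = y & t s s']); split.
- split; first by exists 0, 0; rewrite linear0; split=> //; [case: rr|case: tr].
  move=> a w w' s s' [x [v [h <- e]]] [x' [v' [h' <- e']]].
  exists (a *: x + x'), (a *: v + v'); split; rewrite ?linearP //.
    by case: rr => _; apply.
  by case: tr => _; apply.
- by move=> y s' [x [s [h <- _]]]; exists x => //; apply: d h.
- by move=> s'; have [s e] := to s'; have [x h] := o s; exists (f x), x, s.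
- move=> y s' [n Un <-] [x [s [h E e]]]; apply: (tk s) e.
  by exists x, n; split=> //; apply: linB.
Qed.

Lemma jumps_split X Y (f : {linear X -> Y}) (U U' : set X) k : uncuttable ->
  jumps U U' k -> exists a b, [/\ (k <= a + b)%N,
    jumps (fun x => U x /\ f x = 0) (fun x => U' x /\ f x = 0) a
  & jumps (fun y => exists2 x, U x & f x = y) (fun y => exists2 x, U' x & f x = y) b].
Proof.
move=> unc; elim=> {U U' k} [U U' lU lU' sub|U U' V k h IH lV sub j].
  exists 0%N, 0%N; split=> //; apply: jumps0; try exact: lsub_im;
    try by apply: lsubI => //; apply: lsub_ker.
    by move=> x [/sub].
  by move=> y [x /sub Ux <-]; exists x.
have [lU lU' sub0] := jumps_lsub h; have [a [b [kab ha hb]]] := IH.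
have lk : lsub (fun x => V x /\ f x = 0) by apply: lsubI => //; apply: lsub_ker.
have sk x : U' x /\ f x = 0 -> V x /\ f x = 0 by case=> /sub.
have si y : (exists2 x, U' x & f x = y) -> exists2 x, V x & f x = y.
  by case=> x /sub Ux <-; exists x.
case: (jump_split f unc lU' lV sub j) => j'.
  exists a.+1, b; split; first by rewrite addSn.
    exact: jumpsS ha lk sk j'.
  by apply: jumps_weakr hb => //; apply: lsub_im.
exists a, b.+1; split; first by rewrite addnS.
  exact: jumps_weakr ha.
by apply: jumpsS hb _ si j'; apply: lsub_im.
Qed.

Lemma length_le_add X Y (f : {linear X -> Y}) (Z : set X) a b : uncuttable ->
  length_le (fun x => Z x /\ f x = 0) a ->
  length_le (fun y => exists2 x, Z x & f x = y) b -> length_le Z (a + b).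
Proof.
move=> unc ha hb Z' l sub h.
have [a' [b' [le ja jb]]] := jumps_split f unc h.
apply: leq_trans le _; apply: leq_add.
  apply: ha (jumps_weakl _ _ ja); rewrite ?/zero_set; first by move=> x [/sub].
    exact: lsub0.
  by move=> x ->; rewrite linear0.
apply: hb (jumps_weakl _ _ jb); first by move=> y [x /sub Zx <-]; exists x.
  exact: lsub0.
by move=> y ->; exists 0; rewrite ?linear0.
Qed.

Lemma jumps_pull X Y (f : {linear X -> Y}) (Z : set X) (V V' : set Y) k :
  lsub Z -> (forall y, V' y -> exists2 x, Z x & f x = y) -> jumps V V' k ->
  jumps (fun x => Z x /\ V (f x)) (fun x => Z x /\ V' (f x)) k.
Proof.
move=> lZ + h; elim: h => {V V' k} [V V' lV lV' sub|V V' W k h IH lW sub j] o.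
  apply: jumps0; try by apply: lsubI => //; apply: lsub_pre.
  by move=> x [Zx /sub].
have [lV lV' sub0] := jumps_lsub h.
apply: jumpsS (IH _) _ _ _; first by move=> y /sub/o.
- by apply: lsubI => //; apply: lsub_pre.
- by move=> x [Zx /sub].
have [r [rr d ro k']] := j; exists (fun x s => Z x /\ r (f x) s); split.
- split; first by rewrite linear0; split; [case: lZ|case: rr].
  move=> a x x' s s' [Zx h1] [Zx' h2]; rewrite linearP.
  by split; [case: lZ => _; apply|case: rr => _; apply].
- by move=> x s [Zx /d].
- by move=> s; have [y h1] := ro s; have [x Zx E] := o _ (d _ _ h1); exists x; rewrite E.
- by move=> x s [_ Vx] [_]; apply: k'.
Qed.

Lemma jumps_push X Y (f : {linear X -> Y}) (U U' : set X) k :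
  (forall x, U' x -> f x = 0 -> x = 0) -> jumps U U' k ->
  jumps (fun y => exists2 x, U x & f x = y) (fun y => exists2 x, U' x & f x = y) k.
Proof.
move=> + h; elim: h => {U U' k} [U U' lU lU' sub|U U' W k h IH lW sub j] inj.
  apply: jumps0; try exact: lsub_im.
  by move=> y [x /sub Ux <-]; exists x.
apply: jumpsS (IH _) _ _ _; first by move=> x /sub/inj.
- exact: lsub_im.
- by move=> y [x /sub Ux <-]; exists x.
have [r [rr d ro k']] := j; exists (fun y s => exists2 x, r x s & f x = y); split.
- split; first by exists 0; rewrite ?linear0 //; case: rr.
  move=> a _ _ s s' [x h1 <-] [x' h2 <-]; exists (a *: x + x'); rewrite ?linearP //.
  by case: rr => _; apply.
- by move=> y s [x /d Wx <-]; exists x.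
- by move=> s; have [x h1] := ro s; exists (f x), x.
- move=> y s [u Uu <-] [x h1 E]; apply: (k' x _ _ h1).
  suff -> : x = u by [].
  apply/eqP; rewrite -subr_eq0; apply/eqP/inj; last exact: linB.
  by apply: lsubB => //; [apply: d h1|apply: sub].
Qed.

Lemma length_le_inj X Y (f : {linear X -> Y}) (Z : set X) k :
  (forall x, Z x -> f x = 0 -> x = 0) ->
  length_le (fun y => exists2 x, Z x & f x = y) k -> length_le Z k.
Proof.
move=> inj h Z' l sub /(jumps_push (f := f)) hj; apply: h (jumps_weakl _ _ (hj _)).
- by move=> y [x /sub Zx <-]; exists x.
- exact: lsub0.
- by move=> y ->; exists 0; rewrite ?linear0.
- by move=> x /sub; apply: inj.
Qed.

Lemma length_le_im X Y (f : {linear X -> Y}) (Z : set X) k : lsub Z ->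
  length_le Z k -> length_le (fun y => exists2 x, Z x & f x = y) k.
Proof.
move=> lZ h Z' l sub /(jumps_pull lZ sub) hj; apply: h (jumps_weakl _ _ hj).
- by move=> y [].
- exact: lsub0.
- by move=> x ->; rewrite linear0; split=> //; case: lZ.
Qed.

Lemma jumps_add X Y (f : {linear X -> Y}) (U U' Z : set X) (V V' : set Y) a b :
  lsub Z -> (forall x, U' x -> Z x /\ f x = 0) ->
  (forall y, V' y -> exists2 x, Z x & f x = y) ->
  jumps U U' a -> jumps V V' b -> jumps U Z (a + b).
Proof.
move=> lZ sU o ha hb; have [lV lV' _] := jumps_lsub hb.
have hb' := jumps_pull lZ o hb; have [l1 l2 _] := jumps_lsub hb'.
apply: (jumps_trans (U' := fun x => Z x /\ V (f x))); last first.
  by apply: jumps_weakr hb' => // x [].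
apply: jumps_weakr ha => // x /sU[Zx ->]; split=> //; by case: lV.
Qed.

End Jumps.

(** * Subquotients *)

Section Subquotients.
Variable R : comNzRingType.
Implicit Types X Y : lmodType R.

Definition sq X Y : Prop := exists r : X -> Y -> Prop,
  [/\ lrel r, forall y, exists x, r x y & univalent r].

Lemma sq_jump X Y : sq X Y -> jump Y (@zero_set R X) (fun _ => True).
Proof. by case=> r [rr o u]; exists r; split=> // x s ->; apply: u. Qed.

Lemma sq_trans X Y Z : sq X Y -> sq Y Z -> sq X Z.
Proof.
case=> r [rr ro ru] [t [tr to tu]].
exists (fun x z => exists2 y, r x y & t y z); split.
- split; first by exists 0; [case: rr|case: tr].
  move=> a x x' z z' [y h1 h2] [y' h1' h2']; exists (a *: y + y').
    by case: rr => _; apply.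
  by case: tr => _; apply.
- by move=> z; have [y h] := to z; have [x h'] := ro y; exists x, y.
- by move=> z [y /ru ->]; apply: tu.
Qed.

Lemma sq_inj X Y (f : {linear Y -> X}) : injective f -> sq X Y.
Proof.
move=> inj; exists (fun x y => f y = x); split.
- split; first by rewrite linear0.
  by move=> a x x' y y' <- <-; rewrite linearP.
- by move=> y; exists (f y).
- by move=> y; rewrite -(linear0 f) => /inj.
Qed.

Lemma sq_surj X Y (f : {linear X -> Y}) : (forall y, exists x, f x = y) -> sq X Y.
Proof.
move=> o; exists (fun x y => f x = y); split=> //.
- split; first by rewrite linear0.
  by move=> a x x' y y' <- <-; rewrite linearP.
- by move=> y; rewrite linear0.
Qed.

Lemma sq_refl X : sq X X.
Proof. by apply: (@sq_inj _ _ idfun). Qed.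

End Subquotients.

(** * Chains of submodules under restriction of scalars *)

Section Restriction.
Variables (R : comNzRingType) (phi : {rmorphism R -> R}).
Implicit Types X Y S T : lmodType R.

Lemma restrictE X (a : R) (x : X) : a *: (x : restrict phi X) = phi a *: x.
Proof. by []. Qed.

Lemma lsub_restrict X (U : set X) : lsub U -> lsub (U : set (restrict phi X)).
Proof. by move=> [U0 UD]; split=> // a x y; apply: UD. Qed.

Lemma lrel_restrict X Y (r : X -> Y -> Prop) : lrel r ->
  lrel (r : restrict phi X -> restrict phi Y -> Prop).
Proof. by move=> [r0 rD]; split=> // a x x' y y'; apply: rD. Qed.

Lemma lin_restrict X Y (f : {linear X -> Y}) :
  exists g : {linear restrict phi X -> restrict phi Y}, forall x : X, g x = f x.
Proof.
have [|g gE] := @lin_exists R (restrict phi X) (restrict phi Y) (fun x => f (x : X)).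
  by move=> a x y; rewrite restrictE -linearP.
by exists g => x; rewrite gE.
Qed.

(** Each step has the restriction of S as a subquotient, and the chain of [r] steps in the latter is
    pulled back into it. *)
Lemma jumps_restrict S T X (U U' : set X) k r : jumps S U U' k ->
  jumps T (@zero_set R (restrict phi S)) (fun _ => True) r ->
  jumps T (U : set (restrict phi X)) (U' : set (restrict phi X)) (k * r).
Proof.
move=> h hr; elim: h => {U U' k} [U U' lU lU' sub|U U' V k h IH lV sub j].
  by rewrite mul0n; apply: jumps0 => //; apply: lsub_restrict.
rewrite mulSn addnC; apply: jumps_trans IH _.
have [_ lU' _] := jumps_lsub h; have [q [qr qd qo qk]] := j.
pose G (A : set (restrict phi S)) (x : restrict phi X) :=
  exists n s, [/\ U' n, A s & q ((x : X) - n) s].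
have scE (a : R) (x x' : restrict phi X) (n n' : X) :
    (a *: x + x' : X) - (phi a *: n + n') = phi a *: ((x : X) - n) + ((x' : X) - n').
  by rewrite restrictE [in RHS]scalerBr opprD [RHS]addrACA.
have lG A : lsub A -> lsub (G A).
  move=> [A0 AD]; split.
    by exists 0, 0; rewrite subrr; split; [case: lU'| |case: qr].
  move=> a x x' [n [s [Un As h1]]] [n' [s' [Un' As' h1']]].
  exists (phi a *: n + n'), (a *: s + s'); split.
  - by case: lU' => _; apply.
  - exact: AD.
  - by rewrite scE; apply: (proj2 qr).
have uni x n n' s s' : U' n -> U' n' -> q (x - n) s -> q (x - n') s' -> s = s'.
  move=> Un Un' h1 h2; apply/eqP; rewrite -subr_eq0; apply/eqP.
  apply: (qk (n' - n)); first exact: lsubB.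
  by have := lrelB qr h1 h2; rewrite opprB addrC subrKA.
suff HG A B l : jumps T A B l -> jumps T (G A) (G B) l.
  apply: jumps_weakl (jumps_weakr _ _ (HG _ _ _ hr)).
  - exact: lsub_restrict.
  - move=> x Ux; exists x, 0; rewrite subrr; split=> //; by case: qr.
  - exact: lsub_restrict.
  - move=> x [n [s [/sub Un _ /qd Vx]]].
    by rewrite -[x](subrK (n : restrict phi X)); apply: (lsubD lV).
elim=> {A B l} [A B lA lB sAB|A B C l h1 IH1 lC sBC [t [tr td to tk]]].
  apply: jumps0; try exact: lG.
  by move=> x [n [s [Un /sAB Bs h2]]]; exists n, s.
apply: jumpsS IH1 (lG _ lC) _ _.
  by move=> x [n [s [Un /sBC Bs h2]]]; exists n, s.
exists (fun x w => exists n (s : restrict phi S), [/\ U' n, q ((x : X) - n) s & t s w]); split.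
- split.
    by exists 0, 0; rewrite subrr; split; [case: lU'|case: qr|case: tr].
  move=> a x x' w w' [n [s [Un h2 h3]]] [n' [s' [Un' h2' h3']]].
  exists (phi a *: n + n'), (a *: s + s'); split.
  - by case: lU' => _; apply.
  - by rewrite scE; apply: (proj2 qr).
  - by case: tr => _; apply.
- by move=> x w [n [s [Un h2 /td Cs]]]; exists n, s.
- move=> w; have [s hs] := to w; have [x hx] := qo s.
  by exists x, 0, s; rewrite subr0; split=> //; case: lU'.
- move=> x w [n [s [Un Bs h2]]] [n' [s' [Un' h2' h3]]].
  by apply: tk h3; rewrite -(uni _ _ _ _ _ Un Un' h2 h2').
Qed.

End Restriction.

(** * Primes and generic rank *)

Section Noetherian.
Variable R : comNzRingType.
Implicit Types (X Y N M : lmodType R) (I J Q : set R).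

Definition ideal I : Prop := @lsub R R^o I.

Definition primeI Q : Prop :=
  [/\ ideal Q, ~ Q 1 & forall a b, Q (a * b) -> Q a \/ Q b].

Definition cyclic_mod Q N : Prop := exists g : N,
  (forall x, exists r, x = r *: g) /\ forall r, r *: g = 0 <-> Q r.

Lemma idealM I a x : ideal I -> I x -> I (a * x).
Proof. exact: lsubZ. Qed.

Lemma ideal_ann N (x : N) : ideal (fun a => a *: x = 0).
Proof.
split; first exact: scale0r.
by move=> a b c E E'; rewrite scalerDl -[a *: b]/(a * b) -scalerA E E' scaler0 addr0.
Qed.

Hypothesis noeth : noetherian_ring R.

Lemma ideal_fg I : ideal I -> exists (k : nat) (g : 'I_k -> R),
  (forall i, I (g i)) /\ forall x, I x -> exists c : 'I_k -> R, x = \sum_(i < k) c i * g i.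
Proof.
move=> [I0 ID]; pose P : {pred R^o} := fun x => `[<I x>].
have [|k [g gP]] := noeth (I := P).
  split; first exact/asboolP.
  by move=> a x y /asboolP Ix /asboolP Iy; apply/asboolP/ID.
exists k, g; split=> [i|x Ix]; last exact/gP/asboolP.
apply/asboolP/(gP (g i)); exists (fun j => (j == i)%:R).
rewrite (bigD1 i) //= eqxx mul1r big1 ?addr0 // => j /negbTE ->.
by rewrite mul0r.
Qed.

Lemma ideal_acc (I : nat -> set R) : (forall n, ideal (I n)) ->
  (forall n x, I n x -> I n.+1 x) -> exists n0, forall n x, I n x -> I n0 x.
Proof.
move=> iI up.
have upn n d x : I n x -> I (n + d)%N x.
  by elim: d => [|d IH] Ix; rewrite ?addn0 // addnS; apply/up/IH.
have upl n n' x : (n <= n')%N -> I n x -> I n' x.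
  by move=> le; rewrite -(subnKC le); apply: upn.
have [|k [g [gI gP]]] := @ideal_fg (fun x => exists n, I n x).
  split; first by exists 0%N; case: (iI 0%N).
  move=> a x y [n Ix] [n' Iy]; exists (maxn n n').
  by case: (iI (maxn n n')) => _; apply; [apply: upl Ix|apply: upl Iy]; lia.
have [n nP] := boolp.choice gI.
exists (\max_i n i)%N => n' x Ix; have [|c ->] := gP x; first by exists n'.
apply: (@lsub_sum R R^o (I _)); first exact: iI.
by move=> i; apply: idealM => //; apply: upl (nP i); apply: leq_bigmax.
Qed.

Lemma noeth_ind (Pi : set R -> Prop) :
  (forall I, ideal I -> (forall J, ideal J -> (forall x, I x -> J x) ->
     (exists x, J x /\ ~ I x) -> Pi J) -> Pi I) ->
  forall I, ideal I -> Pi I.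
Proof.
move=> H I0 iI0; apply: contrapT => nI0.
pose T := {I : set R | ideal I /\ ~ Pi I}.
have next (t : T) : {t' : T | (forall x, sval t x -> sval t' x) /\
    exists x, sval t' x /\ ~ sval t x}.
  apply/cid; case: t => I [iI nI] /=; apply: contrapT => nex; apply: nI.
  apply: H => // J iJ IJ ex; apply: contrapT => nJ; apply: nex.
  by exists (exist _ J (conj iJ nJ)).
pose s n := iter n (fun t => sval (next t)) (exist _ I0 (conj iI0 nI0) : T).
have [|n x|N HN] := @ideal_acc (fun n => sval (s n)).
- by move=> n; case: (svalP (s n)).
- by case: (svalP (next (s n))) => + _; apply.
- case: (svalP (next (s N))) => _ [x [Jx]]; apply.
  exact: (HN N.+1).
Qed.

Variables (p : nat) (charRp : p \in [pchar R]).

(** Noetherian induction on the annihilator I of a cyclic module: if I contains a b but neither a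
    nor b, then a g generates a module with annihilator (I : a), and the quotient by it has
    annihilator I + (a). [A0] records scalars that kill M, which all the primes met must contain. *)
Lemma devissage (Pi : lmodType R -> Prop) (A0 : set R) :
  (forall (A B C : lmodType R) (i : {linear A -> B}) (q : {linear B -> C}),
    injective i -> (forall c, exists b, q b = c) ->
    (forall b, q b = 0 <-> exists a, i a = b) -> Pi A -> Pi C -> Pi B) ->
  (forall N, (forall x : N, x = 0) -> Pi N) ->
  (forall Q N, primeI Q -> (forall a, A0 a -> Q a) -> cyclic_mod Q N -> Pi N) ->
  forall M, (forall a (x : M), A0 a -> a *: x = 0) -> fin_gen M -> Pi M.
Proof.
move=> ses zero prim.
have cyc I : ideal I -> forall N, (forall a, A0 a -> I a) -> cyclic_mod I N -> Pi N.
  move: I; apply: noeth_ind => I iI IH N AI [g [gen ann]].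
  have [pI|npI] := pselect (primeI I).
    by apply: prim AI _ => //; exists g.
  have [I1|nI1] := pselect (I 1).
    apply: zero => x; have [r ->] := gen x.
    by rewrite -[g]scale1r (ann 1).2 // scaler0.
  have [a [b [Iab nIa nIb]]] : exists a b, [/\ I (a * b), ~ I a & ~ I b].
    apply: contrapT => nex; apply: npI; split=> // a b Iab.
    apply: contrapT => /not_orP[nIa nIb]; apply: nex; by exists a, b.
  have [Y [i [inji iP]]] := sub_exists (lsub_cyc (a *: g)).
  have [Z [f [fo fP]]] := quot_exists charRp (lsub_cyc (a *: g)).
  have [|y0 y0P] := (iP (a *: g)).1; first by exists 1; rewrite scale1r.
  have ir r : i (r *: y0) = (r * a) *: g by rewrite linearZ /= y0P scalerA.
  apply: (ses _ _ _ i f inji fo).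
  - by move=> x; rewrite fP; apply: iP.
  - apply: (IH (fun r => I (r * a))).
    + split; first by rewrite mul0r; case: iI.
      move=> c x y Ix Iy; rewrite mulrDl -[c *: x]/(c * x) -mulrA.
      by case: iI => _; apply.
    + by move=> x Ix; rewrite mulrC; apply: idealM.
    + by exists b; rewrite mulrC.
    + by move=> c /AI Ic; rewrite mulrC; apply: idealM.
    + exists y0; split=> [y|r].
        have [|r Er] := (iP (i y)).2; first by exists y.
        by exists r; apply: inji; rewrite ir Er scalerA.
      by rewrite -ann -ir; split=> [->|]; [rewrite linear0|rewrite -(linear0 i) => /inji].
  - have Jann r : r *: f g = 0 <-> exists s, I (r - s * a).
      rewrite -linearZ /= fP; split=> [[s E]|[s /ann]].
        by exists s; apply/ann; rewrite scalerBl E scalerA subrr.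
      by rewrite scalerBl -scalerA => /eqP; rewrite subr_eq0 => /eqP ->; exists s.
    apply: (IH (fun r => exists s, I (r - s * a))).
    + split; first by exists 0; rewrite mul0r subr0; case: iI.
      move=> c x y [s Is] [t It]; exists (c * s + t).
      rewrite mulrDl opprD addrACA -mulrA -mulrBr.
      by case: iI => _; apply.
    + by move=> x Ix; exists 0; rewrite mul0r subr0.
    + by exists a; split=> //; exists 1; rewrite mul1r subrr; case: iI.
    + by move=> c /AI Ic; exists 0; rewrite mul0r subr0.
    + exists (f g); split=> // z; have [x <-] := fo z; have [r ->] := gen x.
      by exists r; rewrite linearZ.
move=> M AM [k [g gP]]; elim: k M AM g gP => [|k IH] M AM g gP.
  by apply: zero => x; have [c ->] := gP x; rewrite big_ord0.
have [Y [i [inji iP]]] := sub_exists (lsub_cyc (g ord0)).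
have [Z [f [fo fP]]] := quot_exists charRp (lsub_cyc (g ord0)).
apply: (ses _ _ _ i f inji fo).
- by move=> x; rewrite fP; apply: iP.
- have [|y0 y0P] := (iP (g ord0)).1; first by exists 1; rewrite scale1r.
  have ir r : i (r *: y0) = r *: g ord0 by rewrite linearZ /= y0P.
  apply: (cyc _ (ideal_ann (g ord0))); first by move=> a; apply: AM.
  exists y0; split=> [y|r].
    have [|r Er] := (iP (i y)).2; first by exists y.
    by exists r; apply: inji; rewrite ir.
  by rewrite -ir; split=> [->|]; [rewrite linear0|rewrite -(linear0 i) => /inji].
- apply: (IH _ _ (fun j => f (g (lift ord0 j)))).
    by move=> a z Aa; have [x <-] := fo z; rewrite -linearZ AM ?linear0.
  move=> z; have [x <-] := fo z; have [c ->] := gP x.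
  exists (fun j => c (lift ord0 j)); rewrite linear_sum big_ord_recl /=.
  rewrite (fP _).2 ?add0r; last by exists (c ord0).
  by apply: eq_bigr => j _; rewrite linearZ.
Qed.

End Noetherian.

Lemma fin_gen_surj (R : comNzRingType) (X Y : lmodType R) (f : {linear X -> Y}) :
  (forall y, exists x, f x = y) -> fin_gen X -> fin_gen Y.
Proof.
move=> o [k [g gP]]; exists k, (fun i => f (g i)) => y; have [x <-] := o y.
have [c ->] := gP x; exists c; rewrite linear_sum.
by apply: eq_bigr => i _; rewrite linearZ.
Qed.

(** * Length at a prime *)

Section CyclicPrime.
Variables (R : comNzRingType) (Q : set R) (S : lmodType R).
Hypotheses (pQ : primeI Q) (cS : cyclic_mod Q S).
Implicit Types X Y : lmodType R.

(** The condition says that U'/U does not vanish at Q: modulo U, such a [u] has its annihilator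
    inside Q, so that R u maps onto R/Q. *)
Lemma jump_cyclicP X (U U' : set X) : lsub U -> lsub U' ->
  (forall x, U x -> U' x) ->
  jump S U U' <-> exists u, U' u /\ forall s, ~ Q s -> ~ U (s *: u).
Proof.
have [g [gen ann]] := cS; move=> lU lU' sub; split.
  move=> [r [rr d o k]]; have [x rx] := o g; exists x; split; first exact: d rx.
  move=> s nQs Us; apply: nQs; apply/ann; apply: k Us _.
  exact: lrelZ.
move=> [u [U'u nU]]; exists (fun x s => exists a v, [/\ U v, x = a *: u + v & s = a *: g]).
split.
- split; first by exists 0, 0; rewrite !scale0r addr0; split=> //; case: lU.
  move=> c _ _ _ _ [a [v [Uv -> ->]]] [a' [v' [Uv' -> ->]]].
  exists (c * a + a'), (c *: v + v'); split.
  + by case: lU => _; apply.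
  + by rewrite scalerDr scalerDl !scalerA addrACA.
  + by rewrite scalerDl scalerA.
- move=> _ _ [a [v [/sub Uv -> _]]]; case: lU' => _; exact.
- by move=> s; have [r ->] := gen s; exists (r *: u), r, 0; rewrite addr0; split=> //; case: lU.
- move=> x _ Ux [a [v [Uv E ->]]]; apply/ann; apply: contrapT => /nU; apply.
  have -> : a *: u = x - v by rewrite E addrK.
  exact: lsubB.
Qed.

Lemma primeM a b : ~ Q a -> ~ Q b -> ~ Q (a * b).
Proof. by case: pQ => _ _ H na nb /H []. Qed.

(** Every nonzero submodule of the domain R/Q contains a copy of R/Q. *)
Lemma cyclic_uncuttable : uncuttable S.
Proof.
have [g [gen ann]] := cS; move=> U lU.
have [[u [Uu u0]]|nex] := pselect (exists u, U u /\ u <> 0); [left|right].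
  apply/jump_cyclicP => //; rewrite ?/zero_set; first exact: lsub0.
    by move=> x ->; case: lU.
  exists u; split=> // s nQs; have [r E] := gen u; rewrite E scalerA => /ann.
  by apply: primeM => // Qr; apply: u0; rewrite E; apply/ann.
apply/jump_cyclicP => //; exists g; split=> // s nQs Us.
by apply: nex; exists (s *: g); split=> // /ann.
Qed.

(** A first step contains a g with a outside Q; then a sends every b g to b (a g), so nothing
    survives at Q above that step. *)
Lemma length_cyclic X (g : X) (Z : set X) : (forall a, Q a -> a *: g = 0) ->
  (forall x, Z x -> exists a, x = a *: g) -> length_le S Z 1.
Proof.
move=> Qg Zg Z' l sub h; case: h sub => {Z' l} [U U' //|U U' V k h lV s j sub].
suff -> : k = 0%N by [].
case: h s j => {U U'} [U U' //|U U' W l h lW s1 j1 s j]; exfalso.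
have [lU lU' s0] := jumps_lsub h.
have [u [Wu nu]] := (jump_cyclicP lU' lW s1).1 j1.
have [v [Vv nv]] := (jump_cyclicP lW lV s).1 j.
have [a Ea] := Zg _ (sub _ (s _ Wu)); have [b Eb] := Zg _ (sub _ Vv).
have nQa : ~ Q a.
  move=> Qa; apply: (nu 1); first by case: pQ.
  by rewrite scale1r Ea Qg //; case: lU'.
by apply: (nv a nQa); rewrite Eb scalerA mulrC -scalerA -Ea; apply: lsubZ.
Qed.

Lemma length_torsion X (Z : set X) :
  (forall x, Z x -> exists2 s, ~ Q s & s *: x = 0) -> length_le S Z 0.
Proof.
move=> tor Z' l sub h; case: h sub => // U U' V k h lV s j sub; exfalso.
have [lU lU' s0] := jumps_lsub h.
have [v [Vv nv]] := (jump_cyclicP lU' lV s).1 j.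
have [t nt E] := tor _ (sub _ Vv); apply: (nv t nt); rewrite E.
by case: lU'.
Qed.

End CyclicPrime.

(** * The descending chain condition *)

Section DescendingChains.
Variable R : comNzRingType.
Implicit Types X Y : lmodType R.

Definition dcc X (Z : set X) : Prop := forall N : nat -> set X,
  (forall i, lsub (N i)) -> (forall i x, N i.+1 x -> N i x) ->
  (forall i x, N i x -> Z x) -> exists k, forall i x, (k <= i)%N -> N k x -> N i x.

Lemma desc_le T (N : nat -> set T) i j x : (forall i x, N i.+1 x -> N i x) ->
  (i <= j)%N -> N j x -> N i x.
Proof.
move=> d le; rewrite -(subnKC le); elim: (j - i)%N => [|k IH]; rewrite ?addn0 //.
by rewrite addnS => /d.
Qed.

(* The dual of Hilbert's basis theorem: the submodules [x^t (U : x^t+1)] of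
   the kernel of [x] determine [U] in a descending chain. *)
Lemma dcc_power_torsion X (Z : set X) (a : R) : lsub Z ->
  (forall x, Z x -> exists t, a ^+ t *: x = 0) ->
  dcc (fun x => Z x /\ a *: x = 0) -> dcc Z.
Proof.
move=> lZ tor D N lN d sN.
pose G i t y := exists2 u, N i u /\ a ^+ t.+1 *: u = 0 & y = a ^+ t *: u.
have lG i t : lsub (G i t).
  split; first by exists 0; rewrite ?scaler0 //; split=> //; case: (lN i).
  move=> c _ _ [u [Nu Eu] ->] [v [Nv Ev] ->]; exists (c *: u + v).
    split; first by case: (lN i) => _; apply.
    by rewrite scalerDr scalerA mulrC -scalerA Eu Ev scaler0 addr0.
  by rewrite scalerDr !scalerA mulrC.
have Gi i t x : G i.+1 t x -> G i t x.
  by case=> u [/d Nu E] ->; exists u.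
have Gt i t x : G i t.+1 x -> G i t x.
  case=> u [Nu E] ->; exists (a *: u); last by rewrite scalerA -exprSr.
  by split; [apply: lsubZ|rewrite scalerA -exprSr].
have GZ i t x : G i t x -> Z x /\ a *: x = 0.
  case=> u [/sN Zu E] ->; split; first exact: lsubZ.
  by rewrite scalerA -exprS.
have [n0 n0P] := D (fun n => G n n) (fun n => lG n n) (fun n x h => Gi _ _ _ (Gt _ _ _ h))
  (fun n => GZ n n).
have stab t : exists k, forall i x, (k <= i)%N -> G k t x -> G i t x.
  exact: (D (fun i => G i t) (fun i => lG i t) (fun i x => Gi i t x) (fun i x => GZ i t x)).
have [k kP] := boolp.choice stab.
(* The diagonal of the doubly descending family settles all t >= n0; each of the finitely many
   columns t < n0 stabilizes by itself. *)
pose i0 := maxn n0 (\max_(t < n0) k t).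
have stab0 i t x : (i0 <= i)%N -> G i0 t x -> G i t x.
  move=> le h; have [ltn|gen] := ltnP t n0.
    have kt : (k t <= i0)%N.
      apply: leq_trans (leq_maxr _ _).
      exact: (leq_bigmax (Ordinal ltn)).
    exact: (kP t i x (leq_trans kt le) (desc_le (N := fun i => G i t) (fun i x => Gi i t x) kt h)).
  have i0n : (n0 <= i0)%N by apply: leq_maxl.
  have h1 : G n0 n0 x.
    have h0 : G n0 t x by exact: (desc_le (N := fun j => G j t) (fun i x => Gi i t x) i0n h).
    exact: (desc_le (N := fun j => G n0 j) (fun i x => Gt n0 i x) gen h0).
  have h2 := n0P (maxn i t) x ltac:(lia) h1.
  have h3 : G i (maxn i t) x.
    exact: (desc_le (N := fun j => G j _) (fun i x => Gi i _ x) (leq_maxl i t) h2).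
  exact: (desc_le (N := fun j => G i j) (fun j x => Gt i j x) (leq_maxr i t) h3).
exists i0 => i x le Nx; have [t Et] := tor _ (sN _ _ Nx).
elim: t x Nx Et => [|t IH] x Nx Et.
  by move: Et; rewrite expr0 scale1r => ->; case: (lN i).
(* [u] lies in N i and agrees with x after multiplication by a^t, so induction applies to x - u. *)
have [u [Nu Eu] E] : G i t (a ^+ t *: x) by apply: stab0 => //; exists x.
rewrite -[x](subrK u); apply: lsubD => //; apply: IH.
  by apply: lsubB => //; apply: (desc_le d le).
by rewrite scalerBr E subrr.
Qed.

Lemma dcc_length (S : lmodType R) X (Z : set X) c :
  (forall U U' : set X, lsub U -> lsub U' -> (forall x, U x -> U' x) ->
    (exists x, U' x /\ ~ U x) -> jump S U U') ->
  length_le S Z c -> dcc Z.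
Proof.
move=> J hc N lN d sN; apply: contrapT => nst.
have step k : exists i, (k <= i)%N /\ exists x, N k x /\ ~ N i x.
  apply: contrapT => ns; apply: nst; exists k => i x le Nx.
  by apply: contrapT => nNx; apply: ns; exists i; split=> //; exists x.
have long l k : exists i, jumps S (N i) (N k) l.
  elim: l k => [|l IH] k; first by exists k; apply: jumps0.
  have [i [le ex]] := step k; have [i' h] := IH i; exists i'.
  rewrite -addn1; apply: jumps_trans h _; apply: jumps1 => //.
    by move=> x; apply: desc_le.
  by apply: J => // x; apply: desc_le.
have [i h] := long c.+1 0%N.
have := hc _ _ (sN 0%N) (jumps_weakl _ _ h).
rewrite ltnn => H; have {}H := H (@lsub0 _ _); suff : false by []; apply: H.
by move=> x ->; case: (lN i).
Qed.

Lemma dccW X (Z Z' : set X) : (forall x, Z' x -> Z x) -> dcc Z -> dcc Z'.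
Proof. by move=> sub D N lN d sN; apply: D => // i x /sN/sub. Qed.

Lemma dcc_inj X Y (f : {linear X -> Y}) (Z : set X) (Z' : set Y) :
  injective f -> (forall x, Z x -> Z' (f x)) -> dcc Z' -> dcc Z.
Proof.
move=> inj s D N lN d sN.
have [|||k kP] := D (fun i y => exists2 x, N i x & f x = y).
- by move=> i; apply: lsub_im.
- by move=> i y [x /d Nx <-]; exists x.
- by move=> i y [x /sN/s + <-].
exists k => i x le Nx; have [|u Nu /inj <- //] := kP i (f x) le.
by exists x.
Qed.

Lemma dcc_sq X Y : sq X Y -> dcc (fun _ : X => True) -> dcc (fun _ : Y => True).
Proof.
case=> r [rr o u] D N lN d _.
have [|||k kP] := D (fun i x => exists2 y, N i y & r x y).
- move=> i; split; first by exists 0; [case: (lN i)|case: rr].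
  move=> a x x' [y Ny h] [y' Ny' h']; exists (a *: y + y').
    by case: (lN i) => _; apply.
  by case: rr => _; apply.
- by move=> i x [y /d Ny h]; exists y.
- by [].
exists k => i y le Ny; have [x h] := o y.
have [|y' Ny' h'] := kP i x le; first by exists y.
by rewrite (lrel_uniq rr u h h').
Qed.

Lemma dcc_ind X (Z : set X) (Pi : set X -> Prop) : dcc Z ->
  (forall U, lsub U -> (forall x, U x -> Z x) ->
    (forall V, lsub V -> (forall x, V x -> U x) -> (exists x, U x /\ ~ V x) -> Pi V) ->
    Pi U) ->
  forall U, lsub U -> (forall x, U x -> Z x) -> Pi U.
Proof.
move=> D H U0 lU0 sU0; apply: contrapT => nU0.
pose T := {U : set X | [/\ lsub U, forall x, U x -> Z x & ~ Pi U]}.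
have next (t : T) : {t' : T | (forall x, sval t' x -> sval t x) /\
    exists x, sval t x /\ ~ sval t' x}.
  apply/cid; case: t => U [lU sU nU] /=; apply: contrapT => nex; apply: nU.
  apply: H => // V lV VU ex; apply: contrapT => nV; apply: nex.
  have sV x : V x -> Z x by move=> /VU/sU.
  by exists (exist _ V (And3 lV sV nV)).
pose s n := iter n (fun t => sval (next t)) (exist _ U0 (And3 lU0 sU0 nU0) : T).
have [|n x|n x|k kP] := D (fun n => sval (s n)).
- by move=> n; case: (svalP (s n)).
- by case: (svalP (next (s n))) => + _; apply.
- by case: (svalP (s n)) => _ + _; apply.
- case: (svalP (next (s k))) => _ [x [Jx]]; apply.
  exact: (kP k.+1).
Qed.

Lemma artinian_dcc X : dcc (fun _ : X => True) -> artinian_module X.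
Proof.
move=> D N sN d.
have [|||k kP] := D (fun i x => x \in N i).
- move=> i; case: (sN i) => N0 ND; split=> // a x y; exact: ND.
- by move=> i x; apply: d.
- by [].
exists k => i le x; apply/idP/idP; last exact: kP.
by apply: (desc_le (N := fun i x => x \in N i)) => // j y; apply: d.
Qed.

End DescendingChains.

(** * Lengths of quotients *)

Section RelativeLength.
Variables (R : comNzRingType) (S : lmodType R).
Implicit Types X Y : lmodType R.

(** The length of X/U, without forming the quotient. *)
Definition colength_le X (U : set X) (k : nat) : Prop := forall V V' l,
  (forall x, U x -> V x) -> jumps S V V' l -> (l <= k)%N.

Lemma colength_ses (A B C : lmodType R) (i : {linear A -> B}) (q : {linear B -> C})
    (UA : set A) (UB : set B) (UC : set C) a c : uncuttable S ->
  (forall b, q b = 0 -> exists a, i a = b) ->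
  (forall x, UA x -> UB (i x)) -> (forall x, UA x -> q (i x) = 0) ->
  (forall y, UC y -> exists2 b, UB b & q b = y) ->
  colength_le UA a -> colength_le UC c -> colength_le UB (a + c).
Proof.
move=> unc ex sA kA sC ha hc V V' l sV h.
have [a' [c' [le ja jc]]] := jumps_split q unc h.
apply: leq_trans le _; apply: leq_add; last first.
  by apply: hc jc => y /sC[b /sV Vb <-]; exists b.
have ja' := jumps_pull (@lsubT _ A) (f := i) _ ja.
apply: ha (ja' _) => [x UAx|y [V'y /ex[x Ex]]]; last by exists x.
by split=> //; split; [apply/sV/sA|apply: kA].
Qed.

Lemma max_jumps X (Z : set X) k : lsub Z -> length_le S Z k ->
  exists r, jumps S (@zero_set R X) Z r /\ length_le S Z r.
Proof.
move=> lZ hk; pose P r := `[<jumps S (@zero_set R X) Z r>].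
have P0 : exists r, P r.
  exists 0%N; apply/asboolP/jumps0 => //; first exact: lsub0.
  by move=> x ->; case: lZ.
have Pk r : P r -> (r <= k)%N by move=> /asboolP; apply: hk.
case: (ex_maxnP P0 Pk) => r /asboolP hr mr; exists r; split=> // Z' l sZ h.
by apply/mr/asboolP; apply: jumps_weakr h.
Qed.

Lemma colength0 X k : length_le S (fun _ : X => True) k ->
  colength_le (@zero_set R X) k.
Proof.
move=> hk V V' l s h; apply: hk (jumps_weakl _ s h) => //; exact: lsub0.
Qed.

Lemma length0_colength X k : colength_le (@zero_set R X) k ->
  length_le S (fun _ : X => True) k.
Proof. by move=> h Z' l _; apply: h. Qed.

End RelativeLength.

Lemma length_generators (R : comNzRingType) p (charRp : p \in [pchar R])
    (Q : set R) (S : lmodType R) : primeI Q -> cyclic_mod Q S ->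
  forall k (X : lmodType R) (g : 'I_k -> X),
  (forall a (x : X), Q a -> a *: x = 0) ->
  (forall x, exists c : 'I_k -> R, x = \sum_(i < k) c i *: g i) ->
  length_le S (fun _ : X => True) k.
Proof.
move=> pQ cS; elim=> [|k IH] X g QX gP.
  apply: (length_torsion cS) => x _; exists 1; first by case: pQ.
  by have [c ->] := gP x; rewrite big_ord0 scaler0.
have [Y [f [fo fP]]] := quot_exists charRp (lsub_cyc (g ord0)).
rewrite -add1n; apply: (length_le_add (f := f)); first exact: (cyclic_uncuttable pQ cS).
  apply: (length_cyclic pQ cS (g := g ord0)); first by move=> a; apply: QX.
  by move=> x [_ /fP].
apply: length_leW (IH Y (fun j => f (g (lift ord0 j))) _ _) => //.
  by move=> a z Aa; have [x <-] := fo z; rewrite -linearZ QX ?linear0.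
move=> z; have [x <-] := fo z; have [c ->] := gP x.
exists (fun j => c (lift ord0 j)); rewrite linear_sum big_ord_recl /=.
rewrite (fP _).2 ?add0r; last by exists (c ord0).
by apply: eq_bigr => j _; rewrite linearZ.
Qed.

Lemma fin_gen_fin (R : comNzRingType) (M : lmodType R) (I : finType) (g : I -> M) :
  (forall x, exists c : I -> R, x = \sum_i c i *: g i) -> fin_gen M.
Proof.
move=> gP; exists #|I|, (fun i => g (enum_val i)) => x; have [c ->] := gP x.
exists (fun i => c (enum_val i)).
by rewrite (reindex (@enum_val I I)) //=; apply/onW_bij/enum_val_bij.
Qed.

(** * Pushforward along the Frobenius *)

Section Frobenius.
Variables (R : comNzRingType) (p : nat) (charRp : p \in [pchar R]).
Implicit Types X Y M : lmodType R.

Definition Phi X : lmodType R := restrict (pFrobenius_aut charRp) X.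
Notation push n X := (frobenius_push charRp n X).

Lemma PhiE X (a : R) (x : X) : a *: (x : Phi X) = a ^+ p *: x.
Proof. by []. Qed.

Lemma frob_iterE n (a : R) : frobenius_iter charRp n a = a ^+ (p ^ n).
Proof.
elim: n => [|n IH] //; rewrite /frobenius_iter iterS [iter _ _ _]IH.
by rewrite pFrobenius_autE -exprM expnSr.
Qed.

Lemma pushE n X (a : R) (x : X) : a *: (x : push n X) = a ^+ (p ^ n) *: x.
Proof. by rewrite -frob_iterE. Qed.

Lemma pushS_iso n X : exists f : {linear push n.+1 X -> push n (Phi X)},
  forall x : X, f x = x.
Proof.
have [|f fE] := @lin_exists R (push n.+1 X) (push n (Phi X)) (fun x => x).
  by [].
by exists f => x; rewrite fE.
Qed.

Lemma pushS_iso' n X : exists f : {linear push n (Phi X) -> push n.+1 X},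
  forall x : X, f x = x.
Proof.
have [|f fE] := @lin_exists R (push n (Phi X)) (push n.+1 X) (fun x => x).
  by [].
by exists f => x; rewrite fE.
Qed.

Lemma push0_iso X : exists f : {linear push 0 X -> X}, forall x : X, f x = x.
Proof.
have [|f fE] := @lin_exists R (push 0 X) X (fun x => x).
  by [].
by exists f => x; rewrite fE.
Qed.

Lemma push0_iso' X : exists f : {linear X -> push 0 X}, forall x : X, f x = x.
Proof.
have [|f fE] := @lin_exists R X (push 0 X) (fun x => x).
  by [].
by exists f => x; rewrite fE.
Qed.

Lemma image_id T (U : set T) (f : T -> T) : (forall x, f x = x) ->
  (fun y => exists2 x, U x & f x = y) = U.
Proof.
move=> fE; apply/funext => y; apply/propext; split=> [[x Ux <-]|Uy].
  by rewrite fE.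
by exists y.
Qed.

Lemma jumps_pushS S n X (U U' : set X) k :
  jumps S (U : set (push n (Phi X))) (U' : set (push n (Phi X))) k ->
  jumps S (U : set (push n.+1 X)) (U' : set (push n.+1 X)) k.
Proof.
have [f fE] := pushS_iso' n X => /(jumps_push (f := f)) h.
have := h _; rewrite !(@image_id X) //; apply.
by move=> x _; rewrite fE.
Qed.

Lemma jumps_push0 S X (U U' : set X) k : jumps S U U' k ->
  jumps S (U : set (push 0 X)) (U' : set (push 0 X)) k.
Proof.
have [f fE] := push0_iso' X => /(jumps_push (f := f)) h.
have := h _; rewrite !(@image_id X) //; apply.
by move=> x _; rewrite fE.
Qed.

Lemma jumps_frob S n X (U U' : set X) k r :
  jumps S (@zero_set R (Phi S)) (fun _ => True) r -> jumps S U U' k ->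
  jumps S (U : set (push n X)) (U' : set (push n X)) (k * r ^ n).
Proof.
move=> hr; elim: n X U U' k => [|n IH] X U U' k h.
  by rewrite expn0 muln1; apply: jumps_push0.
apply: jumps_pushS; rewrite expnS mulnA.
by apply: (IH (Phi X)); apply: jumps_restrict h hr.
Qed.

Hypothesis hF : F_finite charRp.

Lemma fin_gen_Phi M : fin_gen M -> fin_gen (Phi M).
Proof.
case: hF => l [h hP] [k [g gP]].
apply: (@fin_gen_fin _ (Phi M) ('I_k * 'I_l)%type (fun ij => h ij.2 *: (g ij.1 : M))).
move=> x; have [c ->] := gP x; have [d dP] := boolp.choice (fun i => hP (c i)).
exists (fun ij => d ij.1 ij.2); rewrite -(pair_bigA _ (fun i j => d i j *: ((h j *: (g i : M)) : Phi M))) /=.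
apply: eq_bigr => i _; rewrite (dP i) [LHS]scaler_suml.
by apply: eq_bigr => j _; rewrite PhiE scalerA.
Qed.

Lemma fin_gen_push n M : fin_gen M -> fin_gen (push n M).
Proof.
elim: n M => [|n IH] M fM.
  by have [f fE] := push0_iso' M; apply: (fin_gen_surj (f := f) _ fM) => y; exists y; rewrite fE.
have [f fE] := pushS_iso' n M.
by apply: (fin_gen_surj (f := f) _ (IH _ (fin_gen_Phi fM))) => y; exists y; rewrite fE.
Qed.

End Frobenius.

Lemma mul_lin (R : comNzRingType) (X : lmodType R) (a : R) :
  exists f : {linear X -> X}, forall x, f x = a *: x.
Proof.
have [|f fE] := @lin_exists R X X (fun x => a *: x); last by exists f.
by move=> b x y; rewrite scalerDr !scalerA mulrC.
Qed.

Lemma cyclic_iso (R : comNzRingType) (Q : set R) (A N : lmodType R) :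
  cyclic_mod Q A -> cyclic_mod Q N ->
  exists f : {linear A -> N}, (forall y, exists x, f x = y) /\ forall x, f x = 0 -> x = 0.
Proof.
move=> [g [gen ann]] [h [hgen hann]].
have [|||f fP] := @lrel_fun _ A N (fun x y => exists r, x = r *: g /\ y = r *: h).
- split; first by exists 0; rewrite !scale0r.
  move=> a _ _ _ _ [r [-> ->]] [s [-> ->]]; exists (a * r + s).
  by rewrite !scalerDl !scalerA.
- by move=> x; have [r ->] := gen x; exists (r *: h), r.
- by move=> y [r [/esym/ann/hann ? ->]].
exists f; split=> [y|x /fP [r [-> /esym/hann/ann //]]].
by have [r ->] := hgen y; exists (r *: g); apply/fP; exists r.
Qed.

(** * Lower bound for the number of generators *)

Section Kunz.
Variables (R : comNzRingType) (p : nat) (charRp : p \in [pchar R]).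
Hypotheses (noeth : noetherian_ring R) (hF : F_finite charRp).
Implicit Types X Y M N : lmodType R.
Notation Phi X := (Phi charRp X).

Definition saturated (P Q : set R) : Prop := forall Q', primeI Q' ->
  (forall a, P a -> Q' a) -> (exists a, Q' a /\ ~ P a) ->
  (forall a, Q' a -> Q a) -> forall a, Q a -> Q' a.

(* Kunz: with A = R/P and x in Q outside P, the length at Q of
   F_* A / x^t F_* A is at least p t e delta, where e is that of A / x A, and at
   most r t e + c, as F_* A is filtered by r copies of A up to modules of
   bounded length at Q. *)
Lemma kunz_step (P Q : set R) (A B : lmodType R) (r delta : nat) :
  primeI P -> primeI Q -> cyclic_mod P A -> cyclic_mod Q B ->
  (forall a, P a -> Q a) -> (exists a, Q a /\ ~ P a) -> saturated P Q ->
  length_le A (fun _ : Phi A => True) r ->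
  jumps B (@zero_set R (Phi B)) (fun _ => True) delta -> (p * delta <= r)%N.
Proof.
move=> pP pQ cA cB PQ [x [Qx nPx]] sat hr hd.
have uncB := cyclic_uncuttable pQ cB; have uncA := cyclic_uncuttable pP cA.
have [gA [genA annA]] := cA.
(* A prime strictly above P either equals Q or is not inside Q, and in the latter case R/Q' vanishes
   at Q. *)
have small N Q' : primeI Q' -> (forall a, P a -> Q' a) -> (exists a, Q' a /\ ~ P a) ->
    cyclic_mod Q' N -> length_le B (fun _ : N => True) 1.
  move=> pQ' PQ' ex [g [gen ann]].
  have [sub|nsub] := pselect (forall a, Q' a -> Q a).
    have QQ' := sat _ pQ' PQ' ex sub.
    by apply: (length_cyclic pQ cB (g := g)) => // a /QQ'/ann.
  apply: length_leW (length_torsion cB (Z := fun _ : N => True) _) => //.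
  have [s [Q's nQs]] : exists s, Q' s /\ ~ Q s.
    apply: contrapT => nex; apply: nsub => a Q'a; apply: contrapT => nQa.
    by apply: nex; exists a.
  move=> y _; exists s => //; have [c ->] := gen y.
  by rewrite scalerA mulrC -scalerA (ann s).2 // scaler0.
have zeroB N : (forall y : N, y = 0) -> length_le B (fun _ : N => True) 0.
  move=> N0; apply: (length_torsion cB) => y _; exists 1; first by case: pQ.
  by rewrite [y]N0 scaler0.
have [mx mxE] := mul_lin A x.
have [C [q [qo qP]]] := quot_exists charRp (lsub_im mx (@lsubT _ A)).
have qx y : q (x *: y) = 0 by apply/qP; exists y.
have CP a (y : C) : P a \/ a = x -> a *: y = 0.
  have [z <-] := qo y; case=> [Pa|->]; last by rewrite -linearZ qx.
  have [c ->] := genA z; rewrite -linearZ scalerA mulrC -scalerA.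
  by rewrite (annA a).2 // scaler0 linear0.
have fC : fin_gen C.
  apply: (fin_gen_surj qo); exists 1%N, (fun _ => gA) => y; have [c ->] := genA y.
  by exists (fun _ => c); rewrite big_ord1.
(* C = A/xA has finite length at Q, since all primes in its devissage contain x and P and so lie
   strictly above P. *)
have [e0 he0] : exists c, colength_le B (@zero_set R C) c.
  apply: (@devissage _ noeth _ charRp (fun N => exists c, colength_le B (@zero_set R N) c)
    (fun a => P a \/ a = x)) CP fC.
  - move=> A' B' C' i f inji fo fP [a ha] [c hc]; exists (a + c)%N.
    apply: (colength_ses (i := i) (q := f)) ha hc => //; first by move=> b /fP.
    + by move=> y ->; apply: linear0.
    + by move=> y _; apply/fP; exists y.
    + by move=> y ->; exists 0; rewrite ?linear0.
  - by move=> N /zeroB/colength0 h; exists 0%N.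
  - move=> Q' N pQ' sub cN; exists 1%N; apply/colength0/(small N Q') => //.
      by move=> a Pa; apply: sub; left.
    by exists x; split=> //; apply: sub; right.
have [e [je he]] := max_jumps (@lsubT _ C) (length0_colength he0).
have e1 : (1 <= e)%N.
  apply: (he (fun _ => True)) => //; apply: jumps1 => //; first exact: lsub0.
  apply/(jump_cyclicP cB) => //; first exact: lsub0.
  exists (q gA); split=> // s nQs; rewrite /zero_set -linearZ => /qP[z _].
  have [c ->] := genA z; rewrite mxE scalerA => E; apply: nQs.
  have /annA/PQ : (s - x * c) *: gA = 0 by rewrite scalerBl -E subrr.
  rewrite -[in Q s](subrK (x * c) s) => h; apply: (@lsubD R R^o Q) => //.
    by case: pQ.
  by rewrite mulrC; apply: idealM => //; case: pQ.
have injx (y : A) : x *: y = 0 -> y = 0.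
  have [c ->] := genA y; rewrite scalerA => /annA; case: pP => _ _ H /H[//|Pc].
  exact/annA.
pose pw k N : set N := fun y : N => exists z, y = x ^+ k *: z.
have lpw k N : lsub (@pw k N).
  split; first by exists 0; rewrite scaler0.
  move=> a _ _ [z ->] [z' ->]; exists (a *: z + z').
  by rewrite scalerDr !scalerA mulrC.
(* As x is regular on A, the quotients x^i A / x^(i+1) A are copies of C, so that A/x^t A has length
   exactly t e at Q; [upA] and [loA] are the two inequalities. *)
have upA t : colength_le B (@pw t A) (t * e).
  elim: t => [|t IH].
    move=> V V' l s h; rewrite mul0n.
    have [lV lV' sV] := jumps_lsub h; case: h s sV lV lV' => // U U' W k h lW sub j s _ lU _.
    have [_ lU' sU] := jumps_lsub h.
    have [u [_ nu]] := (jump_cyclicP cB lU' lW sub).1 j.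
    exfalso; refine (nu 1 _ _); first by case: pQ.
    by apply/sU/s; exists u; rewrite expr0.
  rewrite mulSn addnC.
  apply: (colength_ses (i := mx) (q := q) (UC := @zero_set R C)) IH (colength0 he) => //.
  - by move=> b /qP[z _ <-]; exists z.
  - by move=> _ [z ->]; rewrite mxE scalerA -exprS; exists z.
  - by move=> y _; rewrite mxE qx.
  - by move=> y ->; exists 0; rewrite ?linear0 //; case: (lpw t.+1 A).
have loA t : jumps B (@pw t A) (fun _ => True) (t * e).
  elim: t => [|t IH].
    rewrite mul0n; apply: jumps0 => //; exact: lpw.
  rewrite mulSn; apply: jumps_trans IH.
  have [f fE] := mul_lin A (x ^+ t).
  have finj y : f y = 0 -> y = 0.
    by rewrite fE; elim: (t) => [|k IH]; rewrite ?expr0 ?scale1r // exprS -scalerA => /injx.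
  have h := jumps_push (f := f) (fun y _ => @finj y)
    (jumps_pull (f := q) (@lsubT _ A) (fun y _ => ex_intro2 _ _ _ I (projT2 (cid (qo y)))) je).
  apply: jumps_weakr (lpw _ _) _ (jumps_weakl (lpw _ _) _ h).
    by move=> y [z _ <-]; rewrite fE; exists z.
  move=> _ [z ->]; exists (x *: z); first by split=> //; apply: qx.
  by rewrite fE scalerA -exprSr.
(* [a] counts the factors A of N; [c] bounds the contribution of all other factors, and must do so
   for every t at once. *)
pose Pi N := exists a c, jumps A (@zero_set R N) (fun _ => True) a /\
   forall t, colength_le B (@pw t N) (a * (t * e) + c).
have [a [c [ja hc]]] : Pi (Phi A).
  apply: (@devissage _ noeth _ charRp Pi P).
  - move=> A' B' C' i f inji fo fP [a1 [c1 [j1 h1]]] [a2 [c2 [j2 h2]]].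
    exists (a1 + a2)%N, (c1 + c2)%N; split.
      have inji0 y : i y = 0 -> y = 0 by rewrite -(linear0 i) => /inji.
      have j1' := jumps_push (f := i) (fun y _ => @inji0 y) j1.
      apply: (jumps_add (f := f) _ _ _ (jumps_weakl (@lsub0 _ _) _ j1') j2) => //.
      + by move=> y [z _ <-]; split=> //; apply/fP; exists z.
      + by move=> y _; have [z Ez] := fo y; exists z.
      + by move=> y ->; exists 0; rewrite ?linear0.
    move=> t; rewrite mulnDl addnACA.
    apply: (colength_ses (i := i) (q := f)) (h1 t) (h2 t) => //; first by move=> b /fP.
    + by move=> _ [z ->]; exists (i z); rewrite linearZ.
    + by move=> y _; apply/fP; exists y.
    + move=> _ [z ->]; have [z' <-] := fo z; exists (x ^+ t *: z'); rewrite ?linearZ //.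
      by exists z'.
  - move=> N N0; exists 0%N, 0%N; split.
      by apply: jumps0 => //; apply: lsub0.
    move=> t V V' l s h; rewrite mul0n.
    by apply: (zeroB N N0 V') => //; apply: jumps_weakl h;
      [exact: lsub0|move=> y _; rewrite [y]N0; apply: s; case: (lpw t N)].
  - move=> Q' N pQ' sub cN.
    have [ex|nex] := pselect (exists a, Q' a /\ ~ P a).
      exists 0%N, 1%N; split; first by apply: jumps0 => //; apply: lsub0.
      move=> t V V' l s h; rewrite mul0n; apply: (small N Q' pQ' sub ex cN V') => //.
      by apply: jumps_weakl h; [exact: lsub0|move=> y ->; apply: s; case: (lpw t N)].
    have E : Q' = P.
      apply/funext => a; apply/propext; split=> [Q'a|/sub //].
      by apply: contrapT => nPa; apply: nex; exists a.
    move: cN; rewrite E => cN.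
    exists 1%N, 0%N; split.
      apply: jumps1 => //; first exact: lsub0.
      have [g [gen ann]] := cN.
      apply/(jump_cyclicP cA) => //; first exact: lsub0.
      by exists g; split=> // s nPs /ann.
    move=> t V V' l s h; rewrite mul1n addn0.
    have [f [fo f0]] := cyclic_iso cA cN.
    apply: upA (jumps_pull (f := f) (@lsubT _ A) _ h).
      by move=> _ [z ->]; split=> //; rewrite linearZ; apply: s; exists (f z).
    by move=> y _; have [z Ez] := fo y; exists z.
  - move=> a y Pa; have [c E] := genA (y : A); rewrite PhiE E.
    rewrite scalerA mulrC -scalerA.
    rewrite (annA _).2 ?scaler0 //.
    have p0 : (0 < p)%N by apply/prime_gt0/(pcharf_prime charRp).
    by rewrite -(prednK p0) exprSr; apply: idealM => //; case: pP.
  - apply: fin_gen_Phi => //; exists 1%N, (fun _ => gA) => y; have [c ->] := genA y.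
    by exists (fun _ => c); rewrite big_ord1.
have ar : (a <= r)%N by apply: (hr (fun _ => True)) ja.
(* Since x acts on F_* A as x^p does on A, the submodule x^t F_* A is x^(p t) A, whose colength at Q
   is p t e before restriction. *)
have key t : (p * t * e * delta <= a * (t * e) + c)%N.
  have h := jumps_restrict (phi := pFrobenius_aut charRp) (loA (p * t)%N) hd.
  apply: (hc t) h => _ [z ->]; exists z.
  by rewrite exprM (PhiE charRp) -!exprM mulnC.
(* If p delta exceeded r, it would exceed a, and the inequality would give t e <= c; this fails for
   t = c.+1 because e >= 1. *)
rewrite leqNgt; apply/negP => lt; have := key c.+1.
have h1 : (c.+1 * e * a.+1 <= c.+1 * e * (p * delta))%N.
  by apply: leq_mul => //; apply: leq_ltn_trans ar lt.
have h2 : (c.+1 * 1 <= c.+1 * e)%N by apply: leq_mul.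
have -> : (p * c.+1 * e * delta = c.+1 * e * (p * delta))%N by lia.
by move: h1 h2; rewrite [(a * _)%N]mulnC mulnS; lia.
Qed.

End Kunz.

Lemma prime_idealP (R : comNzRingType) (P : {pred R}) :
  prime_ideal P -> primeI (fun x => x \in P).
Proof.
move=> [[P0 P1 PD] PM]; split; last by move=> a b /PM/orP.
  by split=> // a x y Px Py; apply: PD.
exact/negP.
Qed.

Lemma primeIP (R : comNzRingType) (Q : set R) :
  primeI Q -> prime_ideal (fun x => `[<Q x>]).
Proof.
move=> [[Q0 QD] Q1 QM]; split.
  split; [exact/asboolP|exact/asboolP|].
  by move=> a x y /asboolP Qx /asboolP Qy; apply/asboolP/QD.
by move=> a b /asboolP/QM[Qa|Qb]; apply/orP; [left|right]; apply/asboolP.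
Qed.

Lemma cyclic_exists (R : comNzRingType) p (charRp : p \in [pchar R]) (Q : set R) :
  ideal Q -> exists A, cyclic_mod Q A.
Proof.
move=> iQ; have [A [f [fo fP]]] := @quot_exists R p charRp R^o Q iQ.
exists A, (f 1); split=> [x|r]; last by rewrite -linearZ fP -[r *: 1]/(r * 1) mulr1.
have [r <-] := fo x; exists r; rewrite -linearZ -[r *: 1]/(r * 1) mulr1 //.
Qed.

(** * Local rings and minimal systems of generators *)

Section Local.
Variables (R : comNzRingType) (m : {pred R}) (K : fieldType) (pi : {rmorphism R -> K}).
Hypothesis hlocal : is_local_ring m pi.
Notation mset := (fun x => x \in m : Prop).

Let noeth := local_noetherian hlocal.

Lemma mP x : (x \in m) = (pi x == 0). Proof. exact: residue_ker. Qed.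

Lemma m_prime : primeI mset.
Proof.
split; last first.
- by move=> a b; rewrite !mP rmorphM mulf_eq0 => /orP.
- by rewrite mP rmorph1 oner_eq0.
- split; first by rewrite mP rmorph0.
  move=> a x y; rewrite !mP => /eqP Ex /eqP Ey.
  by rewrite rmorphD rmorphM Ex Ey mulr0 addr0.
Qed.

Lemma proper_sub_m (I : set R) : ideal I -> ~ I 1 -> forall x, I x -> x \in m.
Proof.
move: I; apply: noeth_ind => // I iI IH I1.
have [[J [iJ IJ ex J1]]|nex] := pselect (exists J : set R,
    [/\ ideal J, forall x, I x -> J x, exists x, J x /\ ~ I x & ~ J 1]).
  by move=> x /IJ; apply: IH.
have mI : maximal_ideal (fun x => `[<I x>]).
  split.
    split; [by apply/asboolP; case: iI|exact/asboolP|].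
    move=> a x y /asboolP Ix /asboolP Iy; apply/asboolP.
    by case: iI => _; apply.
  move=> J [J0 J1 JD] sub x; apply/idP/idP => [Jx|]; last exact: sub.
  apply/asboolP; apply: contrapT => nIx; apply: nex; exists (fun x => x \in J).
  by split; [split|move=> y Iy; apply/sub/asboolP|exists x|exact/negP].
by move=> x Ix; rewrite -(local_unique hlocal mI); apply/asboolP.
Qed.

Lemma notm_unit x : x \notin m -> exists y, y * x = 1.
Proof.
move=> nx; apply: contrapT => nex; move/negP: nx; apply.
apply: (@proper_sub_m (fun z => exists y, z = y * x)).
- split; first by exists 0; rewrite mul0r.
  move=> a _ _ [y ->] [z ->]; exists (a * y + z).
  by rewrite mulrDl -mulrA.
- by case=> y E; apply: nex; exists y.
- by exists 1; rewrite mul1r.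
Qed.

Definition resfield : lmodType R := restrict pi K^o.

Lemma resfieldE (a : R) (x : resfield) : a *: x = pi a * (x : K).
Proof. by []. Qed.

Lemma cyclic_resfield : cyclic_mod mset resfield.
Proof.
exists (1 : K); split=> [x|r].
  have [a Ea] := residue_surj hlocal (x : K); exists a.
  by rewrite resfieldE mulr1.
by rewrite resfieldE mulr1 mP; split=> [->|/eqP].
Qed.

Section MinimalGenerators.
Variable M : lmodType R.

Definition generates k (g : 'I_k -> M) := forall x, exists c : 'I_k -> R,
  x = \sum_(i < k) c i *: g i.

(** With the fewest generators, a relation having a coefficient outside m, hence a unit, would
    eliminate a generator. *)
Lemma minimal_generators : fin_gen M -> exists k (g : 'I_k -> M), generates g /\
  forall c : 'I_k -> R, \sum_(i < k) c i *: g i = 0 -> forall i, c i \in m.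
Proof.
move=> fM; pose P k := `[<exists g : 'I_k -> M, generates g>].
have exP : exists k, P k by case: fM => k [g gP]; exists k; apply/asboolP; exists g.
case: (ex_minnP exP) => k /asboolP [g gP] min; exists k, g; split=> // c E i.
apply: contraT => /notm_unit [y Ey].
case: k g gP min c E i y Ey => [|k] g gP min c E i y Ey; first by case: (i).
suff /min : P k by rewrite ltnn.
apply/asboolP; exists (fun j => g (lift i j)) => x; have [b ->] := gP x.
have Eg : g i = - \sum_(j < k) (y * c (lift i j)) *: g (lift i j).
  move: E; rewrite (bigD1_ord i) //= => /(congr1 (fun z => y *: z)).
  rewrite scaler0 scalerDr scalerA Ey scale1r => /eqP; rewrite addr_eq0 => /eqP ->.
  rewrite scaler_sumr; congr (- _); apply: eq_bigr => j _; by rewrite scalerA.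
exists (fun j => b (lift i j) - b i * (y * c (lift i j))).
rewrite (bigD1_ord i) //= Eg scalerN scaler_sumr addrC -sumrB.
by apply: eq_bigr => j _; rewrite scalerBl [b i *: _]scalerA.
Qed.

(** For a minimal system the residues of the coefficients of x depend only on x, so M -> K^k is a
    base change. The space selected by [nu] maps to K^k by its universal property, and onto it
    because the g i go to the basis. *)
Lemma nu_generators : fin_gen M -> exists k (g : 'I_k -> M), generates g /\
  (k <= nu pi M)%N.
Proof.
move=> /minimal_generators [k [g [gP gm]]]; exists k, g; split=> //.
have [c cP] := boolp.choice gP.
have uniq x b : x = \sum_(i < k) b i *: g i -> forall i, pi (b i) = pi (c x i).
  move=> E i; apply/eqP; rewrite -subr_eq0 -rmorphB -mP.
  apply: (gm (fun i => b i - c x i)).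
  under eq_bigr do rewrite scalerBl.
  by rewrite sumrB -E -cP subrr.
pose f x : 'rV[K]_k := \row_i pi (c x i).
have fl (a : R) x y : f (a *: x + y) = (pi \; *:%R) a (f x) + f y.
  apply/rowP => i; rewrite !mxE -rmorphM -rmorphD.
  rewrite -(uniq (a *: x + y) (fun i => a * c x i + c y i)) //.
  rewrite {1}(cP x) {1}(cP y) scaler_sumr -big_split /=.
  by apply: eq_bigr => j _; rewrite scalerDl scalerA.
pose L := GRing.isLinear.Build R M 'rV[K]_k (pi \; *:%R) f fl.
pose io : {linear M -> 'rV[K]_k | pi \; *:%R} := HB.pack f L.
have iog i : io (g i) = 'e_i.
  apply/rowP => j; rewrite !mxE -(uniq (g i) (fun j => (j == i)%:R)) ?eqxx ?rmorph_nat //.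
  rewrite (bigD1 i) //= eqxx scale1r big1 ?addr0 // => l /negbTE ->.
  by rewrite scale0r.
have bc : is_base_change io.
  move=> W h.
  pose e (v : 'rV[K]_k) := \sum_i v 0 i *: h (g i).
  have el (a : K) u v : e (a *: u + v) = a *: e u + e v.
    rewrite /e scaler_sumr -big_split /=; apply: eq_bigr => i _.
    by rewrite !mxE scalerDl scalerA.
  have [e' eE] := lin_exists el; exists e'; split.
    move=> x; rewrite eE /e {2}(cP x) linear_sum; apply: eq_bigr => i _.
    by rewrite !mxE [RHS]linearZ.
  move=> h' hh v; rewrite eE /e [in LHS](row_sum_delta v) linear_sum.
  by apply: eq_bigr => i _; rewrite linearZ -iog /= hh.
have ex : base_change_dim pi M k.
  by exists 'rV[K]_k, io; split=> //; rewrite dimvf /dim /= mul1n.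
have [T [io' [bc' dT]]] := xgetI 0%N ex.
have [h [hP _]] := bc' _ io.
rewrite /nu -dT.
pose hf := linfun h.
have full : (limg hf = fullv)%VS.
  apply/eqP; rewrite eqEsubv subvf /=; apply/subvP => v _.
  rewrite (row_sum_delta v); apply: memv_suml => i _; apply: memvZ.
  by rewrite -iog -hP -(lfunE h) memv_img ?memvf.
have := limg_ker_dim hf fullv; rewrite full dimvf /dim /= mul1n => <-.
exact: leq_addl.
Qed.

End MinimalGenerators.
End Local.

(** Nakayama's lemma at P without localizing and without determinants: u = s - a_0 is outside P and
    eliminates the first generator. *)
Lemma nakayama_prime (R : comNzRingType) (P : set R) (M : lmodType R) k
    (g : 'I_k -> M) (s : R) : primeI P -> ~ P s ->
  (forall i, exists a : 'I_k -> R, (forall j, P (a j)) /\ s *: g i = \sum_j a j *: g j) ->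
  exists t, ~ P t /\ forall i, t *: g i = 0.
Proof.
move=> pP; have [iP P1 _] := pP.
elim: k g s => [|k IH] g s nPs H; first by exists 1; split=> // -[].
have [a [Pa Ea]] := H ord0; pose u := s - a ord0.
have nPu : ~ P u.
  by move=> Pu; apply: nPs; rewrite -[s](subrK (a ord0)); apply: (@lsubD R R^o P).
have Eu : u *: g ord0 = \sum_(j < k) a (lift ord0 j) *: g (lift ord0 j).
  by rewrite scalerBl Ea big_ord_recl addrAC subrr add0r.
have [||t [nPt Et]] := IH (fun i => g (lift ord0 i)) (u * s).
- exact: (primeM pP).
- move=> i; have [b [Pb Eb]] := H (lift ord0 i).
  exists (fun j => b ord0 * a (lift ord0 j) + u * b (lift ord0 j)); split.
    by move=> j; apply: (@lsubD R R^o P) => //; apply: idealM.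
  rewrite -scalerA Eb big_ord_recl scalerDr scalerA mulrC -scalerA Eu.
  rewrite !scaler_sumr -big_split /=; apply: eq_bigr => j _.
  by rewrite scalerDl !scalerA.
exists (t * u); split; first exact: (primeM pP).
move=> i; case: (unliftP ord0 i) => [j ->|->].
  by rewrite mulrC -scalerA Et scaler0.
rewrite -scalerA Eu scaler_sumr big1 // => j _.
by rewrite scalerA mulrC -scalerA Et scaler0.
Qed.

(** * Generic rank and number of generators of F^n_* M *)

Section LowerBound.
Variables (R : comNzRingType) (m : {pred R}) (K : fieldType) (pi : {rmorphism R -> K}).
Variables (p : nat) (charRp : p \in [pchar R]).
Hypotheses (hlocal : is_local_ring m pi) (hF : F_finite charRp).
Notation mset := (fun x => x \in m : Prop).
Notation push n X := (frobenius_push charRp n X).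
Notation Phi X := (Phi charRp X).
Notation k0 := (resfield pi).

Let noeth := local_noetherian hlocal.

Lemma p_gt0 : (0 < p)%N.
Proof. exact/prime_gt0/(pcharf_prime charRp). Qed.

Lemma push_killed n (Q : set R) (X : lmodType R) : ideal Q ->
  (forall a (x : X), Q a -> a *: x = 0) -> forall a (x : push n X), Q a -> a *: x = 0.
Proof.
move=> iQ QX a x Qa; rewrite (pushE charRp n); apply: QX.
have q0 : (0 < p ^ n)%N by rewrite expn_gt0 p_gt0.
by rewrite -(prednK q0) exprSr; apply: idealM.
Qed.

Lemma Phi_killed (Q : set R) (X : lmodType R) : ideal Q ->
  (forall a (x : X), Q a -> a *: x = 0) -> forall a (x : Phi X), Q a -> a *: x = 0.
Proof.
move=> iQ QX a x Qa; rewrite (PhiE charRp); apply: QX.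
by rewrite -(prednK p_gt0) exprSr; apply: idealM.
Qed.

(** Going down the chain from R/m, each prime gains a factor p by [kunz_step]. Maximality of d makes
    the chain end at m and be saturated, since otherwise a prime could be appended or inserted. *)
Lemma prime_chain_residue_growth (I : set R) d P (alpha : nat) :
  prime_chain I d P -> (forall l P', prime_chain I l P' -> (l <= d)%N) ->
  jumps k0 (@zero_set R (Phi k0)) (fun _ => True) alpha ->
  exists (A : lmodType R) delta, [/\ cyclic_mod (fun x => x \in P 0%N) A,
    jumps A (@zero_set R (Phi A)) (fun _ => True) delta & (p ^ d * alpha <= delta)%N].
Proof.
move=> [pP IP sP] maxd ja.
have pI i : (i <= d)%N -> primeI (fun x => x \in P i) by move=> /pP/prime_idealP.
have subP i j x : (i <= j)%N -> (j <= d)%N -> x \in P i -> x \in P j.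
  move=> le; rewrite -(subnKC le); elim: (j - i)%N => [|k IH]; rewrite ?addn0 //.
  by rewrite addnS => lt Px; apply: (sP _ lt).1; apply: IH => //; apply: ltnW.
have top : (fun x => x \in P d : Prop) = mset.
  have [iPd Pd1 _] := pI d (leqnn d).
  apply/funext => x; apply/propext; split; first exact: (proper_sub_m hlocal iPd Pd1).
  move=> mx; apply: contrapT => /negP nPx.
  pose P' i := if (i <= d)%N then P i else m.
  have : prime_chain I d.+1 P'.
    split.
    - rewrite /P' => i _; case: leqP => [/pP //|_].
      have [[m0 mD] m1 mM] := m_prime hlocal; split; last by move=> a b /mM/orP.
      split=> [||a y z]; [exact: m0|exact/negP|exact: mD].
    - by rewrite /P'.
    - move=> i; rewrite ltnS /P' => le; rewrite le; have [lt|ge] := ltnP i d.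
        exact: sP.
      have -> : i = d by lia.
      split; last by exists x.
      exact: (proper_sub_m hlocal iPd Pd1).
  by move/maxd; rewrite ltnn.
have sat i : (i < d)%N -> saturated (fun x => x \in P i) (fun x => x \in P i.+1).
  move=> ltid Q' pQ' PQ' [a [Q'a nPa]] Q'P b Pb; apply: contrapT => nQb.
  pose P' j := if (j <= i)%N then P j else if j == i.+1 then
    (fun x => `[<Q' x>]) : {pred R} else P j.-1.
  have : prime_chain I d.+1 P'.
    split.
    - move=> j le; rewrite /P'; case: leqP => [le'|gt]; first by apply: pP; lia.
      by case: eqP => [_|ne]; [apply: primeIP|apply: pP; lia].
    - by rewrite /P'.
    - move=> j lt; rewrite /P'.
      have [le|gt] := leqP j.+1 i; first by rewrite (ltnW le); apply: sP; lia.
      have [le|gt'] := leqP j i.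
        have -> : j = i by lia.
        rewrite eqxx; split; first by move=> x Px; apply/asboolP/PQ'.
        by exists a; split; [apply/asboolP|apply/negP].
      have -> : (j.+1 == i.+1) = false by lia.
      have [-> /=|ne] := eqVneq j i.+1.
        split; first by move=> x /asboolP; apply: Q'P.
        by exists b; split=> //; apply/asboolP.
      have -> : j.+1.-1 = j.-1.+1 by lia.
      by apply: sP; lia.
  by move/maxd; rewrite ltnn.
suff H j : (j <= d)%N -> exists (A : lmodType R) delta,
    [/\ cyclic_mod (fun x => x \in P (d - j)%N) A,
    jumps A (@zero_set R (Phi A)) (fun _ => True) delta & (p ^ j * alpha <= delta)%N].
  by have := H d (leqnn d); rewrite subnn.
elim: j => [|j IH] le.
  exists k0, alpha; rewrite subn0 top expn0 mul1n.
  by split=> //; apply: cyclic_resfield.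
have [B [delta [cB jB hB]]] := IH (ltnW le).
have [iPj _ _] := pI (d - j.+1)%N (leq_subr _ _).
have [A cA] := cyclic_exists charRp iPj; have [g [gen ann]] := cA.
have [|k [h hP]] := fin_gen_Phi hF (M := A).
  by exists 1%N, (fun _ => g) => x; have [c ->] := gen x; exists (fun _ => c); rewrite big_ord1.
have [||r [jr lr]] := @max_jumps R A (Phi A) (fun _ => True) k => //.
  apply: (length_generators charRp (pI _ (leq_subr _ _)) cA (g := h)) => //.
  apply: (Phi_killed iPj) => a x Pa; have [c ->] := gen x.
  by rewrite scalerA mulrC -scalerA (ann a).2 // scaler0.
exists A, r; split=> //.
have E : (d - j = (d - j.+1).+1)%N by lia.
apply: leq_trans (_ : (p * delta <= r)%N).
  by rewrite expnS -mulnA leq_mul2l hB orbT.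
rewrite E in cB.
have lt : (d - j.+1 < d)%N by lia.
apply: (kunz_step noeth hF (pI _ (leq_subr _ _)) (pI _ lt) cA cB) lr jB => //.
- by move=> a; apply: subP.
- by have [_ [a [Pa /negP nPa]]] := sP _ lt; exists a.
- exact: sat.
Qed.

Lemma nu_push_ge (M : lmodType R) d alpha : fin_gen M -> module_has_dim M d ->
  jumps k0 (@zero_set R (Phi k0)) (fun _ => True) alpha ->
  forall n, ((p ^ d * alpha) ^ n <= nu pi (push n M))%N.
Proof.
move=> fM [[P cP] maxd] ja n.
have [A [delta [cA jA le]]] := prime_chain_residue_growth cP maxd ja.
have [pP IP _] := cP; have pP0 := prime_idealP (pP 0%N (leq0n d)).
have [iP P1 _] := pP0.
have [k [g gP]] := fM.
(* M is replaced with M/PM, as F^n_* of it is again killed by P, and then its rank is at most its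
   number of generators. *)
pose PM (x : M) := exists a : 'I_k -> R, (forall j, a j \in P 0%N) /\ x = \sum_j a j *: g j.
have lPM : lsub PM.
  split; first by exists (fun _ => 0); split; [case: iP|rewrite big1 // => i _; rewrite scale0r].
  move=> c _ _ [a [Pa ->]] [b [Pb ->]]; exists (fun j => c * a j + b j); split.
    by move=> j; case: iP => _; apply.
  by rewrite scaler_sumr -big_split /=; apply: eq_bigr => j _; rewrite scalerDl scalerA.
have [N [q [qo qP]]] := quot_exists charRp lPM.
have NP a (y : N) : a \in P 0%N -> a *: y = 0.
  move=> Pa; have [x <-] := qo y; rewrite -linearZ; apply/qP.
  have [c ->] := gP x; exists (fun j => a * c j); split.
    by move=> j; rewrite mulrC; apply: (@idealM R _ _ _ iP).
  by rewrite scaler_sumr; apply: eq_bigr => j _; rewrite scalerA.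
(* If M/PM vanished at P, then Nakayama would give an annihilator of M outside P, although P
   contains the annihilator of M. *)
have jN : jumps A (@zero_set R N) (fun _ => True) 1.
  apply: jumps1 => //; first exact: lsub0.
  apply/(jump_cyclicP cA) => //; first exact: lsub0.
  apply: contrapT => nex.
  have H i : exists s, ~ s \in P 0%N /\ s *: q (g i) = 0.
    apply: contrapT => ne; apply: nex; exists (q (g i)); split=> // s nPs E.
    by apply: ne; exists s.
  have [s sP] := boolp.choice H.
  have nPs : ~ (\prod_i s i) \in P 0%N.
    elim/big_ind: _ => //; first by move=> x y; apply: (primeM pP0).
    by move=> i _; have [] := sP i.
  have [i|t [nPt tg]] := nakayama_prime (g := g) pP0 nPs.
    have /qP [a [Pa E]] : q ((\prod_i s i) *: g i) = 0.
      rewrite linearZ (bigD1 i) //= mulrC -scalerA.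
      by have [_ ->] := sP i; rewrite scaler0.
    by exists a.
  apply: nPt; apply: IP => x; have [c ->] := gP x.
  rewrite scaler_sumr big1 // => j _.
  by rewrite scalerA mulrC -scalerA tg scaler0.
have [k' [g' [gP' le']]] := nu_generators hlocal (fin_gen_push hF n fM).
apply: leq_trans le'; apply: (@leq_trans (delta ^ n)); first by case: (n) => [|n0]; rewrite ?expn0 ?leq_exp2r.
have jn := jumps_frob n jA jN; rewrite mul1n in jn.
have [qn qnE] := lin_restrict (frobenius_iter charRp n) q.
apply: (@length_generators _ _ charRp _ _ pP0 cA k' (push n N) (fun i => qn (g' i))) jn => //.
  exact: (push_killed (n := n) iP NP).
move=> y; have [x Ex] := qo (y : N); have [c Ec] := gP' (x : push n M).
exists c; have -> : y = qn x by rewrite qnE.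
by rewrite Ec linear_sum; apply: eq_bigr => j _; rewrite linearZ.
Qed.

End LowerBound.

(** * Torsion modules and the hull of the residue field *)

Section Torsion.
Variables (R : comNzRingType) (m : {pred R}) (K : fieldType) (pi : {rmorphism R -> K}).
Hypothesis hlocal : is_local_ring m pi.
Implicit Types X Y : lmodType R.
Notation k0 := (resfield pi).

Let noeth := local_noetherian hlocal.

(** As m is finitely generated, this amounts to being killed by a power of m ([torsP]); testing one
    scalar at a time makes the invariance under F^n_* plain. *)
Definition tors X (x : X) : Prop := forall a, a \in m -> exists t, a ^+ t *: x = 0.
Definition torsion_mod X : Prop := forall x : X, tors x.
Definition soc X (x : X) : Prop := forall a, a \in m -> a *: x = 0.

Lemma lsub_tors X : lsub (@tors X).
Proof.
split=> [a _|c x y tx ty a ma]; first by exists 0%N; rewrite scaler0.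
have [[t Et] [u Eu]] := (tx a ma, ty a ma); exists (t + u)%N.
have Ey : a ^+ (t + u) *: y = 0 by rewrite exprD -scalerA Eu scaler0.
rewrite scalerDr Ey addr0 scalerA mulrC -scalerA addnC exprD -scalerA Et.
by rewrite !scaler0.
Qed.

Lemma lsub_soc X : lsub (@soc X).
Proof.
split=> [a _|c x y sx sy a ma]; first exact: scaler0.
by rewrite scalerDr scalerA mulrC -scalerA sx // sy // scaler0 addr0.
Qed.

Lemma tors_lin X Y (f : {linear X -> Y}) x : tors x -> tors (f x).
Proof.
by move=> tx a /tx[t Et]; exists t; rewrite -linearZ Et linear0.
Qed.

Lemma tors_inj X Y (f : {linear X -> Y}) x : injective f -> tors (f x) -> tors x.
Proof.
move=> inj tx a /tx[t Et]; exists t; apply: inj.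
by rewrite linear0 linearZ.
Qed.

Lemma torsion_sq X Y : sq X Y -> torsion_mod X -> torsion_mod Y.
Proof.
case=> r [rr o u] tX y a ma; have [x rxy] := o y; have [t Et] := tX x a ma.
by exists t; apply: u; rewrite -Et; apply: lrelZ.
Qed.

Lemma max_fg : exists gs : seq R, (forall a, a \in gs -> a \in m) /\
  forall a, a \in m -> exists c : nat -> R, a = \sum_(i < size gs) c i * gs`_i.
Proof.
have [im _ _] := m_prime hlocal; have [k [g [gm gP]]] := ideal_fg noeth im.
exists [seq g i | i <- enum 'I_k]; split=> [a /mapP[i _ ->] //|a /gP[c ->]].
pose c' n := if insub n is Some i then c i else 0.
exists c'; rewrite size_map size_enum_ord; apply: eq_bigr => i _.
rewrite (nth_map i) ?size_enum_ord // nth_ord_enum /c' insubT //= => lt.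
by congr (c _ * _); apply: val_inj.
Qed.

Lemma max_closed_by_gens X (U : set X) gs x : lsub U ->
  (forall a, a \in m -> exists c : nat -> R, a = \sum_(i < size gs) c i * gs`_i) ->
  (forall a, a \in gs -> U (a *: x)) -> forall a, a \in m -> U (a *: x).
Proof.
move=> lU gsP Ux a /gsP[c ->]; rewrite scaler_suml; apply: lsub_sum => // i.
by rewrite -scalerA; apply: lsubZ => //; apply: Ux; apply: mem_nth.
Qed.

(** The generators of m are treated one after another, each time multiplying by the largest power
    that stays outside U. *)
Lemma socle_mod X (U : set X) x : lsub U -> tors x -> ~ U x ->
  exists r, ~ U (r *: x) /\ forall a, a \in m -> U (a *: (r *: x)).
Proof.
move=> lU tx nUx; have [gs [gm gsP]] := max_fg.
suff [r [nU rU]] : exists r, ~ U (r *: x) /\ forall a, a \in gs -> U (a *: (r *: x)).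
  by exists r; split=> //; apply: max_closed_by_gens gsP rU.
elim: gs gm {gsP} => [|b gs IH] gm; first by exists 1; rewrite scale1r.
have [|r [nU rU]] := IH; first by move=> a ag; apply: gm; rewrite inE ag orbT.
have mb : b \in m by apply: gm; rewrite inE eqxx.
have ex : exists t, `[<U (b ^+ t *: (r *: x))>].
  have [t Et] := tx b mb; exists t; apply/asboolP.
  by rewrite scalerA mulrC -scalerA Et scaler0; case: lU.
case: (ex_minnP ex) => -[|t] /asboolP Ut min; first by case: nU; rewrite expr0 scale1r in Ut.
exists (b ^+ t * r); split.
  by rewrite -scalerA => /asboolP/min; rewrite ltnn.
move=> a; rewrite inE => /orP[/eqP ->|/rU Ua]; first by rewrite !scalerA mulrA -exprS -scalerA.
by rewrite scalerA mulrCA -!scalerA; apply: lsubZ.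
Qed.

(** A pigeonhole on exponents: expanding one factor of the product in the generators replaces x by
    multiples gs_i x, for which the sum of the t i drops by one. *)
Lemma prod_tors X (gs : seq R) (t : nat -> nat) (s : nat) (x : X) (l : seq R) :
  (forall a, a \in m -> exists c : nat -> R, a = \sum_(i < size gs) c i * gs`_i) ->
  (forall i, (i < size gs)%N -> gs`_i ^+ t i *: x = 0) ->
  (\sum_(i < size gs) t i <= s)%N -> (forall a, a \in l -> a \in m) ->
  size l = s.+1 -> (\prod_(a <- l) a) *: x = 0.
Proof.
move=> gsP; elim: s t x l => [|s IH] t x [|b l] // Et le lm /= [sz].
  have [|c ->] := gsP b; first by apply: lm; rewrite inE eqxx.
  rewrite big_cons mulrC -scalerA scaler_suml [\sum_(i < _) _]big1 ?scaler0 // => i _.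
  have : (t i <= 0)%N by apply: leq_trans le; rewrite (bigD1 i) //= leq_addr.
  rewrite leqn0 => /eqP ti; have := Et i (ltn_ord i).
  by rewrite ti expr0 scale1r => ->; rewrite scaler0.
have [|c ->] := gsP b; first by apply: lm; rewrite inE eqxx.
rewrite big_cons mulrC -scalerA scaler_suml scaler_sumr [\sum_(i < _) _]big1 // => i _.
rewrite -scalerA scalerA mulrC -scalerA.
case ti : (t i) => [|n].
  by have := Et i (ltn_ord i); rewrite ti expr0 scale1r => ->; rewrite !scaler0.
rewrite (IH (fun j => if j == i :> nat then n else t j)) ?scaler0 //.
- move=> j lt; case: eqP => [->|_]; last by rewrite scalerA mulrC -scalerA Et ?scaler0.
  by rewrite scalerA -exprSr -ti; apply: Et.
- move: le; rewrite (bigD1 i) //= ti addSn ltnS => le.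
  rewrite (bigD1 i) //= eqxx (eq_bigr (fun j : 'I__ => t j)) // => j.
  by rewrite -val_eqE => /negbTE ->.
- by move=> a al; apply: lm; rewrite inE al orbT.
Qed.

(** The annihilator of m^t in X. *)
Definition Et X t (x : X) : Prop := forall l : seq R,
  (forall a, a \in l -> a \in m) -> size l = t -> (\prod_(a <- l) a) *: x = 0.

Lemma Et_leq X t t' (x : X) : (t <= t')%N -> Et t x -> Et t' x.
Proof.
move=> le H l lm sz; rewrite -[l](cat_take_drop t) big_cat /= mulrC -scalerA.
rewrite H ?scaler0 //; first by move=> a /mem_take; apply: lm.
by rewrite size_takel // sz.
Qed.

Lemma torsP X (x : X) : tors x <-> exists t, Et t x.
Proof.
split=> [tx|[t H] a ma]; last first.
  exists t; have := H (nseq t a); rewrite big_nseq -Monoid.iteropE /= => -> //.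
    by move=> b /nseqP[->].
  by rewrite size_nseq.
have [gs [gm gsP]] := max_fg.
have ex i : exists t, (i < size gs)%N -> gs`_i ^+ t *: x = 0.
  have [lt|ge] := ltnP i (size gs); last by exists 0%N.
  by have [t Et] := tx _ (gm _ (mem_nth 0 lt)); exists t.
have [t tP] := boolp.choice ex.
exists (\sum_(i < size gs) t i).+1 => l lm sz.
exact: (prod_tors gsP tP (leqnn _)).
Qed.

Lemma torsionP X (x : X) : tors x <-> torsion m x.
Proof.
split=> [/torsP[t H]|[t H] a ma].
  exists t => a am; have := H [seq a i | i <- enum 'I_t]; rewrite big_map big_enum /=.
  apply; last by rewrite size_map size_enum_ord.
  by move=> b /mapP[i _ ->].
exists t; have := H (fun _ => a) (fun _ => ma).
by rewrite prodr_const card_ord.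
Qed.

Lemma Et_gens X gs t (x : X) :
  (forall a, a \in m -> exists c : nat -> R, a = \sum_(i < size gs) c i * gs`_i) ->
  (forall w : t.-tuple 'I_(size gs), (\prod_(i <- w) gs`_i) *: x = 0) -> Et t x.
Proof.
move=> gsP; elim: t x => [|t IH] x H [|b l] // lm /= sz.
  by have := H [tuple]; rewrite !big_nil.
case: sz => sz; have [|c ->] := gsP b; first by apply: lm; rewrite inE eqxx.
rewrite big_cons mulrC -scalerA scaler_suml scaler_sumr [\sum_(i < _) _]big1 // => i _.
rewrite -scalerA scalerA mulrC -scalerA (IH (gs`_i *: x)) ?scaler0 //.
  move=> w; rewrite scalerA mulrC.
  by have := H [tuple of i :: w]; rewrite big_cons.
by move=> a al; apply: lm; rewrite inE al orbT.
Qed.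

Lemma jump_resfield X (U U' : set X) : lsub U -> lsub U' -> (forall x, U x -> U' x) ->
  (exists x, U' x /\ ~ U x) -> jump k0 U U'.
Proof.
move=> lU lU' sub [x [U'x nUx]]; apply/(jump_cyclicP (cyclic_resfield hlocal)) => //.
exists x; split=> // s /negP/(notm_unit hlocal)[y Ey] /(lsubZ y lU).
by rewrite scalerA Ey scale1r.
Qed.

(** The socle is cut out by finitely many generators of m, and [dcc_power_torsion] drops these
    conditions one at a time. *)
Lemma dcc_soc X c : torsion_mod X -> length_le k0 (@soc X) c -> dcc (fun _ : X => True).
Proof.
move=> tX hc; have [gs [gm gsP]] := max_fg.
have D : dcc (fun x : X => forall a, a \in gs -> a *: x = 0).
  apply: (dcc_length (S := k0) (@jump_resfield X) (c := c)).
  apply: length_leW hc => // x kx a ma.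
  exact: (max_closed_by_gens (@lsub0 _ X) gsP kx).
suff H (hs : seq R) : (forall a, a \in hs -> a \in m) ->
    dcc (fun x : X => forall a, a \in hs -> a *: x = 0) -> dcc (fun _ : X => True).
  exact: H D.
elim: hs => [|b hs IH] hm; first by apply: dccW.
move=> Db; apply: IH => [a ah|]; first by apply: hm; rewrite inE ah orbT.
apply: (dcc_power_torsion (a := b)).
- split=> [a _|a x y kx ky c' hc']; first exact: scaler0.
  by rewrite scalerDr scalerA mulrC -scalerA kx // ky // scaler0 addr0.
- by move=> x _; apply: tX; apply: hm; rewrite inE eqxx.
- apply: dccW Db => x [kx Eb] a; rewrite inE => /orP[/eqP -> //|]; exact: kx.
Qed.

Lemma socle_zero X : torsion_mod X -> (forall x : X, soc x -> x = 0) ->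
  forall x : X, x = 0.
Proof.
move=> tX s0 x; apply: contrapT => nx.
have [r [nr rs]] := socle_mod (@lsub0 _ X) (tX x) nx.
by apply: nr; apply: s0.
Qed.

End Torsion.

(** * The injective hull of the residue field among torsion modules *)

Section TorsionHull.
Variables (R : comNzRingType) (m : {pred R}) (K : fieldType) (pi : {rmorphism R -> K}).
Hypothesis hlocal : is_local_ring m pi.
Implicit Types X Y : lmodType R.
Notation k0 := (resfield pi).
Notation soc := (soc m).
Notation tors := (tors m).
Notation torsion_mod := (torsion_mod m).
Notation Et := (Et m).

(* [E] is an essential extension of the residue field, with generator [e] of
   its socle, injective among the m-torsion modules: the injective hull of the
   residue field. *)
Definition hull (E : lmodType R) (e : E) : Prop :=
  [/\ torsion_mod E, e <> 0, forall x : E, soc x <-> exists r, x = r *: e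
    & forall X, torsion_mod X -> extends X E].

(** E is a maximal element among the m-torsion submodules of an injective module T containing K
    whose socle is just this copy of K. *)
Lemma hull_exists (p : nat) (charRp : p \in [pchar R]) : exists (E : lmodType R) (e : E), hull e.
Proof.
pose T : lmodType R := coind R k0.
have [hu huE] := coind_unit k0; pose e0 : T := hu (1 : K).
have e0n : e0 <> 0.
  move=> /(congr1 (fun f => cofun f 1)); rewrite /e0 huE scale1r => /eqP.
  by rewrite oner_eq0.
have e0s : soc e0.
  by move=> a; rewrite (mP hlocal) -linearZ resfieldE => /eqP ->; rewrite mul0r linear0.
pose good (U : set T) := [/\ lsub U, U e0, forall x, U x -> tors x
  & forall x, U x -> soc x -> exists r, x = r *: e0].
pose P (U : set T) := (forall z, ~ U z) \/ good U.
have [|U [PU mU]] := @Zorn_bigcup _ P.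
  move=> F FP tot.
  have gF U z : F U -> U z -> good U.
    by move=> FU Uz; case: (FP _ FU) => // nU; case: (nU z).
  have [[U0 [F0 [z0 Uz0]]]|nF] := pselect (exists U, F U /\ exists z, U z); last first.
    by left=> z [U FU Uz]; apply: nF; exists U; split=> //; exists z.
  have [[U00 _] U0e _ _] := gF _ _ F0 Uz0.
  right; split.
  - split; first by exists U0.
    move=> a x y [V FV Vx] [W FW Wy].
    case: (tot _ _ FV FW) => sub.
      by exists W => //; have [[_ WD] _ _ _] := gF _ _ FW Wy; apply: WD => //; apply: sub.
    by exists V => //; have [[_ VD] _ _ _] := gF _ _ FV Vx; apply: VD => //; apply: sub.
  - by exists U0.
  - by move=> x [V FV Vx]; have [_ _ + _] := gF _ _ FV Vx; apply.
  - by move=> x [V FV Vx]; have [_ _ _] := gF _ _ FV Vx; apply.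
have gU : good U.
  case: PU => // nU; exfalso.
  apply: (mU (fun x => exists r : R, x = r *: e0)).
    split=> [z /nU //|/(_ e0) H]; apply: (nU e0); apply: H.
    by exists 1; rewrite scale1r.
  right; split=> //; first exact: lsub_cyc.
    by exists 1; rewrite scale1r.
  by move=> _ [r ->] a ma; exists 1%N; rewrite expr1 scalerA mulrC -scalerA e0s // scaler0.
have [lU Ue tU sU] := gU.
have max V : good V -> (forall x, U x -> V x) -> forall x, V x -> U x.
  move=> gV sub x Vx; apply: contrapT => nUx; apply: (mU V); last by right.
  by split=> [//|H]; apply/nUx/H.
have [E [i [inji iP]]] := sub_exists lU.
have [e Ee] := (iP e0).1 Ue.
have soci x : soc (i x) <-> soc x.
  split=> sx a ma; last by rewrite -linearZ sx ?linear0.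
  by apply: inji; rewrite linearZ linear0 /= sx.
exists E, e; split.
- by move=> x; apply: (tors_inj inji); apply/tU/iP; exists x.
- by move=> E0; apply: e0n; rewrite -Ee E0 linear0.
- move=> x; split=> [/soci/(sU (i x)) hx|[r ->]].
    have [|r Er] := hx; first by apply/iP; exists x.
    by exists r; apply: inji; rewrite Er linearZ /= Ee.
  by apply/soci; rewrite linearZ /= Ee => a ma; rewrite scalerA mulrC -scalerA e0s // scaler0.
move=> X tX r0 rr0 ur0.
have [|r [[r00 rB rZ] ur sr mr]] := @Zorn_rel X E R (fun a x => a *: x)
    (fun a x => a *: x) r0 _ ur0.
  split; [by case: rr0|by move=> *; apply: lrelB|by move=> *; apply: lrelZ].
have rr : lrel r.
  split=> // a x x' y y' h h'; rewrite -[x']opprK -[y']opprK; apply: rB; first exact: rZ.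
  by rewrite -[- x']scaleN1r -[- y']scaleN1r; apply: rZ.
suff tot x : exists y, r x y.
  by have [g gP] := lrel_fun rr tot ur; exists g => x y /sr/gP.
apply: contrapT => nx0; pose D x := exists y, r x y.
have lD : lsub D.
  split; first by exists 0.
  by move=> a u v [y ry] [z rz]; exists (a *: y + z); case: rr => _; apply.
have [s [nx mx]] := socle_mod hlocal lD (tX x) nx0; set z := s *: x in nx mx.
have [||g gP] := (injective_moduleP T).1 (coind_injective charRp (Y := k0)) X
  (fun u w => exists2 y, r u y & i y = w).
- split; first by exists 0; rewrite ?linear0.
  move=> a u v _ _ [y h <-] [y' h' <-]; exists (a *: y + y'); last by rewrite linearP.
  by case: rr => _; apply.
- by move=> w [y /ur -> <-]; rewrite linear0.
have Ug a : a \in m -> U (a *: g z).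
  by move=> /mx[y ry]; rewrite -linearZ (gP _ (i y)); [apply/iP; exists y|exists y].
(* [w] will be the value at z. If adding g z to U creates no new socle, then g z is in U by
   maximality. Otherwise a new socle element u + c g z has c a unit, and w = - c^-1 u has the same
   multiples by m as g z. *)
have [w [Uw Ew]] : exists w, U w /\ forall a, a \in m -> a *: w = a *: g z.
  pose V v := exists u c, U u /\ v = u + c *: g z.
  have lV : lsub V.
    split; first by exists 0, 0; rewrite scale0r addr0; split=> //; case: lU.
    move=> a _ _ [u [c [Uu ->]]] [u' [c' [Uu' ->]]].
    exists (a *: u + u'), (a * c + c'); split; first by case: lU => _; apply.
    by rewrite scalerDr scalerDl scalerA addrACA.
  have tg : tors (g z) by apply/tors_lin/tX.
  have [sV|nsV] := pselect (forall v, V v -> soc v -> exists r, v = r *: e0).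
    have Vg : U (g z).
      apply: (max V); last by exists 0, 1; rewrite add0r scale1r; split=> //; case: lU.
        split=> //; first by exists e0, 0; rewrite scale0r addr0.
        move=> _ [u [c [Uu ->]]].
        have [_ tD] := @lsub_tors R m T.
        by rewrite addrC; apply: tD => //; apply: tU.
      by move=> v Uv; exists v, 0; rewrite scale0r addr0.
    by exists (g z).
  have [_ [[u [c [Uu ->]]] [sv nv]]] : exists v, V v /\ soc v /\ ~ exists r, v = r *: e0.
    apply: contrapT => ne; apply: nsV => v Vv sv; apply: contrapT => nv.
    by apply: ne; exists v.
  have [mc|/(notm_unit hlocal) [b Eb]] := boolP (c \in m).
    by case: nv; apply: sU => //; apply: lsubD => //; apply: Ug.
  exists (- (b *: u)); split; first by apply: (lsubN lU); apply: (lsubZ _ lU).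
  move=> a ma; have /(congr1 (fun v => b *: v)) := sv a ma.
  rewrite scaler0 scalerDr scalerDr !scalerA => /eqP; rewrite addr_eq0 => /eqP E'.
  rewrite scalerN scalerA [a * b]mulrC E' opprK.
  by rewrite -mulrA mulrCA Eb mulr1.
have [y0 Ey0] := (iP w).1 Uw.
apply: (nx); exists y0; apply: (mr (fun u y => exists c u' y', [/\ r u' y',
  u = u' + c *: z & y = y' + c *: y0])); last first.
- by exists 1, 0, 0; rewrite !add0r !scale1r.
- by move=> u y h; exists 0, u, y; rewrite !scale0r !addr0.
- move=> y [c [u' [y' [h /esym/eqP + ->]]]]; rewrite addr_eq0 => /eqP E'.
  have mc : c \in m.
    apply: contraT => /(notm_unit hlocal) [b Eb]; case: nx.
    exists (- (b *: y')); rewrite -[z]scale1r -Eb -scalerA -[c *: z]opprK -E'.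
    by rewrite scalerN -!scaleNr; apply: rZ.
  apply: inji; rewrite linear0 linearD linearZ /= Ey0 Ew // -linearZ.
  have -> : i y' = g u' by rewrite (gP _ (i y')) //; exists y'.
  by rewrite E' linearN addNr.
- split.
  + by exists 0, 0, 0; rewrite !scale0r !addr0.
  + move=> u1 u2 y1 y2 [c [u [y [h -> ->]]]] [c' [u' [y' [h' -> ->]]]].
    exists (c - c'), (u - u'), (y - y'); split; first exact: rB.
      by rewrite scalerBl opprD addrACA.
    by rewrite scalerBl opprD addrACA.
  + move=> a _ _ [c [u [y [h -> ->]]]]; exists (a * c), (a *: u), (a *: y); split.
    * exact: rZ.
    * by rewrite scalerDr scalerA.
    * by rewrite scalerDr scalerA.
Qed.

Section Hull.
Variables (E : lmodType R) (e : E) (hE : hull e).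

(** Some multiple z of w is a nonzero socle element modulo U; z |-> e is well defined modulo U and
    extends to X. *)
Lemma hull_cogenerates X (U : set X) w : torsion_mod X -> lsub U -> ~ U w ->
  exists f : {linear X -> E}, (forall u, U u -> f u = 0) /\ f w <> 0.
Proof.
have [tE e0 sE xE] := hE; move=> tX lU nUw.
have [s [ns ms]] := socle_mod hlocal lU (tX w) nUw; set z := s *: w in ns ms.
have [||f fP] := xE X tX (fun x y => exists u c, [/\ U u, x = u + c *: z & y = c *: e]).
- split; first by exists 0, 0; rewrite !scale0r addr0; split=> //; case: lU.
  move=> a _ _ _ _ [u [c [Uu -> ->]]] [u' [c' [Uu' -> ->]]].
  exists (a *: u + u'), (a * c + c'); split; first by case: lU => _; apply.
    by rewrite scalerDr scalerDl scalerA addrACA.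
  by rewrite scalerDl scalerA.
- move=> _ [u [c [Uu /esym/eqP + ->]]]; rewrite addr_eq0 => /eqP Eu.
  apply: (sE e).2; first by exists 1; rewrite scale1r.
  apply: contraT => /(notm_unit hlocal) [b Eb]; case: ns.
  rewrite -[z]scale1r -Eb -scalerA -[c *: z]opprK -Eu.
  by apply: (lsubZ _ lU); apply: lsubN.
exists f; split=> [u Uu|Ew].
  by apply: fP; exists u, 0; rewrite !scale0r addr0.
have E1 : f (1 *: z) = 1 *: e.
  by apply: fP; exists 0, 1; rewrite add0r; split=> //; case: lU.
by apply: e0; rewrite -[LHS]scale1r -E1 scale1r /z linearZ /= Ew scaler0.
Qed.

Lemma hull_end_socle (f : {linear E -> E}) : exists c, forall x, soc x -> f x = c *: x.
Proof.
have [tE e0 sE xE] := hE.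
have [c Ec] : exists c, f e = c *: e.
  apply/sE => a ma; rewrite -linearZ.
  by rewrite ((sE e).2 _ a ma) ?linear0 //; exists 1; rewrite scale1r.
exists c => x /sE[r ->]; by rewrite linearZ /= Ec !scalerA mulrC.
Qed.

(* An endomorphism of [E] vanishing on the elements killed by [m ^ t] maps [x]
   killed by [m ^ t.+1] to a combination of the elements [s x] of the socle,
   for [s] in a set of generators of [m ^ t]. *)
Lemma hull_end_bounded t (f : {linear E -> E}) :
  exists r, forall x, Et t x -> f x = r *: x.
Proof.
have [tE e0 sE xE] := hE.
elim: t f => [|t IH] f.
  exists 0 => x /(_ [::]); rewrite big_nil scale1r => -> //.
  by rewrite linear0 scaler0.
have [r0 r0P] := IH f; have [gs [gm gsP]] := max_fg hlocal.
pose k := size gs; pose W := t.-tuple 'I_k.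
pose s (w : W) := \prod_(i <- w) gs`_i.
pose X : lmodType R := {ffun W -> E}.
have tX : torsion_mod X.
  move=> v a ma; have [n nP] := boolp.choice (fun w => tE (v w) a ma).
  exists (\sum_w n w)%N; apply/ffunP => w; rewrite !ffunE (bigD1 w) //= addnC exprD.
  by rewrite -scalerA nP scaler0.
have ssoc x w : Et t.+1 x -> soc (s w *: x).
  move=> Ex a ma; rewrite scalerA.
  have := Ex (a :: [seq gs`_(nat_of_ord i) | i <- w]); rewrite big_cons big_map; apply.
    by move=> b; rewrite inE => /orP[/eqP -> //|/mapP[i _ ->]]; apply/gm/mem_nth.
  by rewrite /= size_map size_tuple.
have lEt : lsub (@Et E t.+1).
  split=> [l _ _|a x y Ex Ey l lm sz]; first by rewrite scaler0.
  by rewrite scalerDr scalerA mulrC -scalerA Ex // Ey // scaler0 addr0.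
(* The products s w generate m^t, so if all s w x vanish then f x = r0 x by induction. Hence f x -
   r0 x is a function of the tuple of the s w x, and this function extends to all of X = E^W. *)
have [||G GP] := xE X tX (fun v y => exists x, [/\ Et t.+1 x, v = [ffun w => s w *: x] &
  y = f x - r0 *: x]).
- split.
    exists 0; split; [by case: lEt|by apply/ffunP => w; rewrite !ffunE scaler0|].
    by rewrite linear0 scaler0 subr0.
  move=> a v v' y y' [x [Ex -> ->]] [x' [Ex' -> ->]]; exists (a *: x + x'); split.
  + by case: lEt => _; apply.
  + apply/ffunP => w; rewrite !ffunE scalerDr !scalerA; congr (_ *: _ + _).
    exact: mulrC.
  + rewrite linearP scalerBr scalerDr opprD addrACA; by rewrite !scalerA [a * r0]mulrC.
- move=> y [x [Ex /ffunP Ev ->]]; rewrite r0P ?subrr //.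
  by apply: (Et_gens gsP) => w; have := Ev w; rewrite !ffunE => <-.
pose delta w (u : E) : X := [ffun w' => if w' == w then u else 0].
have dl w (a : R) u v : G (delta w (a *: u + v)) = a *: G (delta w u) + G (delta w v).
  rewrite -linearP; congr (G _); apply/ffunP => w'; rewrite !ffunE.
  by case: eqP => // _; rewrite scaler0 addr0.
have cex w : exists c, forall x, soc x -> G (delta w x) = c *: x.
  have [g gE] := lin_exists (dl w); have [c cP] := hull_end_socle g.
  by exists c => x /cP; rewrite gE.
have [c cP] := boolp.choice cex.
exists (r0 + \sum_w c w * s w) => x Ex.
rewrite scalerDl; apply/eqP; rewrite addrC -subr_eq; apply/eqP.
rewrite -(GP [ffun w => s w *: x] (f x - r0 *: x)); last by exists x.
have -> : [ffun w => s w *: x] = \sum_w delta w (s w *: x) :> X.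
  apply/ffunP => w; rewrite sum_ffunE ffunE (bigD1 w) //= ffunE eqxx big1 ?addr0 // => w' ne.
  by rewrite ffunE eq_sym (negbTE ne).
rewrite linear_sum scaler_suml; apply: eq_bigr => w _.
by rewrite /= cP ?scalerA //; apply: ssoc.
Qed.

(** Two elements of E are killed by a common power of m, modulo which the completion agrees with
    R. *)
Lemma hull_end2 (f : {linear E -> E}) x y : exists r, f x = r *: x /\ f y = r *: y.
Proof.
have [tE e0 sE xE] := hE.
have [t Ex] := (torsP hlocal x).1 (tE x); have [u Ey] := (torsP hlocal y).1 (tE y).
have [r rP] := hull_end_bounded (maxn t u) f.
by exists r; split; apply: rP; [apply: Et_leq Ex|apply: Et_leq Ey]; lia.
Qed.

Lemma hull_dcc : dcc (fun _ : E => True).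
Proof.
have [tE e0 sE xE] := hE.
apply: (dcc_soc hlocal tE (c := 1)).
apply: (length_cyclic (m_prime hlocal) (cyclic_resfield hlocal) (g := e)).
  by apply/sE; exists 1; rewrite scale1r.
by move=> x /sE.
Qed.

End Hull.
End TorsionHull.

(** * Filtrations by coprimes *)

Section Filtrations.
Variable R : comNzRingType.
Implicit Types X Y N M S : lmodType R.

(** The relational form of [subquot_iso]: [r] has domain exactly U', so factors compose without
    values chosen outside. *)
Definition factor X (U U' : set X) N : Prop := exists r : X -> N -> Prop,
  [/\ lrel r, forall x, U' x <-> exists s, r x s, forall s, exists x, r x s,
      univalent r & forall x, U x <-> r x 0].

Inductive filt (V : lmodType R -> Prop) X : set X -> set X -> nat -> Prop :=
| filt0 U : lsub U -> filt V U U 0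
| filtS U U' U'' k N : filt V U U' k -> lsub U'' -> V N -> factor U' U'' N ->
    filt V U U'' k.+1.

Lemma filt_lsub V X (U U' : set X) k : filt V U U' k ->
  [/\ lsub U, lsub U' & forall x, U x -> U' x].
Proof.
elim=> {U U' k} [U lU|U U' U'' k N _ [lU lU' sub] lU'' _ [r [rr d o u k0]]] //.
by split=> // x /sub/k0 h; apply/d; exists 0.
Qed.

Lemma filt_trans V X (U U' U'' : set X) k l :
  filt V U U' k -> filt V U' U'' l -> filt V U U'' (k + l).
Proof.
move=> h1 h2; elim: h2 h1 => {U' U'' l} [U' l'|U' V' W l N _ IH lW VN f] h1.
  by rewrite addn0.
by rewrite addnS; apply: filtS VN f => //; apply: IH.
Qed.

Lemma filtW (V V' : lmodType R -> Prop) X (U U' : set X) k :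
  (forall N, V N -> V' N) -> filt V U U' k -> filt V' U U' k.
Proof.
move=> s; elim=> {U U' k} [U lU|U U' W k N _ IH lW VN f]; first exact: filt0.
by apply: filtS IH lW (s _ VN) f.
Qed.

Lemma factor_pull X N (r : X -> N -> Prop) (A B : set N) M : lrel r -> univalent r ->
  (forall s, exists x, r x s) -> factor A B M ->
  factor (fun x => exists2 s, r x s & A s) (fun x => exists2 s, r x s & B s) M.
Proof.
move=> rr ur ro [t [tr td to tu tk]].
exists (fun x w => exists2 s, r x s & t s w); split.
- split; first by exists 0; [case: rr|case: tr].
  move=> a x x' w w' [s h h1] [s' h' h1']; exists (a *: s + s').
    by case: rr => _; apply.
  by case: tr => _; apply.
- move=> x; split=> [[s h /td[w h1]]|[w [s h h1]]]; first by exists w, s.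
  by exists s => //; apply/td; exists w.
- by move=> w; have [s h] := to w; have [x h'] := ro s; exists x, s.
- by move=> w [s /ur ->]; apply: tu.
- by move=> x; split=> -[s h h1]; exists s => //; apply/tk.
Qed.

Lemma filt_pull V X N (r : X -> N -> Prop) (A B : set N) k : lrel r -> univalent r ->
  (forall s, exists x, r x s) -> filt V A B k ->
  filt V (fun x => exists2 s, r x s & A s) (fun x => exists2 s, r x s & B s) k.
Proof.
move=> rr ur ro.
have lp C : lsub C -> lsub (fun x => exists2 s, r x s & C s).
  move=> [C0 CD]; split; first by exists 0 => //; case: rr.
  move=> a x y [s h Cs] [t h' Ct]; exists (a *: s + t); last exact: CD.
  by case: rr => _; apply.
elim=> {A B k} [A lA|A B C k M _ IH lC VM f]; first by apply: filt0; apply: lp.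
by apply: filtS IH (lp _ lC) VM _; apply: factor_pull.
Qed.

Lemma filt_factor V X (U U' : set X) N k : factor U U' N ->
  filt V (@zero_set R N) (fun _ => True) k -> filt V U U' k.
Proof.
move=> [r [rr d o u kr]] /(filt_pull rr u o).
have -> : (fun x => exists2 s, r x s & zero_set s) = U.
  apply/funext => x; apply/propext; split=> [[s h E]|/kr h]; first by apply/kr; rewrite -(E : s = 0).
  by exists 0.
have -> // : (fun x => exists2 s, r x s & True) = U'.
apply/funext => x; apply/propext; split=> [[s h _]|/d[s h]]; last by exists s.
by apply/d; exists s.
Qed.

Lemma factor_restrict (phi : {rmorphism R -> R}) X (U U' : set X) N :
  factor U U' N ->
  factor (U : set (restrict phi X)) (U' : set (restrict phi X)) (restrict phi N).
Proof. by move=> [r [/(lrel_restrict phi) rr d o u k]]; exists r. Qed.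

Lemma factor_iso X (U U' : set X) N M (f : {linear N -> M}) :
  (forall y, exists x, f x = y) -> (forall x, f x = 0 -> x = 0) ->
  factor U U' N -> factor U U' M.
Proof.
move=> fo f0 [r [rr d o u k]]; exists (fun x y => exists2 s, r x s & f s = y); split.
- split; first by exists 0; [case: rr|rewrite linear0].
  move=> a x x' _ _ [s h <-] [s' h' <-]; exists (a *: s + s'); last by rewrite linearP.
  by case: rr => _; apply.
- move=> x; split=> [/d[s h]|[_ [s h _]]]; first by exists (f s), s.
  by apply/d; exists s.
- by move=> y; have [s <-] := fo y; have [x h] := o s; exists x, s.
- by move=> y [s /u -> <-]; rewrite linear0.
- move=> x; split=> [/k h|[s h /f0 E]]; first by exists 0; rewrite ?linear0.
  by apply/k; rewrite -E.
Qed.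

Lemma factor_self X N (f : {linear X -> N}) :
  (forall y, exists x, f x = y) -> (forall x, f x = 0 -> x = 0) ->
  factor (@zero_set R X) (fun _ => True) N.
Proof.
move=> fo f0; exists (fun x y => f x = y); split=> //.
- split; first exact: linear0.
  by move=> a x x' _ _ <- <-; rewrite linearP.
- by move=> x; split=> // _; exists (f x).
- by move=> y <-; rewrite linear0.
- by move=> x; split=> [->|/f0 //]; rewrite linear0.
Qed.

Lemma factor_lsub_jump S X (U U' : set X) : factor U U' S -> jump S U U'.
Proof.
move=> [r [rr d o u k]]; exists r; split=> //.
  by move=> x s h; apply/d; exists s.
move=> x s /k h h'; apply/eqP; rewrite -subr_eq0; apply/eqP/u.
by rewrite -(subrr x); apply: lrelB.
Qed.

End Filtrations.

(** * Coprime submodules of the hull *)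

Section Coprimes.
Variables (R : comNzRingType) (m : {pred R}) (K : fieldType) (pi : {rmorphism R -> K}).
Variables (p : nat) (charRp : p \in [pchar R]).
Hypothesis hlocal : is_local_ring m pi.
Implicit Types X Y S : lmodType R.
Notation k0 := (resfield pi).
Notation soc := (@soc R m _).
Notation torsion_mod := (torsion_mod m).
Notation push n X := (frobenius_push charRp n X).
Variables (E : lmodType R) (e : E) (hE : hull m e).

(* The annihilators in [E] of the primes of the completion of [R], which is the
   endomorphism ring of [E]. *)
Definition coprime_sub (W : set E) : Prop :=
  [/\ lsub W, exists x, W x /\ x <> 0 & forall f : {linear E -> E},
    (forall x, W x -> f x = 0) \/ (forall y, W y -> exists2 x, W x & f x = y)].

Definition models (W : set E) S : Prop := exists i : {linear S -> E},
  injective i /\ forall x, W x <-> exists s, i s = x.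

(** For torsion X and coprime W, the dual way of saying that X is killed by the prime of the
    completion that corresponds to W. *)
Definition maps_into X (W : set E) : Prop := forall (f : {linear X -> E}) x, W (f x).

Lemma end_stable (U : set E) (f : {linear E -> E}) x : lsub U -> U x -> U (f x).
Proof.
move=> lU Ux; have [r [-> _]] := hull_end2 hlocal hE f x x.
exact: lsubZ.
Qed.

Lemma models_torsion W S : models W S -> torsion_mod S.
Proof.
case: hE => tE _ _ _ [i [inji _]]; apply: torsion_sq tE.
exact: sq_inj inji.
Qed.

(** If a nonzero image of X in E is not coprime, then some endomorphism of E sends it to a smaller
    nonzero one; a minimal image is coprime. *)
Lemma coprime_quotient X x0 : torsion_mod X -> x0 <> 0 :> X ->
  exists f : {linear X -> E}, coprime_sub (fun y => exists x, f x = y).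
Proof.
move=> tX nx0.
pose Pi (U : set E) := forall f : {linear X -> E}, (forall y, U y <-> exists x, f x = y) ->
  (exists x, f x <> 0) -> exists f : {linear X -> E}, coprime_sub (fun y => exists x, f x = y).
have H : forall U, lsub U -> (forall x, U x -> True) -> Pi U.
  apply: (dcc_ind (hull_dcc hlocal hE)) => U lU _ IH f fU [x fx].
  have EU : (fun y => exists x, f x = y) = U.
    by apply/funext => y; apply/propext; split=> /fU.
  have [cU|ncU] := pselect (coprime_sub U); first by exists f; rewrite EU.
  have [g [ng no]] : exists g : {linear E -> E}, ~ (forall x, U x -> g x = 0) /\
      ~ (forall y, U y -> exists2 x, U x & g x = y).
    apply: contrapT => nex; apply: ncU; split=> //.
      by exists (f x); split=> //; apply/fU; exists x.
    move=> g; apply: contrapT => /not_orP[ng no]; apply: nex; by exists g.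
  apply: (IH (fun y => exists2 x, U x & g x = y) _ _ _ (g \o f : {linear X -> E})).
  - exact: lsub_im.
  - by move=> _ [y Uy <-]; apply: end_stable.
  - apply: contrapT => nex; apply: no => y Uy; apply: contrapT => ny; apply: nex.
    by exists y; split.
  - move=> y; split=> [[u /fU[z <-] <-]|[z <-]]; first by exists z.
    by exists (f z) => //; apply/fU; exists z.
  - apply: contrapT => nex; apply: ng => u /fU[z <-]; apply: contrapT => nz.
    by apply: nex; exists z.
have [f [_ fx0]] := hull_cogenerates hlocal hE tX (@lsub0 _ X) nx0.
apply: (H _ (lsub_im f (@lsubT _ X)) (fun _ _ => I) f); last by exists x0.
by move=> y; split=> [[x _ <-]|[x <-]]; exists x.
Qed.

Section OneCoprime.
Variables (W : set E) (S : lmodType R) (cW : coprime_sub W) (mW : models W S).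

(** If U is proper, then a nonzero map S/U -> E extends to an endomorphism of E that does not kill
    W. It maps W onto W, so S is a quotient of S/U. *)
Lemma coprime_uncuttable : uncuttable S.
Proof.
have [lW [x0 [Wx0 nx0]] Wf] := cW; have [i [inji iP]] := mW.
have [tE _ _ xE] := hE; have tS := models_torsion mW.
move=> U lU; have [[w nUw]|nex] := pselect (exists w, ~ U w); [right|left].
  have [f [fU fw]] := hull_cogenerates hlocal hE tS lU nUw.
  have [||g gP] := xE E tE (fun x y => exists2 s, i s = x & f s = y).
  - split; first by exists 0; rewrite linear0.
    by move=> a _ _ _ _ [s <- <-] [s' <- <-]; exists (a *: s + s'); rewrite linearP.
  - move=> y [s E0 <-]; have -> : s = 0 by apply: inji; rewrite E0 linear0.
    by rewrite linear0.
  have gi s : g (i s) = f s by apply: gP; exists s.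
  case: (Wf g) => [g0|go]; first by case: fw; rewrite -gi g0 //; apply/iP; exists w.
  exists (fun s s' => f s = i s'); split=> //.
  - split; first by rewrite !linear0.
    by move=> a s t s' t' h h'; rewrite !linearP h h'.
  - move=> s; have [|_ /iP[t <-] Et] := go (i s); first by apply/iP; exists s.
    by exists t; rewrite -gi Et.
  - by move=> s s' /fU ->; rewrite -(linear0 i) => /inji.
exists (fun s s' => s = s'); split=> //.
- by split=> // a s t s' t' -> ->.
- by move=> s s' _; apply: contrapT => ns; apply: nex; exists s.
- by move=> s; exists s.
- by move=> s s' -> ->.
Qed.

(** The partial map from U' onto S, followed by the inclusion in E, extends to an endomorphism of E,
    and these preserve U'. One step thus already fills W. *)
Lemma jump_eq_coprime (U U' : set E) : lsub U -> lsub U' -> (forall x, U' x -> W x) ->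
  jump S U U' -> forall x, W x -> U' x.
Proof.
have [i [inji iP]] := mW; have [tE _ _ xE] := hE.
move=> lU lU' sub [r [rr d o k]] x /iP[s <-].
have [||g gP] := xE E tE (fun x y => exists2 s, r x s & i s = y).
- split; first by exists 0; rewrite ?linear0 //; case: rr.
  move=> a x1 x2 _ _ [s1 h1 <-] [s2 h2 <-]; exists (a *: s1 + s2); rewrite ?linearP //.
  by case: rr => _; apply.
- move=> y [t h <-]; have -> : t = 0 by apply: k h; case: lU.
  by rewrite linear0.
have [y h] := o s; rewrite -(gP y (i s)); last by exists s.
by apply: end_stable => //; apply: d h.
Qed.

Lemma length_coprime : length_le S W 1.
Proof.
have [lW [x0 [Wx0 nx0]] Wf] := cW; have [i [inji iP]] := mW.
move=> Z' l sub h; case: h sub => {Z' l} [U U' //|U U' V k h lV s j sub].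
suff -> : k = 0%N by [].
case: h s j => {U U'} [U U' //|U U' V' l h lW' s1 j1 s j]; exfalso.
have [lU lU' s0] := jumps_lsub h.
have WV' : forall x, W x -> V' x.
  by apply: jump_eq_coprime j1 => // x /s/sub.
have [r [rr d o k0]] := j; have [s1' Es1] := (iP x0).1 Wx0.
have [x rx] := o s1'; apply: nx0; rewrite -Es1 (k0 x s1') ?linear0 //.
by apply/WV'/sub/d/rx.
Qed.

Lemma length_zero X : (forall x : X, x = 0) -> length_le S (fun _ : X => True) 0.
Proof.
have [lW [x0 [Wx0 nx0]] Wf] := cW; have [i [inji iP]] := mW.
move=> X0 Z' l sub h; case: h sub => // U U' V k h lV s [r [rr d o k0]] _; exfalso.
have [lU lU' s0] := jumps_lsub h.
have [s1 Es1] := (iP x0).1 Wx0.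
have [x rx] := o s1; apply: nx0; rewrite -Es1 (k0 x s1) ?linear0 //.
by rewrite [x]X0; case: lU'.
Qed.

(** A map X -> E that does not kill a given socle element has its image in W, which counts at most
    once, and its kernel has a shorter socle. *)
Lemma corank_le_socle X s : torsion_mod X -> maps_into X W ->
  length_le k0 (soc : set X) s -> length_le S (fun _ : X => True) s.
Proof.
have [tE _ _ xE] := hE.
elim: s X => [|s IH] X tX into hs.
  apply: length_zero; apply: (socle_zero hlocal tX) => x sx.
  apply: contrapT => nx.
  suff : (1 <= 0)%N by [].
  apply: (hs (fun y => exists r, y = r *: x)).
    by move=> _ [r ->] a ma; rewrite scalerA mulrC -scalerA sx // scaler0.
  apply: jumps1; rewrite ?/zero_set; [exact: lsub0|exact: lsub_cyc|..].
    by move=> y ->; exists 0; rewrite scale0r.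
  apply: (jump_resfield hlocal); [exact: lsub0|exact: lsub_cyc|..].
    by move=> y ->; exists 0; rewrite scale0r.
  by exists x; split=> //; exists 1; rewrite scale1r.
have [zX|nzX] := pselect (forall x : X, soc x -> x = 0).
  by apply: length_leW (length_zero (socle_zero hlocal tX zX)).
have [x [sx nx]] : exists x : X, soc x /\ x <> 0.
  apply: contrapT => nex; apply: nzX => x sx; apply: contrapT => nx.
  by apply: nex; exists x.
have [f [_ fx]] := hull_cogenerates hlocal hE tX (@lsub0 _ X) nx.
have [Y [j [injj jP]]] := sub_exists (lsub_ker f).
have tY : torsion_mod Y by apply: torsion_sq tX; apply: sq_inj injj.
have fj y : f (j y) = 0 by apply/jP; exists y.
have hY : length_le S (fun _ : Y => True) s.
  apply: IH => //.
    move=> g y; have [||g' gP] := xE X tX (fun x z => exists2 y, j y = x & g y = z).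
    - split; first by exists 0; rewrite linear0.
      by move=> a _ _ _ _ [u <- <-] [v <- <-]; exists (a *: u + v); rewrite linearP.
    - move=> z [u E0 <-]; have -> : u = 0 by apply: injj; rewrite E0 linear0.
      by rewrite linear0.
    by rewrite -(gP (j y) (g y)); [apply: into|exists y].
  move=> Z' l sub h; rewrite -ltnS; apply: (hs (soc : set X)) => //.
  have hj : jumps k0 (fun x => exists2 y, zero_set y & j y = x)
                     (fun x => exists2 y, Z' y & j y = x) l.
    by apply: jumps_push h => y _; rewrite -(linear0 j) => /injj.
  have hj' : jumps k0 (@zero_set R X) (fun x => soc x /\ f x = 0) l.
    apply: jumps_weakl (jumps_weakr _ _ hj).
    - exact: lsub0.
    - by move=> y ->; exists 0; rewrite ?linear0.
    - by apply: lsubI; [apply: lsub_soc|apply: lsub_ker].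
    - move=> _ [y /sub sy <-]; split=> // a ma; by rewrite -linearZ sy // linear0.
  have [_ l2 _] := jumps_lsub hj'.
  apply: (jumpsS hj' (lsub_soc m X)); first by move=> y [].
  apply: (jump_resfield hlocal) => //; [exact: lsub_soc|by move=> y []|].
  by exists x; split=> // -[_ /fx].
rewrite -addn1; apply: (length_le_add (f := f) coprime_uncuttable).
  apply: length_leW (length_le_im (f := j) (@lsubT _ Y) hY) => // y [_ /jP[z <-]].
  by exists z.
by apply: length_leW length_coprime => // _ [y _ <-]; apply: into.
Qed.

(** An endomorphism of E that kills W but not f x would act on both [i x] and f x through one scalar
    r. Then r kills x, hence so does r^(p^n), which means that r kills f x. *)
Lemma push_maps_into n : maps_into (push n S) W.
Proof.
have [lW _ _] := cW; have [i [inji iP]] := mW; have [tE _ _ _] := hE.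
move=> f x; apply: contrapT => nW.
have [g [gW gn]] := hull_cogenerates hlocal hE tE lW nW.
have [r [Er1 Er2]] := hull_end2 hlocal hE g (i x) (f x).
apply: gn; rewrite Er2 -linearZ.
have rx : r *: (x : S) = 0.
  by apply: inji; rewrite linear0 linearZ /= -Er1; apply: gW; apply/iP; exists x.
suff -> : r *: x = 0 by rewrite linear0.
rewrite (pushE charRp n).
have q0 : (0 < p ^ n)%N by rewrite expn_gt0 (p_gt0 charRp).
by rewrite -(prednK q0) exprSr -scalerA rx scaler0.
Qed.

End OneCoprime.

Lemma models_exists W : lsub W -> exists S, models W S.
Proof. by move=> /sub_exists [S [i iP]]; exists S, i. Qed.

Lemma models_iso W S T : models W S -> models W T -> exists f : {linear S -> T},
  (forall y, exists x, f x = y) /\ forall x, f x = 0 -> x = 0.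
Proof.
move=> [i [inji iP]] [j [injj jP]].
have [|||f fP] := @lrel_fun _ S T (fun s t => i s = j t).
- split; first by rewrite !linear0.
  by move=> a x x' y y' h h'; rewrite !linearP h h'.
- by move=> x; have [|y Ey] := (jP (i x)).1; [apply/iP; exists x|exists y].
- by move=> y; rewrite linear0 -(linear0 j) => /injj.
exists f; split=> [y|x /fP].
  have [|x Ex] := (iP (j y)).1; first by apply/jP; exists y.
  by exists x; apply/fP.
by rewrite linear0 -(linear0 i) => /inji.
Qed.

(** A coprime quotient is taken off the top and its kernel is treated by Artinian induction. The map
    from all of X in the last clause places each W that occurs inside any submodule into which X
    maps. *)
Lemma coprime_filtration X : torsion_mod X -> dcc (fun _ : X => True) ->
  exists l, filt (fun N => exists W, [/\ coprime_sub W, models W N, sq X N &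
    exists f : {linear X -> E}, forall y, W y -> exists x, f x = y])
    (@zero_set R X) (fun _ => True) l.
Proof.
have [tE _ _ xE] := hE.
move=> tX dX; set V := (X in filt X).
suff H : forall U : set X, lsub U -> (forall x, U x -> True) ->
    exists l, filt V (@zero_set R X) U l by apply: H.
apply: (dcc_ind dX) => U lU _ IH.
have [[x0 [Ux0 nx0]]|nex] := pselect (exists x, U x /\ x <> 0); last first.
  exists 0%N; have -> : U = @zero_set R X; last by apply: filt0; apply: lsub0.
  apply/funext => x; apply/propext; split=> [Ux|->]; last by case: lU.
  by apply: contrapT => nx; apply: nex; exists x.
have [Y [j [injj jP]]] := sub_exists lU.
have tY : torsion_mod Y by apply: torsion_sq tX; apply: sq_inj injj.
have [y0 Ey0] := (jP x0).1 Ux0.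
have ny0 : y0 <> 0 by move=> E0; apply: nx0; rewrite -Ey0 E0 linear0.
have [f cf] := coprime_quotient tY ny0; have [lW [w [Ww nw]] _] := cf.
have [N mN] := models_exists lW; have [i [inji iP]] := mN.
pose r x s := exists2 y, j y = x & i s = f y.
have lr : lrel r.
  split; first by exists 0; rewrite !linear0.
  by move=> a _ _ s s' [y <- Es] [y' <- Es']; exists (a *: y + y'); rewrite !linearP // Es Es'.
have ro s : exists x, r x s.
  by have [|y Ey] := (iP (i s)).2; [exists s|exists (j y), y].
have ru : univalent r.
  move=> s [y Ey Es]; apply: inji; rewrite Es linear0.
  have -> : y = 0 by apply: injj; rewrite Ey linear0.
  exact: linear0.
have l0 : lsub (fun x => r x 0).
  split; first by case: lr.
  move=> a x y h h'; rewrite -[0](scaler0 _ a) -[a *: 0]addr0.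
  by case: lr => _; apply.
have [||l hl] := IH (fun x => r x 0) l0.
- by move=> _ [y <- _]; apply/jP; exists y.
- have [y Ey] := Ww; exists (j y); split; first by apply/jP; exists y.
  move=> [y' /injj -> /esym]; rewrite linear0 Ey => E0; exact: nw.
exists l.+1; apply: (filtS (N := N)) hl lU _ _.
  exists (fun y => exists x, f x = y); split=> //.
    apply: (@sq_trans _ _ Y); first exact: sq_inj injj.
    exists (fun y s => i s = f y); split.
    - split; first by rewrite !linear0.
      by move=> a x x' y y' h h'; rewrite !linearP h h'.
    - by move=> s; have [|y Ey] := (iP (i s)).2; [exists s|exists y].
    - by move=> s; rewrite linear0 -(linear0 i) => /inji.
  have [||g gP] := xE X tX (fun x z => exists2 y, j y = x & f y = z).
  - split; first by exists 0; rewrite linear0.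
    by move=> a _ _ _ _ [u <- <-] [v <- <-]; exists (a *: u + v); rewrite linearP.
  - move=> z [u E0 <-]; have -> : u = 0 by apply: injj; rewrite E0 linear0.
    by rewrite linear0.
  by exists g => _ [y <-]; exists (j y); apply: gP; exists y.
exists r; split=> // x; split=> [/jP[y Ey]|[s [y <- _]]]; last by apply/jP; exists y.
by have [|s Es] := (iP (f y)).1; [exists y|exists s, y].
Qed.

End Coprimes.

Lemma leq_exp_growth (r c l : nat) : (0 < l)%N ->
  (forall n, r ^ n <= c * l ^ n)%N -> (r <= l)%N.
Proof.
move=> l0 H; rewrite leqNgt; apply/negP => lt.
(* Bernoulli's inequality for 1 + 1/l, with denominators cleared. *)
have bern n : (l ^ n * (l + n) <= l * l.+1 ^ n)%N.
  elim: n => [|n IH]; first by rewrite !expn0 addn0 mul1n muln1.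
  rewrite !expnS; move: IH; set A := (l ^ n)%N; set B := (l.+1 ^ n)%N => IH.
  have h : (l.+1 * (A * (l + n)) <= l.+1 * (l * B))%N by rewrite leq_mul2l IH orbT.
  apply: leq_trans (_ : (l.+1 * (A * (l + n)) <= _)%N); nia.
pose n := (c * l).+1.
have h1 : (l.+1 ^ n <= c * l ^ n)%N.
  by apply: leq_trans (H n); rewrite leq_exp2r.
have h2 : (l ^ n * (l + n) <= l ^ n * (c * l))%N.
  apply: leq_trans (bern n) _; apply: leq_trans (leq_mul (leqnn l) h1) _.
  by have -> : (l * (c * l ^ n) = l ^ n * (c * l))%N by ring.
by move: h2; rewrite leq_pmul2l ?expn_gt0 ?l0 // /n; lia.
Qed.

Section MoreDcc.
Variable R : comNzRingType.
Implicit Types X Y : lmodType R.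

Lemma dcc_image X Y (f : {linear X -> Y}) (Z : set Y) :
  (forall y, Z y -> exists x, f x = y) -> dcc (fun _ : X => True) -> dcc Z.
Proof.
move=> o D N lN d sN.
have [|||k kP] := D (fun i x => N i (f x)) => //.
- by move=> i; apply: lsub_pre.
- by move=> i x; apply: d.
exists k => i y le Ny; have [x Ex] := o _ (sN _ _ Ny).
by rewrite -Ex; apply: kP; rewrite ?Ex.
Qed.

Lemma jumps_sq S X Y (r : X -> Y -> Prop) (V V' : set Y) k : lrel r -> univalent r ->
  (forall y, exists x, r x y) -> jumps S V V' k ->
  jumps S (fun x => exists2 y, r x y & V y) (fun x => exists2 y, r x y & V' y) k.
Proof.
move=> rr ur ro.
have lp C : lsub C -> lsub (fun x => exists2 s, r x s & C s).
  move=> [C0 CD]; split; first by exists 0 => //; case: rr.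
  move=> a x y [s h Cs] [t h' Ct]; exists (a *: s + t); last exact: CD.
  by case: rr => _; apply.
elim=> {V V' k} [U U' lU lU' sub|U U' V k _ IH lV sub [t [tr td to tk]]].
  by apply: jumps0; rewrite ?lp //; [apply: lp|apply: lp|move=> x [y h /sub Uy]; exists y].
apply: jumpsS IH (lp _ lV) _ _; first by move=> x [y h /sub Uy]; exists y.
exists (fun x s => exists2 y, r x y & t y s); split.
- split; first by exists 0; [case: rr|case: tr].
  move=> a x x' w w' [s h h1] [s' h' h1']; exists (a *: s + s').
    by case: rr => _; apply.
  by case: tr => _; apply.
- by move=> x s [y h /td Vy]; exists y.
- by move=> s; have [y h] := to s; have [x h'] := ro y; exists x, y.
- move=> x s [y h Uy] [y' h' h2]; apply: (tk y) => //.
  by rewrite (lrel_uniq rr ur h h').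
Qed.

Lemma length_sq S X Y k : sq X Y -> length_le S (fun _ : X => True) k ->
  length_le S (fun _ : Y => True) k.
Proof.
case=> r [rr o u] h Z' l _ /(jumps_sq rr u o) hj; apply: h (jumps_weakl _ _ hj) => //.
  exact: lsub0.
by move=> x ->; exists 0 => //; case: rr.
Qed.

End MoreDcc.

(** * Growth of socles along the Frobenius *)

Section Growth.
Variables (R : comNzRingType) (m : {pred R}) (K : fieldType) (pi : {rmorphism R -> K}).
Variables (p : nat) (charRp : p \in [pchar R]).
Hypothesis hlocal : is_local_ring m pi.
Implicit Types A B X Y Z S N : lmodType R.
Notation k0 := (resfield pi).
Notation soc := (@soc R m _).
Notation torsion_mod := (torsion_mod m).
Notation push n X := (frobenius_push charRp n X).
Notation Phi X := (Phi charRp X).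
Variable alpha : nat.
Hypothesis (alphaP : length_le k0 (fun _ : Phi k0 => True) alpha).

Definition growth j X : Prop := exists C, forall n,
  length_le k0 (soc : set (push n X)) (C * (p ^ j * alpha) ^ n).

(** A bound on the socle need not pass to quotients, so it is imposed on all subquotients. *)
Definition small j X : Prop := torsion_mod X /\ forall Y, sq X Y -> growth j Y.

Lemma length_resfield_zero X : (forall x : X, x = 0) ->
  length_le k0 (fun _ : X => True) 0.
Proof.
move=> X0; apply: (length_torsion (cyclic_resfield hlocal)) => x _; exists 1.
  by have [_ m1 _] := m_prime hlocal.
by rewrite [x]X0 scaler0.
Qed.

Lemma resfield_map X (x : X) : soc x -> exists f : {linear k0 -> X},
  forall y, (exists r, y = r *: x) <-> exists z, f z = y.
Proof.
move=> sx; have [g [gen ann]] := cyclic_resfield hlocal.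
have [|||f fP] := @lrel_fun R k0 X (fun z y => exists r, z = r *: g /\ y = r *: x).
- split; first by exists 0; rewrite !scale0r.
  move=> a _ _ _ _ [r [-> ->]] [s [-> ->]]; exists (a * r + s).
  by rewrite !scalerDl !scalerA.
- by move=> z; have [r ->] := gen z; exists (r *: x), r.
- by move=> y [r [/esym/ann mr ->]]; apply: sx.
exists f => y; split=> [[r ->]|[z /fP[r [_ ->]]]]; last by exists r.
by exists (r *: g); apply/fP; exists r.
Qed.

Lemma length_Phi X l : torsion_mod X -> length_le k0 (fun _ : X => True) l ->
  length_le k0 (fun _ : Phi X => True) (l * alpha).
Proof.
elim: l X => [|l IH] X tX hX.
  rewrite mul0n; apply: length_resfield_zero.
  suff X0 : forall x : X, x = 0 by [].
  apply: (socle_zero hlocal tX) => x sx; apply: contrapT => nx.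
  suff : (1 <= 0)%N by [].
  apply: (hX (fun _ => True)) => //; apply: jumps1 => //; first exact: lsub0.
  by apply: (jump_resfield hlocal) => //; [exact: lsub0|exists x].
have [X0|nX0] := pselect (forall x : X, x = 0).
  by apply: length_leW (length_resfield_zero (X := Phi X) X0).
have [x nx] : exists x : X, x <> 0.
  by apply: contrapT => nex; apply: nX0 => x; apply: contrapT => nx; apply: nex; exists x.
have [r [nr sr]] := socle_mod hlocal (@lsub0 _ X) (tX x) nx.
set z := r *: x in nr sr; have lz := lsub_cyc z.
have [C [q [qo qP]]] := quot_exists charRp lz.
have tC : torsion_mod C by apply: torsion_sq tX; apply: sq_surj qo.
have hC : length_le k0 (fun _ : C => True) l.
  move=> Z' k _ h; rewrite -ltnS; apply: (hX (fun _ => True)) => //.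
  have hq := jumps_pull (f := q) (@lsubT _ X)
    (fun y _ => ex_intro2 _ _ _ I (projT2 (cid (qo y)))) h.
  rewrite -add1n; apply: jumps_trans (jumps_weakr _ _ (jumps_weakl lz _ hq)) => //.
    apply: jumps1 => //; first exact: lsub0.
      by move=> y ->; exists 0; rewrite scale0r.
    apply: (jump_resfield hlocal) => //; first exact: lsub0.
      by move=> y ->; exists 0; rewrite scale0r.
    by exists z; split=> //; exists 1; rewrite scale1r.
  by move=> y /qP Ey.
have [q' q'E] := lin_restrict (pFrobenius_aut charRp) q.
have [f fP] := resfield_map sr.
have [f' f'E] := lin_restrict (pFrobenius_aut charRp) f.
rewrite mulSn; apply: (length_le_add (f := q')).
- exact: cyclic_uncuttable (m_prime hlocal) (cyclic_resfield hlocal).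
- apply: length_leW (length_le_im (f := f') (@lsubT _ _) alphaP) => // y [_].
  by rewrite q'E => /qP/fP[w Ew]; exists w => //; rewrite f'E.
- by apply: length_leW (IH _ tC hC).
Qed.

Lemma torsion_push n X : torsion_mod X -> torsion_mod (push n X).
Proof.
move=> tX x a ma; have [t Et] := tX x a ma; exists t.
have q0 : (0 < p ^ n)%N by rewrite expn_gt0 (p_gt0 charRp).
by rewrite (pushE charRp n) -exprM mulnC -(prednK q0) mulSn addnC exprD -scalerA Et scaler0.
Qed.

Lemma torsion_Phi X : torsion_mod X -> torsion_mod (Phi X).
Proof.
move=> tX x a ma; have [t Et] := tX x a ma; exists t.
have E : (a ^+ t) ^+ p = (a ^+ t) ^+ p.-1 * a ^+ t.
  by rewrite -exprSr prednK // (p_gt0 charRp).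
by rewrite (PhiE charRp) E -scalerA Et scaler0.
Qed.

Lemma length_push n X l : torsion_mod X -> length_le k0 (fun _ : X => True) l ->
  length_le k0 (fun _ : push n X => True) (l * alpha ^ n).
Proof.
elim: n X l => [|n IH] X l tX hX.
  have [f fE] := push0_iso charRp X; rewrite expn0 muln1.
  apply: (length_le_inj (f := f)); first by move=> x _; rewrite fE.
  exact: length_leW hX.
have [f fE] := pushS_iso charRp n X.
apply: (length_le_inj (f := f)); first by move=> x _; rewrite fE.
apply: length_leW (IH (Phi X) _ (torsion_Phi tX) (length_Phi tX hX)) => //.
by rewrite expnS mulnA.
Qed.

Lemma push_soc n X Y (f : {linear X -> Y}) (x : push n X) : soc x ->
  soc (f (x : X) : push n Y).
Proof.
move=> sx a ma; rewrite (pushE charRp n) -linearZ.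
by have := sx a ma; rewrite (pushE charRp n) => ->; rewrite linear0.
Qed.

Lemma growth_ses j X Y Z (i : {linear X -> Y}) (q : {linear Y -> Z}) :
  injective i -> (forall y, q y = 0 -> exists x, i x = y) ->
  growth j X -> growth j Z -> growth j Y.
Proof.
move=> inji ex [C1 h1] [C2 h2]; exists (C1 + C2)%N => n; rewrite mulnDl.
have [i' i'E] := lin_restrict (frobenius_iter charRp n) i.
have [q' q'E] := lin_restrict (frobenius_iter charRp n) q.
apply: (length_le_add (f := q')).
- exact: cyclic_uncuttable (m_prime hlocal) (cyclic_resfield hlocal).
- apply: length_leW (length_le_im (f := i') (lsub_soc m _) (h1 n)) => // y [sy].
  rewrite q'E => /ex[x Ex]; exists x; last by rewrite i'E.
  move=> a ma; have := sy a ma; rewrite !(pushE charRp n) -Ex -linearZ => E0.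
  by apply: inji; rewrite E0 linear0.
- apply: length_leW (h2 n) => // _ [y sy <-]; rewrite q'E; exact: push_soc.
Qed.

Lemma small_sq j X Y : sq X Y -> small j X -> small j Y.
Proof.
move=> s [tX h]; split; first exact: torsion_sq tX.
by move=> Z /(sq_trans s)/h.
Qed.

(** B1 is a subquotient of A and B/B1 one of C, which is how the middle term of a three-term exact
    sequence depends on its neighbours. *)
Lemma small_ext j A B (C : lmodType R) (B1 : set B) (rho : A -> B -> Prop) (sigma : C -> B -> Prop) :
  lsub B1 -> lrel rho -> univalent rho -> (forall b, B1 b -> exists a, rho a b) ->
  lrel sigma -> (forall b, sigma 0 b -> B1 b) -> (forall b, exists c, sigma c b) ->
  small j A -> small j C -> small j B.
Proof.
move=> lB1 rr ur ro sr su so [tA hA] [tC hC]; split.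
  move=> b a ma; have [c hc] := so b; have [t Et] := tC c a ma.
  have /ro[x hx] : B1 (a ^+ t *: b) by apply: su; rewrite -Et; apply: lrelZ.
  have [u Eu] := tA x a ma; exists (u + t)%N; rewrite exprD -scalerA.
  by apply: ur; rewrite -Eu; apply: lrelZ.
move=> Y [t [tr to tu]].
pose Y1 y := exists2 b, B1 b & t b y.
have lY1 : lsub Y1.
  split; first by exists 0; [case: lB1|case: tr].
  move=> a x y [b Bb h] [b' Bb' h']; exists (a *: b + b').
    by case: lB1 => _; apply.
  by case: tr => _; apply.
have [N1 [i [inji iP]]] := sub_exists lY1.
have [N2 [q [qo qP]]] := quot_exists charRp lY1.
apply: (growth_ses inji (q := q)) (hA _ _) (hC _ _).
- by move=> y /qP/iP.
- exists (fun a n => exists b, [/\ B1 b, rho a b & t b (i n)]); split.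
  + split; first by exists 0; rewrite linear0; split; [case: lB1|case: rr|case: tr].
    move=> a x x' n n' [b [Bb h1 h2]] [b' [Bb' h1' h2']]; exists (a *: b + b'); split.
    * by case: lB1 => _; apply.
    * by case: rr => _; apply.
    * by rewrite linearP; case: tr => _; apply.
  + move=> n; have [|b Bb h] := (iP (i n)).2; first by exists n.
    by have [a ha] := ro _ Bb; exists a, b.
  + move=> n [b [_ /ur -> /tu]]; rewrite -(linear0 i); exact: inji.
- exists (fun c n => exists b y, [/\ sigma c b, t b y & q y = n]); split.
  + split; first by exists 0, 0; rewrite linear0; split=> //; [case: sr|case: tr].
    move=> a x x' n n' [b [y [h1 h2 <-]]] [b' [y' [h1' h2' <-]]].
    exists (a *: b + b'), (a *: y + y'); split; last by rewrite linearP.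
      by case: sr => _; apply.
    by case: tr => _; apply.
  + move=> n; have [y Ey] := qo n; have [b hb] := to y; have [c hc] := so b.
    by exists c, b, y.
  + by move=> n [b [y [/su Bb h <-]]]; apply/qP; exists b.
Qed.

Lemma small_zero j X : (forall x : X, x = 0) -> small j X.
Proof.
move=> X0; split; first by move=> x a ma; exists 0%N; rewrite [x]X0 scaler0.
move=> Y [r [rr ro ru]].
have Y0 (y : Y) : y = 0 by have [x h] := ro y; apply: ru; rewrite -[0 : X](X0 x).
exists 0%N => n; rewrite mul0n.
exact: length_leW (length_resfield_zero (X := push n Y) Y0).
Qed.

Lemma growth_dcc j X : torsion_mod X -> growth j X -> dcc (fun _ : X => True).
Proof.
move=> tX [C /(_ 0%N) h]; have [f fE] := push0_iso' charRp X.
apply: (dcc_soc hlocal tX (c := (C * (p ^ j * alpha) ^ 0)%N)).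
apply: (length_le_inj (f := f)); first by move=> x _; rewrite fE.
apply: length_leW h => // _ [x sx <-] a ma; rewrite fE; exact: sx.
Qed.

Lemma small_dcc j X : small j X -> dcc (fun _ : X => True).
Proof. by move=> [tX h]; apply: (growth_dcc tX (h X (sq_refl X))). Qed.

Lemma small_resfield : small 0 k0.
Proof.
have tk : torsion_mod k0.
  move=> x a ma; exists 1%N; rewrite expr1.
  have [g [gen ann]] := cyclic_resfield hlocal; have [r ->] := gen x.
  by rewrite scalerA mulrC -scalerA (ann a).2 // scaler0.
split=> // Y sY; exists 1%N => n; rewrite expn0 !mul1n -[(alpha ^ n)%N]mul1n.
have hY : length_le k0 (fun _ : Y => True) 1; last first.
  by apply: length_leW (length_push (n := n) (torsion_sq sY tk) hY).
apply: (length_sq sY).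
have [g [gen ann]] := cyclic_resfield hlocal.
apply: (length_cyclic (m_prime hlocal) (cyclic_resfield hlocal) (g := g)).
  by move=> a /ann.
by move=> x _; have [r ->] := gen x; exists r.
Qed.

Definition kernel_of X (a : R) Z : Prop := exists i : {linear Z -> X},
  injective i /\ forall x, a *: x = 0 <-> exists z, i z = x.

Lemma kernel_exists X a : exists Z, kernel_of X a Z.
Proof.
have [f fE] := mul_lin X a; have [Z [i [inji iP]]] := sub_exists (lsub_ker f).
by exists Z, i; split=> // x; rewrite -iP fE.
Qed.

(** Multiplication by a sends the kernel of a^(t+1) into that of a^t, with kernel Z. *)
Lemma small_kernel_power j X a Z t Zt : kernel_of X a Z -> kernel_of X (a ^+ t) Zt ->
  small j Z -> small j Zt.
Proof.
move=> [i [inji iP]] + sZ; elim: t Zt => [|t IH] Zt [k [injk kP]].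
  apply: small_zero => x; apply: injk; rewrite linear0 -[k x]scale1r -(expr0 a).
  by apply/kP; exists x.
have [Z' kZ'] := kernel_exists X (a ^+ t); have sZ' := IH _ kZ'.
have [k' [injk' kP']] := kZ'.
apply: (small_ext (B1 := fun z => a *: k z = 0) (rho := fun z y => i z = k y)
  (sigma := fun c y => k' c = a *: k y) _ _ _ _ _ _ _ sZ sZ').
- split; first by rewrite linear0 scaler0.
  move=> b x y Ex Ey; rewrite linearP scalerDr scalerA mulrC -scalerA Ex Ey.
  by rewrite scaler0 addr0.
- split; first by rewrite !linear0.
  by move=> b x x' y y' E E'; rewrite !linearP E E'.
- by move=> y; rewrite linear0 -(linear0 k) => /injk.
- by move=> y /iP[z Ez]; exists z.
- split; first by rewrite !linear0.
  by move=> b x x' y y' E E'; rewrite !linearP E E'.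
- by move=> y; rewrite linear0.
- by move=> y; apply/kP'; rewrite scalerA -exprSr; apply/kP; exists y.
Qed.

(** The socle of F^n_* X is killed by a^(p^n). Its filtration by the kernels of powers of a has p^n
    pieces, each embedded in the socle of F^n_* Z; hence one more factor p in the rate. *)
Lemma growth_kernel j X a Z : a \in m -> kernel_of X a Z -> growth j Z -> growth j.+1 X.
Proof.
move=> ma [i [inji iP]] [C hC]; exists C => n.
have [i' i'E] := lin_restrict (frobenius_iter charRp n) i.
have [f fE] := mul_lin X a; have [f' f'E] := lin_restrict (frobenius_iter charRp n) f.
pose c := (C * (p ^ j * alpha) ^ n)%N.
have H s : length_le k0 (fun x : push n X => soc x /\ a ^+ s *: (x : X) = 0) (s * c).
  elim: s => [|s IH].
    apply: length_leW (length_torsion (cyclic_resfield hlocal)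
      (Z := fun x : push n X => soc x /\ a ^+ 0 *: (x : X) = 0) _) => //.
    move=> x [_]; rewrite expr0 scale1r => E; exists 1.
      by have [_ m1 _] := m_prime hlocal.
    by rewrite E scaler0.
  rewrite mulSn; apply: (length_le_add (f := f')).
  - exact: cyclic_uncuttable (m_prime hlocal) (cyclic_resfield hlocal).
  - apply: length_leW (length_le_im (f := i') (lsub_soc m _) (hC n)) => // x [[sx _]].
    rewrite f'E fE => /iP[z Ez]; exists z; last by rewrite i'E.
    move=> b mb; have := sx b mb; rewrite !(pushE charRp n) -Ez -linearZ => E0.
    by apply: inji; rewrite E0 linear0.
  - apply: length_leW IH => // _ [x [sx Ex] <-]; rewrite f'E; split.
      exact: push_soc.
    by rewrite fE scalerA -exprSr.
apply: length_leW (H (p ^ n)%N).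
  by move=> x sx; split=> //; have := sx a ma; rewrite (pushE charRp n).
have E : ((p ^ j.+1 * alpha) ^ n = p ^ n * (p ^ j * alpha) ^ n)%N.
  by rewrite expnS -mulnA expnMn.
by rewrite /c E mulnCA.
Qed.

(** Let Y = D/Y0 be a subquotient of X; by [growth_kernel] it is enough to bound the kernel of a on
    Y. If u represents an element of this kernel, then a u is in Y0. The chain of the a^t Y0
    stabilizes, so a^(t+1) u = a^(t+1) w with w in Y0, and a (u - w) lies in the kernel of a^t on X.
    If it vanishes, then u - w is in Z: the kernel on Y is an extension of subquotients of Z and of
    the kernel of a^t. *)
Lemma small_kernel j X a Z : torsion_mod X -> a \in m -> kernel_of X a Z ->
  small j Z -> small j.+1 X.
Proof.
move=> tX ma kZ sZ; split=> // Y [r [rr ro ru]].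
have [i [inji iP]] := kZ.
have dX : dcc (fun _ : X => True).
  apply: (dcc_power_torsion (a := a)) => //; first by move=> x _; apply: tX.
  apply: (dcc_image (f := i)) (small_dcc sZ).
  by move=> y [_ /iP].
pose Y0 u := r u 0.
have lY0 : lsub Y0.
  split; first by case: rr.
  move=> b x y h h'; rewrite /Y0 -[0](scaler0 _ b) -[b *: 0]addr0.
  by case: rr => _; apply.
have lN t : lsub (fun x => exists2 y, Y0 y & a ^+ t *: y = x).
  have [f fE] := mul_lin X (a ^+ t); have := lsub_im f lY0.
  by congr lsub; apply/funext => x; apply/propext; split=> -[y Yy <-]; exists y.
have [|t tP] := dX _ lN _ (fun _ _ _ => I).
  by move=> s _ [y Yy <-]; exists (a *: y); [apply: lsubZ|rewrite scalerA -exprSr].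
have [B kB] := kernel_exists Y a; have [k [injk kP]] := kB.
have [A kA] := kernel_exists X (a ^+ t); have [i' [inji' iP']] := kA.
apply: (growth_kernel ma kB).
suff [_ h] : small j B by apply: h; apply: sq_refl.
apply: (small_ext (B1 := fun z => exists y, r (i y) (k z)) (rho := fun y z => r (i y) (k z))
  (sigma := fun v z => exists u w, [/\ r u (k z), r w 0 & i' v = a *: (u - w)])
  _ _ _ _ _ _ _ sZ (small_kernel_power kZ kA sZ)).
- split; first by exists 0; rewrite !linear0; case: rr.
  move=> b x y [u h] [v h']; exists (b *: u + v); rewrite !linearP.
  by case: rr => _; apply.
- split; first by rewrite !linear0; case: rr.
  by move=> b x x' y y' h h'; rewrite !linearP; case: rr => _; apply.
- by move=> z; rewrite linear0 => /ru; rewrite -(linear0 k) => /injk.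
- by [].
- split.
    exists 0, 0; split; [by rewrite linear0; case: rr|by case: rr|].
    by rewrite subrr !linear0.
  move=> b x x' z z' [u [w [h1 h2 E]]] [u' [w' [h1' h2' E']]].
  exists (b *: u + u'), (b *: w + w'); rewrite (linearP k) (linearP i') E E'; split.
  + by case: rr => _; apply.
  + rewrite -[0](scaler0 _ b) -[b *: 0]addr0; by case: rr => _; apply.
  + have -> : b *: u + u' - (b *: w + w') = b *: (u - w) + (u' - w').
      by rewrite opprD addrACA scalerBr.
    by rewrite [RHS]scalerDr [in RHS]scalerA [a * b]mulrC -scalerA.
- move=> z [u [w [h1 h2]]]; rewrite linear0 => /esym/iP[y Ey].
  by exists y; rewrite Ey -[k z]subr0; apply: lrelB.
- move=> z; have [u hu] := ro (k z).
  have Yau : Y0 (a *: u).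
    have /kP E : exists z', k z' = k z by exists z.
    by rewrite /Y0 -E; apply: lrelZ.
  have [|w Yw Ew] := tP t.+1 (a ^+ t *: (a *: u)) (leqnSn t).
    by exists (a *: u).
  have [v Ev] : exists v, i' v = a *: (u - w).
    by apply/iP'; rewrite !scalerBr -Ew scalerA -exprSr subrr.
  by exists v, u, w.
Qed.

End Growth.

(** * Filtrations of F^n_* of a small module *)

Section FiltrationGrowth.
Variables (R : comNzRingType) (m : {pred R}) (K : fieldType) (pi : {rmorphism R -> K}).
Variables (p : nat) (charRp : p \in [pchar R]).
Hypothesis hlocal : is_local_ring m pi.
Implicit Types X Y S N : lmodType R.
Notation k0 := (resfield pi).
Notation torsion_mod := (torsion_mod m).
Notation push n X := (frobenius_push charRp n X).
Notation Phi X := (Phi charRp X).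
Variable alpha : nat.
Hypothesis (alpha_gt0 : (0 < alpha)%N).
Hypothesis (alphaP : length_le k0 (fun _ : Phi k0 => True) alpha).
Variables (E : lmodType R) (e : E) (hE : hull m e) (j : nat).
Notation small := (small m pi charRp alpha j).
Notation lambda := (p ^ j * alpha)%N.

Definition among (s : seq (lmodType R)) N : Prop := List.In N s.
Definition all_artinian (s : seq (lmodType R)) : Prop :=
  forall N, among s N -> artinian_module N.

Lemma filt_push_iso V n X (U U' : set X) k :
  filt V (U : set (push n (Phi X))) (U' : set (push n (Phi X))) k ->
  filt V (U : set (push n.+1 X)) (U' : set (push n.+1 X)) k.
Proof.
have [f fE] := pushS_iso charRp n X.
have lf : lrel (fun (x : push n.+1 X) (y : push n (Phi X)) => f x = y).
  split; first by rewrite linear0.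
  by move=> a x x' y y' <- <-; rewrite linearP.
move=> /(filt_pull lf) h.
have EU (A : set X) : (fun x : X => exists2 s, f x = s & A s) = A.
  apply/funext => x; apply/propext; rewrite fE.
  by split=> [[_ <-]//|Ax]; exists x.
have := h _ _; rewrite !EU; apply; first by move=> y; rewrite linear0.
by move=> y; exists y; rewrite fE.
Qed.

Lemma filt_push0 V X (U U' : set X) k : filt V U U' k ->
  filt V (U : set (push 0 X)) (U' : set (push 0 X)) k.
Proof.
have [f fE] := push0_iso charRp X.
have lf : lrel (fun (x : push 0 X) (y : X) => f x = y).
  split; first by rewrite linear0.
  by move=> a x x' y y' <- <-; rewrite linearP.
move=> /(filt_pull lf) h.
have EU (A : set X) : (fun x : X => exists2 s, f x = s & A s) = A.
  apply/funext => x; apply/propext; rewrite fE.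
  by split=> [[_ <-]//|Ax]; exists x.
have := h _ _; rewrite !EU; apply; first by move=> y; rewrite linear0.
by move=> y; exists y; rewrite fE.
Qed.

Lemma sq_push1_Phi X : sq (push 1 X) (Phi X) /\ sq (Phi X) (push 1 X).
Proof.
have [|f fE] := @lin_exists R (push 1 X) (Phi X) (fun x => x); first by [].
have [|g gE] := @lin_exists R (Phi X) (push 1 X) (fun x => x); first by [].
split; [apply: (sq_surj (f := f))|apply: (sq_surj (f := g))] => y; exists y.
  by rewrite fE.
by rewrite gE.
Qed.

Lemma models_artinian (W : set E) S : models W S -> artinian_module S.
Proof.
case=> i [inji _]; apply: artinian_dcc; apply: (dcc_inj inji) (hull_dcc hlocal hE) => //.
Qed.

(** The bound C (3/2 lambda)^n, with the denominator cleared. *)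
Definition push_growth X (s : seq (lmodType R)) C : Prop := forall n, exists l,
  filt (among s) (@zero_set R (push n X)) (fun _ => True) l /\
  (2 ^ n * l <= C * (3 * lambda) ^ n)%N.

Lemma push_growthW X s s' C : (forall N, among s N -> among s' N) ->
  push_growth X s C -> push_growth X s' C.
Proof.
move=> sub h n; have [l [fl le]] := h n; exists l; split=> //; exact: filtW fl.
Qed.

Lemma among_catl s s' N : among s N -> among (s ++ s') N.
Proof. by move=> h; apply/List.in_or_app; left. Qed.

Lemma among_catr s s' N : among s' N -> among (s ++ s') N.
Proof. by move=> h; apply/List.in_or_app; right. Qed.

Lemma all_artinian_cat s s' : all_artinian s -> all_artinian s' -> all_artinian (s ++ s').
Proof. by move=> h h' N a; have [/h|/h'] := List.in_app_or _ _ _ a. Qed.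

Lemma lambda_gt0 : (0 < lambda)%N.
Proof. by rewrite muln_gt0 alpha_gt0 expn_gt0 (p_gt0 charRp). Qed.

(* F_* W is filtered by r copies of W and by coprimes strictly inside W, where
   r <= lambda because the corank of F^n_* W, at least r^n, is at most the
   length of its socle. *)
Lemma coprime_push_growth (W : set E) : coprime_sub W -> forall S, models W S -> small S ->
  exists s C, all_artinian s /\ push_growth S s C.
Proof.
pose Pi (W : set E) := coprime_sub W -> forall S, models W S -> small S ->
  exists s C, all_artinian s /\ push_growth S s C.
suff H : forall W : set E, lsub W -> (forall x, W x -> True) -> Pi W.
  by move=> cW; apply: (H W) => //; case: cW.
apply: (dcc_ind (hull_dcc hlocal hE)) => {}W lW _ IH cW S mS sS.
have tS : torsion_mod S := models_torsion hE mS.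
have [gS gP] : growth m pi charRp alpha j S by apply: sS.2; apply: sq_refl.
have tPhi : torsion_mod (Phi S) := torsion_Phi tS.
have into n := @push_maps_into _ _ _ _ _ charRp hlocal _ _ hE _ _ cW mS n.
have intoPhi : maps_into (Phi S) W.
  have [|g gE] := @lin_exists R (push 1 S) (Phi S) (fun x => x); first by [].
  by move=> f x; have := into 1%N (f \o g : {linear push 1 S -> E}) x; rewrite /= gE.
have dPhi : dcc (fun _ : Phi S => True).
  apply: dcc_sq (sq_push1_Phi S).1 _.
  by apply: (dcc_soc hlocal (torsion_push tS)) (gP 1%N).
have [l0 hl0] := coprime_filtration hlocal hE tPhi dPhi.
set V0 := (X in filt X) in hl0.
(* [r] counts the factors isomorphic to S; into each one a filtration of F^n_* S, of length a, is
   inserted. [s] and [C] collect what the strictly smaller coprimes need by induction. *)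
have main (U U' : set (Phi S)) l : filt V0 U U' l -> exists r s C,
    [/\ jumps S U U' r, all_artinian s & forall s' n a, (forall N, among s N -> among s' N) ->
      filt (among s') (@zero_set R (push n S)) (fun _ => True) a ->
      exists l, filt (among s') (U : set (push n (Phi S))) (U' : set (push n (Phi S))) l /\
        (2 ^ n * l <= r * (2 ^ n * a) + C * (3 * lambda) ^ n)%N].
  elim=> {U U' l} [U lU|U U' U'' k N h1 [r [s [C [jr as_ H]]]] lU'' [W' [cW' mW' sqN [f fW']]] fac].
    exists 0%N, [::], 0%N; split=> //; first exact: jumps0.
    move=> s' n a _ _; exists 0%N; split; last by rewrite muln0.
    by apply: filt0; apply: lsub_restrict.
  have [_ lU' _] := filt_lsub h1.
  have sub : forall x, U' x -> U'' x.
    by case: fac => q [rr d o u kq] x /kq hx; apply/d; exists 0.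
  have W'W y : W' y -> W y by move=> /fW'[x <-]; apply: intoPhi.
  have facn n : factor (U' : set (push n (Phi S))) (U'' : set (push n (Phi S))) (push n N).
    exact: (factor_restrict (frobenius_iter charRp n) fac).
  have [WW'|nWW'] := pselect (forall y, W y -> W' y).
    have EW : W' = W by apply/funext => y; apply/propext; split=> [/W'W|/WW'].
    rewrite EW in mW'; have [g [go g0]] := models_iso mW' mS.
    exists r.+1, s, C; split=> //.
      by apply: jumpsS jr lU'' sub _; apply: factor_lsub_jump; apply: factor_iso fac.
    move=> s' n a ss' fa; have [l [fl le]] := H s' n a ss' fa.
    exists (l + a)%N; split; last by move: le; rewrite mulnDr mulSn; lia.
    apply: (filt_trans fl).
    have [g' g'E] := lin_restrict (frobenius_iter charRp n) g.
    have facS : factor (U' : set (push n (Phi S))) (U'' : set (push n (Phi S))) (push n S).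
      apply: (factor_iso (f := g') _ _ (facn n)).
        by move=> y; have [x Ex] := go y; exists x; rewrite g'E.
      by move=> x; rewrite g'E; apply: g0.
    exact: filt_factor facS fa.
  have sN : small N.
    have [i [inji iP]] := mS; have [i' [inji' iP']] := mW'.
    apply: small_sq sS; exists (fun x y => i x = i' y); split.
    - split; first by rewrite !linear0.
      by move=> a x x' y y' E1 E2; rewrite !linearP E1 E2.
    - by move=> y; apply/iP/W'W/iP'; exists y.
    - by move=> y; rewrite linear0 -(linear0 i') => /inji'.
  have [s2 [C2 [as2 H2]]] : exists s C, all_artinian s /\ push_growth N s C.
    apply: (IH W') => //; first by case: cW'.
    apply: contrapT => nex; apply: nWW' => y Wy; apply: contrapT => nW'y.
    by apply: nex; exists y.
  exists r, (s ++ s2), (C + C2)%N; split.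
  - exact: jumps_weakr jr.
  - exact: all_artinian_cat.
  - move=> s' n a ss' fa; have [|l [fl le]] := H s' n a _ fa.
      by move=> M /(among_catl s2)/ss'.
    have [l2 [fl2 le2]] := H2 n; exists (l + l2)%N; split.
      apply: (filt_trans fl); apply: filt_factor (facn n) _.
      by apply: filtW fl2 => M /(among_catr s)/ss'.
    by rewrite mulnDr mulnDl addnA leq_add.
have [r [s [C [jr as_ H]]]] := main _ _ _ hl0.
have rl : (r <= lambda)%N.
  apply: (@leq_exp_growth _ gS) lambda_gt0 _ => n.
  have j1 : jumps S (@zero_set R S) (fun _ => True) 1.
    by apply: jumps1 => //; [exact: lsub0|apply: sq_jump; apply: sq_refl].
  have := jumps_frob n jr j1; rewrite mul1n.
  apply: (corank_le_socle hlocal hE cW mS _ (into n) (gP n)) => //.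
  exact: torsion_push.
(* With D = 2 C + 1, the induction step needs lambda D + C <= 3/2 lambda D, which holds because 2 C
   <= D and lambda >= 1; the case n = 0 needs D >= 1. *)
exists (S :: s), (2 * C).+1; split.
  move=> N [<-|/as_ //]; exact: models_artinian mS.
elim=> [|n [l [fl le]]].
  exists 1%N; split; last by rewrite !expn0 !muln1.
  apply: filt_push0; apply: (filtS (N := S)) (filt0 _ (@lsub0 _ S)) _ _ _ => //.
    by left.
  by apply: (factor_self (f := idfun)) => // y; exists y.
have [|l' [fl' le']] := H (S :: s) n l _ fl; first by move=> N; right.
exists l'; split; first exact: filt_push_iso.
rewrite expnS -mulnA; set A := (2 ^ n)%N in le le' *.
have E3 : ((3 * lambda) ^ n.+1 = 3 * lambda * (3 * lambda) ^ n)%N by rewrite expnS.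
rewrite E3; set B := ((3 * lambda) ^ n)%N in le le' *.
have h1 : (r * (A * l) <= lambda * ((2 * C).+1 * B))%N by apply: leq_mul.
have h2 : (C * B <= lambda * (C * B))%N by rewrite leq_pmull // lambda_gt0.
have h3 : (2 * (A * l') <= 2 * (lambda * ((2 * C).+1 * B)) + 2 * (lambda * (C * B)))%N by lia.
apply: leq_trans h3 _; set L := lambda.
have -> : ((2 * C).+1 * (3 * L * B) = 2 * (L * ((2 * C).+1 * B)) + (L * ((2 * C).+1 * B)))%N by ring.
rewrite leq_add2l mulnCA leq_mul2l; apply/orP; right.
by rewrite mulnA leq_mul2r leqnSn orbT.
Qed.

Theorem small_push_growth X : small X ->
  exists s C, all_artinian s /\ push_growth X s C.
Proof.
move=> sX; have [tX _] := sX.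
have [l0 hl0] := coprime_filtration hlocal hE tX (small_dcc hlocal sX).
set V0 := (X in filt X) in hl0.
have main (U U' : set X) l : filt V0 U U' l -> exists s C, all_artinian s /\
    forall n, exists l, filt (among s) (U : set (push n X)) (U' : set (push n X)) l /\
      (2 ^ n * l <= C * (3 * lambda) ^ n)%N.
  elim=> {U U' l} [U lU|U U' U'' k N h1 [s [C [as_ H]]] lU'' [W' [cW' mW' sqN _]] fac].
    exists [::], 0%N; split=> // n; exists 0%N; split; last by rewrite muln0.
    by apply: filt0; apply: lsub_restrict.
  have [s2 [C2 [as2 H2]]] := coprime_push_growth cW' mW' (small_sq sqN sX).
  exists (s ++ s2), (C + C2)%N; split; first exact: all_artinian_cat.
  move=> n; have [l [fl le]] := H n; have [l2 [fl2 le2]] := H2 n.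
  exists (l + l2)%N; split; last by rewrite mulnDr mulnDl leq_add.
  apply: (filt_trans (filtW (@among_catl s s2) fl)).
  apply: filt_factor (factor_restrict (frobenius_iter charRp n) fac) _.
  exact: filtW (@among_catr s s2) fl2.
have [s [C [as_ H]]] := main _ _ _ hl0.
by exists s, C.
Qed.

End FiltrationGrowth.

(** * Local cohomology *)

Section Flasque.
Variables (R : comNzRingType) (m : {pred R}) (K : fieldType) (pi : {rmorphism R -> K}).
Hypothesis hlocal : is_local_ring m pi.
Implicit Types X Y Z M A B : lmodType R.
Notation tors := (tors m).

Lemma pow_le_kill X (c : R) s t (x : X) : (s <= t)%N -> c ^+ s *: x = 0 -> c ^+ t *: x = 0.
Proof. by move=> le E; rewrite -(subnK le) exprD -scalerA E scaler0. Qed.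

(** Torsion for the ideal generated by [b]; using lists lets generators of m be added one at a
    time. *)
Definition gam X (b : seq R) (x : X) : Prop := forall c, c \in b -> exists s, c ^+ s *: x = 0.

Definition in_max (b : seq R) : Prop := forall c, c \in b -> c \in m.

Lemma lsub_gam X b : lsub (@gam X b).
Proof.
split=> [c _|a x y gx gy c cb]; first by exists 0%N; rewrite scaler0.
have [[s Es] [t Et]] := (gx c cb, gy c cb); exists (s + t)%N.
have Ey : c ^+ (s + t) *: y = 0 by apply: pow_le_kill Et; apply: leq_addl.
have Ex : c ^+ (s + t) *: x = 0 by apply: pow_le_kill Es; apply: leq_addr.
by rewrite scalerDr Ey addr0 scalerA mulrC -scalerA Ex scaler0.
Qed.

Lemma gam_lin X Y (f : {linear X -> Y}) b x : gam b x -> gam b (f x).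
Proof. by move=> gx c /gx[s Es]; exists s; rewrite -linearZ Es linear0. Qed.

Lemma gam_tors X (x : X) : exists b, in_max b /\ forall X (x : X), gam b x <-> tors x.
Proof.
have [gs [gm gsP]] := max_fg hlocal; exists gs; split=> // {}X {}x; split=> [gx|tx c cg]; last first.
  by apply: tx; apply: gm.
apply/(torsP hlocal).
have ex i : exists t, (i < size gs)%N -> gs`_i ^+ t *: x = 0.
  have [lt|ge] := ltnP i (size gs); last by exists 0%N.
  by have [t Et] := gx _ (mem_nth 0 lt); exists t.
have [t tP] := boolp.choice ex.
exists (\sum_(i < size gs) t i).+1 => l lm sz.
exact: (prod_tors gsP tP (leqnn _)).
Qed.

(* A weak form of flasqueness that makes a module acyclic for the functor of
   m-torsion elements: [Z], cut down to the elements killed by powers of [b],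
   is divisible by [a] up to a-power torsion. It is stable under restriction
   along the Frobenius, unlike injectivity. *)
Definition flasque X (Z : set X) : Prop := forall b a, in_max b -> a \in m ->
  forall x, Z x -> gam b x -> exists y t, [/\ Z y, gam b y & a ^+ t.+1 *: y = a ^+ t *: x].

(** The b-torsion of X maps onto that of the image of d, as it does when the first local cohomology
    of the kernel vanishes. *)
Definition lifts X Y (d : {linear X -> Y}) : Prop := forall b, in_max b ->
  forall x, gam b (d x) -> exists2 k, gam b k & d k = d x.

(** When a is added to b, some power c of a sends the lift k found so far into the kernel of d.
    Flasqueness gives y in the kernel with c y = c k up to torsion for c, and k - y is the new
    lift. *)
Lemma flasque_ker_lifts X Y (d : {linear X -> Y}) :
  flasque (fun x => d x = 0) -> lifts d.
Proof.
move=> fl; elim=> [|a b IH] bm x gx; first by exists x.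
have [||k gk Ek] := IH _ x; first by move=> c cb; apply: bm; rewrite inE cb orbT.
  by move=> c cb; apply: gx; rewrite inE cb orbT.
have am : a \in m by apply: bm; rewrite inE eqxx.
have [s Es] : exists s, a ^+ s *: d x = 0 by apply: gx; rewrite inE eqxx.
(* A positive exponent puts the power of a in m. *)
have {}Es : a ^+ s.+1 *: d x = 0 by apply: pow_le_kill Es.
have asm : a ^+ s.+1 \in m.
  have [im _ _] := m_prime hlocal.
  by rewrite exprSr; apply: (@idealM R (fun x => x \in m) _ _ im).
have bm' : in_max b by move=> c cb; apply: bm; rewrite inE cb orbT.
have dk : d (a ^+ s.+1 *: k) = 0 by rewrite linearZ Ek.
have [y [t [dy gy Ey]]] := fl b (a ^+ s.+1) bm' asm _ dk (lsubZ _ (lsub_gam X b) gk).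
exists (k - y); last by rewrite linearB dy subr0.
move=> c; rewrite inE => /orP[/eqP ->|cb]; last first.
  by apply: (lsubB (lsub_gam X b)).
exists (s.+1 * t.+1)%N; rewrite scalerBr exprM Ey exprSr -scalerA subrr //.
Qed.

Lemma inj_lifts X Y (d : {linear X -> Y}) : (forall x, d x = 0 -> x = 0) -> lifts d.
Proof.
move=> inj b _ x gx; exists x => // c /gx[s Es]; exists s; apply: inj.
by rewrite linearZ.
Qed.

Lemma tors_ker_lifts X Y (d : {linear X -> Y}) : (forall x, d x = 0 -> tors x) -> lifts d.
Proof.
move=> tk b bm x gx; exists x => // c cb; have [s Es] := gx c cb.
have [|t Et] := tk (c ^+ s *: x) _ c (bm _ cb); first by rewrite linearZ.
by exists (t + s)%N; rewrite exprD -scalerA.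
Qed.

Lemma flasque_im X Y (d : {linear X -> Y}) : flasque (fun _ : X => True) -> lifts d ->
  flasque (fun y => exists x, d x = y).
Proof.
move=> fl li b a bm am _ [x <-] /(li b bm) [k gk <-].
have [y [t [_ gy Ey]]] := fl b a bm am k I gk.
exists (d y), t; split; [by exists y|exact: gam_lin|].
by rewrite -!linearZ Ey.
Qed.

Lemma lifts_tors X Y (d : {linear X -> Y}) x : lifts d -> tors (d x) ->
  exists2 k, tors k & d k = d x.
Proof.
move=> li tx; have [b [bm bP]] := gam_tors x.
by have [k /bP tk Ek] := li b bm x ((bP _ _).2 tx); exists k.
Qed.

Lemma flasqueW X (Z Z' : set X) : (forall x, Z x <-> Z' x) -> flasque Z -> flasque Z'.
Proof.
move=> ZZ fl b a bm am x /ZZ Zx gx; have [y [t [/ZZ Zy gy Ey]]] := fl b a bm am x Zx gx.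
by exists y, t.
Qed.

(** On the ideal generated by a^(t+1) and the annihilator of x, the map s a^(t+1) + u |-> s a^t x is
    well defined once the annihilators of the a^t x are stable. Extended to R, its value y at 1
    satisfies a^(t+1) y = a^t x and is killed by the annihilator of x, so it is b-torsion. *)
Lemma injective_flasque X : injective_module X -> flasque (fun _ : X => True).
Proof.
move/injective_moduleP => inj b a bm am x _ gx.
have [||t tP] := @ideal_acc R (local_noetherian hlocal) (fun t r => (r * a ^+ t) *: x = 0).
- move=> t; split; first by rewrite mul0r scale0r.
  move=> c r s Er Es; rewrite -[c *: r]/(c * r) mulrDl scalerDl Es addr0.
  by rewrite -mulrA -scalerA Er scaler0.
- by move=> t r Er; rewrite exprS mulrCA -scalerA Er scaler0.
have [||g gP] := inj R^o (fun r z => exists s u : R, [/\ r = s * a ^+ t.+1 + u,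
  u *: x = 0 & z = (s * a ^+ t) *: x]).
- split; first by exists 0, 0; rewrite !mul0r addr0 scale0r.
  move=> c _ _ _ _ [s [u [-> Eu ->]]] [s' [u' [-> Eu' ->]]].
  exists (c * s + s'), (c * u + u'); split.
  + by rewrite -[c *: _]/(c * _) mulrDr mulrDl addrACA !mulrA.
  + by rewrite scalerDl -scalerA Eu Eu' scaler0 addr0.
  + by rewrite scalerA -scalerDl mulrDl mulrA.
- move=> z [s [u [/esym/eqP + Eu ->]]]; rewrite addr_eq0 => /eqP E.
  by apply: (tP t.+1); rewrite E scaleNr Eu oppr0.
exists (g 1), t; split=> //.
- move=> c cb; have [s Es] := gx c cb; exists s.
  rewrite -linearZ; apply: gP; exists 0, (c ^+ s).
  by rewrite !mul0r add0r scale0r -[_ *: 1]/(_ * 1) mulr1.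
- rewrite -linearZ; apply: gP; exists 1, 0.
  by rewrite !mul1r addr0 scale0r -[_ *: 1]/(_ * 1) mulr1.
Qed.

Lemma flasque_pair X Y : flasque (fun _ : X => True) -> flasque (fun _ : Y => True) ->
  flasque (fun _ : (X * Y)%type => True).
Proof.
move=> fX fY b a bm am [x y] _ g.
have [|x' [t [_ gx' Ex]]] := fX b a bm am x I.
  by move=> c /g[s [Es _]]; exists s.
have [|y' [u [_ gy' Ey]]] := fY b a bm am y I.
  by move=> c /g[s [_ Es]]; exists s.
exists (x', y'), (t + u)%N; split=> //.
  move=> c cb; have [[s Es] [s' Es']] := (gx' c cb, gy' c cb); exists (s + s')%N.
  by congr pair; [apply: pow_le_kill Es; apply: leq_addr|apply: pow_le_kill Es'; apply: leq_addl].
congr pair => /=.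
  by rewrite -addSn addnC exprD -scalerA Ex scalerA -exprD addnC.
by rewrite -addnS exprD -scalerA Ey scalerA -exprD.
Qed.

Lemma tors_pair X Y (x : X) (y : Y) : tors ((x, y) : X * Y) <-> tors x /\ tors y.
Proof.
split=> [t|[tx ty] a am].
  by split=> a /t[s [E1 E2]]; exists s.
have [[s Es] [s' Es']] := (tx a am, ty a am); exists (s + s')%N.
by congr pair; [apply: pow_le_kill Es; apply: leq_addr|apply: pow_le_kill Es'; apply: leq_addl].
Qed.

(** * Complexes of flasque modules *)

Section Complexes.
Variables (obj : nat -> lmodType R) (d : forall i, {linear obj i -> obj i.+1}).

Definition cocyc j : set (obj j) := fun x => tors x /\ d j x = 0.
Definition cobound j : set (obj j) := match j with
  | 0 => fun x => x = 0
  | i.+1 => fun x => exists y, tors y /\ d i y = x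
  end.

Lemma lsub_cocyc j : lsub (@cocyc j).
Proof. by apply: lsubI; [apply: lsub_tors|apply: lsub_ker]. Qed.

Lemma lsub_cobound j : lsub (@cobound j).
Proof.
case: j => [|j]; first exact: lsub0.
split; first by exists 0; rewrite linear0; split=> //; case: (lsub_tors m (obj j)).
move=> a _ _ [x [tx <-]] [y [ty <-]]; exists (a *: x + y); rewrite linearP; split=> //.
by case: (lsub_tors m (obj j)) => _; apply.
Qed.

(** Lifting propagates upwards: if d i lifts torsion, then its image, which is the kernel of the
    next map, is flasque, and so the next map lifts torsion as well. *)
Lemma exact_flasque : (forall i, flasque (fun _ : obj i => True)) -> lifts (d 0) ->
  (forall i x, d i.+1 x = 0 <-> exists y, d i y = x) ->
  (forall i, lifts (d i)) /\ forall i z, cocyc z -> @cobound i.+1 z.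
Proof.
move=> fl l0 ex.
have li i : lifts (d i).
  elim: i => [//|i IH]; apply: flasque_ker_lifts.
  apply: flasqueW (flasque_im (fl i) IH) => x; exact: iff_sym.
split=> // i z [tz /ex[w Ew]]; have [|k tk Ek] := lifts_tors (x := w) (li i).
  by rewrite Ew.
by exists k; rewrite Ek.
Qed.

End Complexes.

(** Flasque resolutions, a class that contains injective resolutions and is preserved by F^n_*. *)
Record fres (M : lmodType R) := Fres {
  fobj : nat -> lmodType R;
  faug : {linear M -> fobj 0};
  fdiff : forall i, {linear fobj i -> fobj i.+1};
  fres_flasque : forall i, flasque (fun _ : fobj i => True);
  fres_aug0 : forall x, faug x = 0 -> x = 0;
  fres_exact0 : forall x, fdiff 0 x = 0 <-> exists y, faug y = x;
  fres_exactS : forall i x, fdiff i.+1 x = 0 <-> exists y, fdiff i y = x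
}.

Lemma res_aug0 M (I : injective_resolution M) x : res_aug I x = 0 -> x = 0.
Proof. by move=> E; apply: (@res_exact_aug _ _ I); rewrite E linear0. Qed.

Definition fres_of M (I : injective_resolution M) : fres M :=
  @Fres M _ (res_aug I) (res_diff I)
   (fun i => injective_flasque (@res_injective _ _ I i)) (@res_aug0 _ I)
   (@res_exact0 _ _ I) (@res_exactS _ _ I).

Lemma fdiff0_aug M (J : fres M) x : fdiff J 0 (faug J x) = 0.
Proof. by apply/fres_exact0; exists x. Qed.

Lemma fdiffK M (J : fres M) i x : fdiff J i.+1 (fdiff J i x) = 0.
Proof. by apply/fres_exactS; exists x. Qed.

Lemma chain_map_exists A B (J : fres A) (I : injective_resolution B) (phi : {linear A -> B}) :
  exists f : forall i, {linear fobj J i -> res_obj I i},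
    (forall x, f 0%N (faug J x) = res_aug I (phi x)) /\
    forall i x, f i.+1 (fdiff J i x) = res_diff I i (f i x).
Proof.
pose T i := {f : {linear fobj J i -> res_obj I i} |
  forall x, fdiff J i x = 0 -> res_diff I i (f x) = 0}.
have [f0 f0P] : {f0 : {linear fobj J 0 -> res_obj I 0} |
    forall x, f0 (faug J x) = res_aug I (phi x)}.
  apply: cid.
  have [||g gP] := (injective_moduleP _).1 (@res_injective _ _ I 0) (fobj J 0)
    (fun y z => exists2 x, faug J x = y & res_aug I (phi x) = z).
  - split; first by exists 0; rewrite !linear0.
    by move=> a _ _ _ _ [x <- <-] [y <- <-]; exists (a *: x + y); rewrite !linearP.
  - by move=> z [x /fres_aug0 -> <-]; rewrite !linear0.
  - by exists g => x; apply: gP; exists x.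
have f0K x : fdiff J 0 x = 0 -> res_diff I 0 (f0 x) = 0.
  by move=> /fres_exact0 [y <-]; rewrite f0P; apply/res_exact0; exists (phi y).
have next i (s : T i) : {s' : T i.+1 |
    forall x, sval s' (fdiff J i x) = res_diff I i (sval s x)}.
  apply: cid; case: s => f fK /=.
  have [||g gP] := (injective_moduleP _).1 (@res_injective _ _ I i.+1) (fobj J i.+1)
    (fun y z => exists2 x, fdiff J i x = y & res_diff I i (f x) = z).
  - split; first by exists 0; rewrite !linear0.
    by move=> a _ _ _ _ [x <- <-] [y <- <-]; exists (a *: x + y); rewrite !linearP.
  - by move=> z [x /fK -> <-].
  have gE x : g (fdiff J i x) = res_diff I i (f x) by apply: gP; exists x.
  have gK x : fdiff J i.+1 x = 0 -> res_diff I i.+1 (g x) = 0.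
    by move=> /fres_exactS [y <-]; rewrite gE; apply/res_exactS; exists (f y).
  by exists (exist _ g gK).
pose F := nat_rect T (exist _ f0 f0K) (fun i s => sval (next i s)).
by exists (fun i => sval (F i)); split=> // i x; apply: (svalP (next i (F i))).
Qed.

(** * Mapping cones *)

Section Cone.
Variables (A B : lmodType R) (J : fres A) (I : fres B).
Variable f : forall i, {linear fobj J i -> fobj I i}.
Hypothesis fd : forall i x, f i.+1 (fdiff J i x) = fdiff I i (f i x).

(** The cone of f, indexed so that J keeps its degrees and I is shifted up by one. *)
Definition cone_obj i : lmodType R := match i with
  | 0 => fobj J 0
  | i'.+1 => (fobj J i'.+1 * fobj I i')%type
  end.

Definition cone_fun i : cone_obj i -> cone_obj i.+1 := match i with
  | 0 => fun u => (fdiff J 0 u, f 0 u)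
  | i'.+1 => fun uv => (fdiff J i'.+1 uv.1, f i'.+1 uv.1 - fdiff I i' uv.2)
  end.

Fact cone_fun_linear i (a : R) x y : cone_fun (a *: x + y) = a *: @cone_fun i x + cone_fun y.
Proof.
case: i x y => [|i] x y /=; first by rewrite !linearP.
case: x y => [u v] [u' v']; congr pair => /=; first exact: linearP.
by rewrite (linearP (f _)) (linearP (fdiff I i)) opprD addrACA -scalerBr.
Qed.

HB.instance Definition _ i := GRing.isLinear.Build R (cone_obj i) (cone_obj i.+1) *:%R
  (@cone_fun i) (@cone_fun_linear i).

Definition cone_diff i : {linear cone_obj i -> cone_obj i.+1} := @cone_fun i.

Lemma cone_flasque i : flasque (fun _ : cone_obj i => True).
Proof.
case: i => [|i]; first exact: fres_flasque.
by apply: flasque_pair; apply: fres_flasque.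
Qed.

Lemma cone_diffK i x : cone_diff i.+1 (cone_diff i x) = 0.
Proof.
case: i x => [|i] x; rewrite /cone_diff /=; congr pair => /=.
- exact: fdiffK.
- by rewrite fd subrr.
- exact: fdiffK.
- by rewrite linearB /= fdiffK subr0 fd subrr.
Qed.

Lemma cone_exactSS i x : cone_diff i.+2 x = 0 <-> exists y, cone_diff i.+1 y = x.
Proof.
split=> [|[y <-]]; last exact: cone_diffK.
case: x => u v [/fres_exactS[u0 Eu] /eqP]; rewrite subr_eq0 => /eqP E.
have /fres_exactS[v0 Ev] : fdiff I i.+1 (f i.+1 u0 - v) = 0.
  by rewrite linearB /= -fd Eu E subrr.
by exists (u0, v0); congr pair; rewrite /= ?Eu // Ev opprB addrC subrK.
Qed.

(* As [phi] is injective, the only cohomology of the cone is the cokernel of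
   [phi], in degree 1. *)
Variable phi : {linear A -> B}.
Hypothesis f0 : forall x, f 0%N (faug J x) = faug I (phi x).
Hypothesis phi0 : forall x, phi x = 0 -> x = 0.

Lemma cone_diff0_inj x : cone_diff 0 x = 0 -> x = 0.
Proof.
move=> [/fres_exact0[a <-]]; rewrite f0 => /fres_aug0/phi0 ->.
by rewrite linear0.
Qed.

Lemma cone_exact1 u v : cone_diff 1 (u, v) = 0 -> exists u0 b,
  (u, v) = cone_diff 0 u0 + (0, faug I b).
Proof.
move=> [/fres_exactS[u0 Eu] /eqP]; rewrite subr_eq0 => /eqP E.
have /fres_exact0[b Eb] : fdiff I 0 (v - f 0 u0) = 0.
  by rewrite linearB /= -fd Eu E subrr.
by exists u0, b; congr pair; rewrite /= ?addr0 ?Eu // Eb addrC subrK.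
Qed.

Lemma cocyc_coneS j u v : @cocyc cone_obj cone_diff j.+1 (u, v) <->
  [/\ tors u, tors v, fdiff J j.+1 u = 0 & f j.+1 u = fdiff I j v].
Proof.
split=> [[/tors_pair[tu tv] [Eu /eqP]]|[tu tv Eu Ev]].
  by rewrite subr_eq0 => /eqP Ev.
by split; [apply/tors_pair|congr pair; rewrite /= ?Eu // Ev subrr].
Qed.

Lemma cobound_coneS j u v : @cobound cone_obj cone_diff j.+1 (u, v) <->
  exists w, [/\ tors w, fdiff J j w = u & @cobound (fobj I) (fdiff I) j (f j w - v)].
Proof.
case: j u v => [|j] u v; split.
- by case=> w [tw [<- <-]]; exists w; rewrite /= subrr.
- case=> w [tw <- /eqP]; rewrite subr_eq0 => /eqP <-; exists w; by split.
- case=> -[w z] [/tors_pair[tw tz] [<- <-]]; exists w; split=> //.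
  by exists z; rewrite /= opprB addrC subrK.
- case=> w [tw <- [z [tz Ez]]]; exists (w, z); split; first exact/tors_pair.
  by congr pair; rewrite /= Ez opprB addrC subrK.
Qed.

End Cone.
End Flasque.

(** * Existence of factors, and their relation to [subquot_iso] *)

Section Factors.
Variables (R : comNzRingType) (p : nat) (charRp : p \in [pchar R]).
Implicit Types X Y N : lmodType R.

Lemma factor_exists X (U U' : set X) : lsub U -> lsub U' -> (forall x, U x -> U' x) ->
  exists N, factor U U' N.
Proof.
move=> lU lU' sub; have [Y [i [inji iP]]] := sub_exists lU'.
have [N [q [qo qP]]] := quot_exists charRp (lsub_pre i lU).
exists N, (fun x n => exists2 y, i y = x & q y = n); split.
- split; first by exists 0; rewrite linear0.
  by move=> a _ _ _ _ [y <- <-] [z <- <-]; exists (a *: y + z); rewrite linearP.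
- move=> x; split=> [/iP[y Ey]|[_ [y Ey _]]]; first by exists (q y), y.
  by apply/iP; exists y.
- by move=> n; have [y Ey] := qo n; exists (i y), y.
- move=> n [y Ey <-]; have -> : y = 0 by apply: inji; rewrite Ey linear0.
  exact: linear0.
- move=> x; split=> [Ux|[y <- /qP //]].
  by have [y Ey] := (iP x).1 (sub _ Ux); exists y => //; apply/qP; rewrite Ey.
Qed.

Lemma subquot_iso_factor X (Z B : set X) N : lsub Z -> (forall x, B x -> Z x) ->
  subquot_iso Z B N -> factor B Z N.
Proof.
move=> lZ sub [f [fl fo fk]].
have Z0 : Z 0 by case: lZ.
have f0 : f 0 = 0.
  by have := fl 1 0 0 Z0 Z0; rewrite !scale1r addr0 -{1}[f 0]addr0 => /addrI.
exists (fun x n => Z x /\ f x = n); split.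
- split=> // a x x' _ _ [Zx <-] [Zx' <-]; split; last exact: fl.
  by case: lZ => _; apply.
- by move=> x; split=> [Zx|[_ [Zx _]] //]; exists (f x).
- by move=> n; have [x [Zx Ex]] := fo n; exists x.
- by move=> n [_ <-].
- by move=> x; split=> [Bx|[Zx /fk]]; [split; [apply: sub|apply/fk; [apply: sub|]]|apply].
Qed.

Lemma factor_subquot_iso X (U U' : set X) N : factor U U' N -> subquot_iso U' U N.
Proof.
move=> [r [rr d o u k]].
have ex x : exists n, U' x -> r x n.
  have [/d[n h]|nU] := pselect (U' x); first by exists n.
  by exists 0.
have [f fP] := boolp.choice ex; exists f; split.
- move=> a x y Ux Uy; apply: (lrel_uniq rr u (fP _ _)); last first.
    by case: rr => _; apply; apply: fP.
  by apply/d; exists (a *: f x + f y); case: rr => _; apply; apply: fP.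
- move=> n; have [x h] := o n; exists x; have Ux : U' x by apply/d; exists n.
  by split=> //; apply: (lrel_uniq rr u (fP _ Ux)).
- move=> x Ux; split=> [E|/k h]; first by apply/k; rewrite -E; apply: fP.
  exact: lrel_uniq rr u (fP _ Ux) h.
Qed.

End Factors.

(** * Comparison of resolutions and the cokernel of an injection *)

Section LocalCohomology.
Variables (R : comNzRingType) (m : {pred R}) (K : fieldType) (pi : {rmorphism R -> K}).
Variables (p : nat) (charRp : p \in [pchar R]).
Hypothesis hlocal : is_local_ring m pi.
Implicit Types X Y Z M A B N H : lmodType R.
Notation tors := (tors m).
Notation fres := (fres m).
Notation fres_of := (fres_of hlocal).

Definition cohom (obj : nat -> lmodType R) (d : forall i, {linear obj i -> obj i.+1}) j H :=
  factor (cobound m d (j := j)) (cocyc m d (j := j)) H.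

Lemma cobound_cocyc (obj : nat -> lmodType R) (d : forall i, {linear obj i -> obj i.+1}) j x :
  (forall i x, d i.+1 (d i x) = 0) -> cobound m d (j := j) x -> cocyc m d (j := j) x.
Proof.
move=> dK; case: j x => [|j] x; first by move=> ->; case: (lsub_cocyc m d 0).
by move=> [y [ty <-]]; split; [apply: tors_lin|apply: dK].
Qed.

Lemma cohom_exists (obj : nat -> lmodType R) (d : forall i, {linear obj i -> obj i.+1}) j :
  (forall i x, d i.+1 (d i x) = 0) -> exists H, cohom d j H.
Proof.
move=> dK; apply: (factor_exists charRp); [exact: lsub_cobound|exact: lsub_cocyc|].
by move=> x; apply: cobound_cocyc.
Qed.

(** The cone of a comparison map over the identity is an exact complex of flasque modules, so it
    stays exact on torsion elements; hence the map is an isomorphism on local cohomology. *)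
Lemma fres_unique M (J : fres M) (I : injective_resolution M) j H H' :
  cohom (fdiff J) j H -> cohom (res_diff I) j H' ->
  exists g : {linear H -> H'}, (forall y, exists x, g x = y) /\ forall x, g x = 0 -> x = 0.
Proof.
have [f [f0 fd]] := chain_map_exists J I idfun.
pose I' := fres_of I.
have [_ ex] : (forall i, lifts m (cone_diff (J := J) (I := I') f i)) /\
    forall i z, cocyc m (cone_diff (J := J) (I := I') f) z -> cobound m (cone_diff (J := J) (I := I') f) (j := i.+1) z.
  apply: (exact_flasque hlocal).
  - exact: cone_flasque.
  - apply: inj_lifts; exact: (cone_diff0_inj (I := I') (phi := idfun) f0).
  - case=> [|i] x; last exact: (cone_exactSS (I := I') fd).
    split=> [|[y <-]]; last exact: (cone_diffK (I := I') fd).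
    case: x => u v /(cone_exact1 (I := I') fd) [u0 [b E]].
    exists (u0 + faug J b); rewrite E linearD; congr (_ + _).
    by congr pair; rewrite /= ?fdiff0_aug // f0.
have {}ex i (u : fobj J i.+1) (v : fobj I' i) :
    [/\ tors u, tors v, fdiff J i.+1 u = 0 & f i.+1 u = fdiff I' i v] ->
    exists w, [/\ tors w, fdiff J i w = u & cobound m (fdiff I') (j := i) (f i w - v)].
  by move/(cocyc_coneS (I := I') f u v)/ex/(cobound_coneS (I := I') f u v).
have fZ z : cocyc m (fdiff J) (j := j) z -> cocyc m (res_diff I) (j := j) (f j z).
  by move=> [tz Ez]; split; [apply: tors_lin|rewrite -fd Ez linear0].
have fB z : cobound m (fdiff J) (j := j) z -> cobound m (res_diff I) (j := j) (f j z).
  case: (j) z => [|i] z; first by move=> ->; apply: linear0.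
  by move=> [y [ty <-]]; exists (f i y); rewrite fd; split=> //; apply: tors_lin.
have fB' z : cocyc m (fdiff J) (j := j) z -> cobound m (res_diff I) (j := j) (f j z) ->
    cobound m (fdiff J) (j := j) z.
  case: (j) z => [|i] z [tz Ez] => [Efz|[w [tw Ew]]].
    apply: (cone_diff0_inj (I := I') (phi := idfun) f0) => //.
    by congr pair; rewrite /= ?Ez ?Efz.
  by have [//|w' [tw' Ew' _]] := ex i z w; exists w'.
have fZ' w : cocyc m (res_diff I) (j := j) w -> exists z, cocyc m (fdiff J) (j := j) z /\
    cobound m (res_diff I) (j := j) (f j z - w).
  move=> [tw Ew]; have [|z [tz Ez Bz]] := ex j 0 w; last by exists z.
  by split; rewrite ?linear0 // /= ?Ew //; case: (lsub_tors m (fobj J j.+1)).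
move=> [r [rr rd ro ru rk]] [s [sr sd so su sk]].
have [|||g gP] := @lrel_fun R H H' (fun h h' => exists2 z, r z h & s (f j z) h').
- split; first by exists 0; [case: rr|rewrite linear0; case: sr].
  move=> a n1 n2 n1' n2' [x h h'] [y k k']; exists (a *: x + y).
    by case: rr => _; apply.
  by rewrite linearP; case: sr => _; apply.
- move=> h; have [z hz] := ro h; have /sd[h' hh'] : cocyc m (res_diff I) (f j z).
    by apply/fZ/rd; exists h.
  by exists h', z.
- move=> h' [z /rk/fB/sk s0 hs]; exact: lrel_uniq sr su hs s0.
exists g; split=> [h'|h /gP[z hz /sk hs]].
  have [w hw] := so h'; have /fZ'[z [/rd[h hz] /sk Bz]] : cocyc m (res_diff I) (j := j) w.
    by apply/sd; exists h'.
  exists h; apply/gP; exists z => //; rewrite -[f j z](subrK w) -[h']add0r.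
  exact: lrelD.
apply: (lrel_uniq rr ru hz); apply/rk; apply: fB' hs.
by apply/rd; exists h.
Qed.

Section ConeResolution.
Variables (A B C : lmodType R) (J : fres A) (I : fres B).
Variable f : forall i, {linear fobj J i -> fobj I i}.
Hypothesis fd : forall i x, f i.+1 (fdiff J i x) = fdiff I i (f i x).
Variable phi : {linear A -> B}.
Hypothesis f0 : forall x, f 0%N (faug J x) = faug I (phi x).
Hypothesis phi0 : forall x, phi x = 0 -> x = 0.
Variable q : {linear B -> C}.
Hypothesis qo : forall c, exists b, q b = c.
Hypothesis qP : forall b, q b = 0 <-> exists a, phi a = b.
Notation cdiff := (cone_diff (J := J) (I := I) f).

(** Collapsing the first two terms of the cone to the cokernel Q of its injective differential gives
    a flasque resolution of C. This yields the part of the long exact sequence that is used, as the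
    cone is tied to both J and I. *)
Lemma cone_resolution : exists L : fres C, forall j H,
  cohom (fdiff L) j H -> cohom cdiff j.+1 H.
Proof.
have inj0 := cone_diff0_inj f0 phi0.
have [Q [pr [pro prP]]] := quot_exists charRp (lsub_im (cdiff 0) (@lsubT _ _)).
have [|||d0 d0P] := @lrel_fun R Q (cone_obj J I 2) (fun y z => exists2 x, pr x = y & cdiff 1 x = z).
- split; first by exists 0; rewrite linear0.
  by move=> a _ _ _ _ [x <- <-] [y <- <-]; exists (a *: x + y); rewrite linearP.
- by move=> y; have [x Ex] := pro y; exists (cdiff 1 x), x.
- by move=> z [x /prP[u _ <-] <-]; apply: (cone_diffK fd).
have d0E x : d0 (pr x) = cdiff 1 x by apply/d0P; exists x.
pose io b : cone_obj J I 1 := (0, faug I b).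
have iol (a : R) b b' : io (a *: b + b') = a *: io b + io b'.
  by congr pair; rewrite /= ?linearP // scaler0 addr0.
have io0 b : io (phi b) = cdiff 0 (faug J b).
  by congr pair; rewrite /= ?fdiff0_aug // f0.
have [|||aug augP] := @lrel_fun R C Q (fun c y => exists2 b, q b = c & pr (io b) = y).
- split; first by exists 0; rewrite ?linear0 // /io linear0 linear0.
  move=> a _ _ _ _ [b <- <-] [b' <- <-]; exists (a *: b + b'); first exact: linearP.
  by rewrite iol linearP.
- by move=> c; have [b Eb] := qo c; exists (pr (io b)), b.
- by move=> y [b /qP[a <-] <-]; apply/prP; exists (faug J a) => //; rewrite io0.
have augE b : aug (q b) = pr (io b) by apply/augP; exists b.
(* Torsion elements of Q lift to torsion elements of the cone, so passing to Q loses no torsion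
   cocycle or coboundary. *)
have lpr : lifts m pr.
  apply: (flasque_ker_lifts hlocal).
  apply: flasqueW (flasque_im (cone_flasque (J := J) (I := I) (i := 0)) (inj_lifts inj0)) => x.
  by rewrite prP; split=> [[u <-]|[u _ <-]]; exists u.
pose Lobj i : lmodType R := if i is i'.+1 then cone_obj J I i'.+2 else Q.
pose Ldiff i : {linear Lobj i -> Lobj i.+1} :=
  match i return {linear Lobj i -> Lobj i.+1} with
  | 0 => d0
  | i'.+1 => cdiff i'.+2
  end.
have Lf i : flasque m (fun _ : Lobj i => True).
  case: i => [|i]; last exact: cone_flasque.
  apply: flasqueW (flasque_im (cone_flasque (J := J) (I := I) (i := 1)) lpr) => y.
  by split=> // _; apply: pro.
have La c : aug c = 0 -> c = 0.
  have [b <-] := qo c; rewrite augE => /prP[u _ /esym E].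
  apply/qP; have [/esym/fres_exact0[a Ea] Eu] : 0 = fdiff J 0 u /\ faug I b = f 0 u.
    by move: E => [-> ->].
  exists a; apply/eqP; rewrite -subr_eq0; apply/eqP/(fres_aug0 (f := I)).
  by rewrite linearB Eu -Ea f0 subrr.
have L0 y : Ldiff 0 y = 0 <-> exists c, aug c = y.
  split=> [|[c <-]].
    have [[u v] <-] := pro y; rewrite /= d0E => /(cone_exact1 fd)[u0 [b ->]].
    exists (q b); rewrite augE linearD -[LHS]add0r; congr (_ + _).
    by apply/esym/prP; exists u0.
  have [b <-] := qo c; rewrite augE /= d0E; congr pair; rewrite /= ?linear0 //.
  by rewrite fdiff0_aug subrr.
have LS i x : Ldiff i.+1 x = 0 <-> exists y, Ldiff i y = x.
  case: i x => [|i] x; last exact: (cone_exactSS fd).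
  split=> [/(cone_exactSS fd)[y <-]|[y <-]]; first by exists (pr y); rewrite /= d0E.
  by have [z <-] := pro y; rewrite /= d0E; apply: (cone_diffK fd).
exists (Fres (fdiff := Ldiff) Lf La L0 LS) => j H.
(* Q enters only through the cocycles in degree 0 and the coboundaries in degree 1; higher degrees
   agree by definition. *)
case: j => [|[|j]]; rewrite /cohom //=.
- move=> [r [rr rd ro ru rk]].
  exists (fun x h => cocyc m cdiff (j := 1) x /\ r (pr x) h); split.
  + split; first by rewrite linear0; split; [case: (lsub_cocyc m cdiff 1)|case: rr].
    move=> a x x' h h' [cx hx] [cx' hx']; split.
      by case: (lsub_cocyc m cdiff 1) => _; apply.
    by rewrite linearP; case: rr => _; apply.
  + move=> x; split=> [cx|[h []]//].
    have /rd[h hh] : cocyc m Ldiff (j := 0) (pr x).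
      by case: cx => tx Ex; split; [apply: tors_lin|rewrite /= d0E].
    by exists h.
  + move=> h; have [y hy] := ro h; have [ty Ey] : cocyc m Ldiff (j := 0) y.
      by apply/rd; exists h.
    have [x Ex] := pro y; rewrite -Ex in ty Ey hy.
    have [k tk Ek] := lifts_tors hlocal lpr ty.
    exists k; split; last by rewrite Ek.
    by split=> //; rewrite -d0E Ek.
  + by move=> h [_]; rewrite linear0; apply: ru.
  + move=> x; split=> [[u [tu <-]]|[[tx Ex] /rk/prP[u _ Eu]]].
      split; first by split; [exact: (tors_lin (cdiff 0) tu)|apply: cone_diffK].
      by have -> : pr (cdiff 0 u) = 0; [apply/prP; exists u|case: rr].
    have [|k tk Ek] := lifts_tors hlocal (inj_lifts inj0) (x := u); first by rewrite Eu.
    by exists k; split=> //; rewrite -Eu; exact: Ek.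
- move=> hL; have E : cobound m Ldiff (j := 1) = cobound m cdiff (j := 2); last first.
    change (factor (cobound m cdiff (j := 2)) (cocyc m cdiff (j := 2)) H).
    by rewrite -E; exact: hL.
  apply/funext => x; apply/propext; split=> [[y [ty <-]]|[k [tk <-]]]; last first.
    by exists (pr k); split; [apply: tors_lin|rewrite /= d0E].
  have [z Ez] := pro y; rewrite -Ez in ty *; have [k tk Ek] := lifts_tors hlocal lpr ty.
  by exists k; split=> //; rewrite /= -Ek d0E.
Qed.

End ConeResolution.
End LocalCohomology.

(** * Growth of local cohomology *)

Section CohomologySmall.
Variables (R : comNzRingType) (m : {pred R}) (K : fieldType) (pi : {rmorphism R -> K}).
Variables (p : nat) (charRp : p \in [pchar R]).
Hypothesis hlocal : is_local_ring m pi.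
Implicit Types X Y Z M A B N H : lmodType R.
Notation k0 := (resfield pi).
Notation tors := (tors m).
Notation fres := (fres m).
Notation fres_of := (fres_of hlocal).
Notation cohom := (cohom m).
Notation push n X := (frobenius_push charRp n X).
Notation Phi X := (Phi charRp X).
Variable alpha : nat.
Hypothesis (alphaP : length_le k0 (fun _ : Phi k0 => True) alpha).
Notation small := (small m pi charRp alpha).

Definition cohom_small j M : Prop := forall (I : injective_resolution M) H,
  cohom (res_diff I) j H -> small j H.

Lemma res_diffK M (I : injective_resolution M) i x :
  res_diff I i.+1 (res_diff I i x) = 0.
Proof. by apply/(res_exactS (i0 := I)); exists x. Qed.

Lemma cohom_small_fres j M (L : fres M) H : cohom_small j M ->
  cohom (fdiff L) j H -> small j H.
Proof.
move=> sM cH; have [I] := injective_resolution_exists charRp M.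
have [H' cH'] := cohom_exists m charRp j (res_diffK (I := I)).
have [g [go g0]] := fres_unique hlocal cH cH'.
by apply: small_sq (sM I H' cH'); apply: (sq_inj (f := g)); apply: lin_inj.
Qed.

Section Cone.
Variables (A B C : lmodType R) (phi : {linear A -> B}) (q : {linear B -> C}).
Hypotheses (phi0 : forall x, phi x = 0 -> x = 0) (qo : forall c, exists b, q b = c).
Hypothesis qP : forall b, q b = 0 <-> exists a, phi a = b.
Variables (IA : injective_resolution A) (IB : injective_resolution B).
Let J := fres_of IA.
Let I := fres_of IB.
Variable f : forall i, {linear fobj J i -> fobj I i}.
Hypothesis f0 : forall x, f 0%N (faug J x) = faug I (phi x).
Hypothesis fd : forall i x, f i.+1 (fdiff J i x) = fdiff I i (f i x).

Lemma cone_small j : cohom_small j C -> exists H,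
  cohom (cone_diff (J := J) (I := I) f) j.+1 H /\ small j H.
Proof.
move=> sC; have [L LP] := cone_resolution charRp hlocal fd f0 phi0 qo qP.
have [H cH] := cohom_exists m charRp j (fdiffK (J := L)).
by exists H; split; [apply: LP|apply: cohom_small_fres sC cH].
Qed.

End Cone.

(** Exactness of H^j(A) -> H^j(B) -> H^j(C), with the last term read in degree j + 1 of the cone,
    where a cocycle w of B is sent to (0, w). *)
Lemma cohom_small_ses j A B (C : lmodType R) (phi : {linear A -> B}) (q : {linear B -> C}) :
  injective phi -> (forall c, exists b, q b = c) ->
  (forall b, q b = 0 <-> exists a, phi a = b) ->
  cohom_small j A -> cohom_small j C -> cohom_small j B.
Proof.
move=> inj qo qP sA sC IB HB cB; have [IA] := injective_resolution_exists charRp A.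
have [HA cA] := cohom_exists m charRp j (res_diffK (I := IA)).
have [f [f0 fd]] := chain_map_exists (fres_of IA) IB phi.
have phi0 x : phi x = 0 -> x = 0 by rewrite -(linear0 phi) => /inj.
have [HC [cC sHC]] := cone_small (IA := IA) (IB := IB) phi0 qo qP f0 fd sC.
have sHA := sA IA HA cA.
have [r [rr rd ro ru rk]] := cA; have [s [sr sd so su sk]] := cB.
have [t [tr td to tu tk]] := cC.
have fZ z : cocyc m (res_diff IA) (j := j) z -> cocyc m (res_diff IB) (j := j) (f j z).
  move=> [tz Ez]; split; first exact: tors_lin.
  by rewrite -(fd j z) [fdiff _ _ _]Ez linear0.
have fB z : cobound m (res_diff IA) (j := j) z -> cobound m (res_diff IB) (j := j) (f j z).
  case: (j) z => [|i] z; first by move=> ->; apply: linear0.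
  by move=> [y [ty <-]]; exists (f i y); split; [apply: tors_lin|rewrite -fd].
pose io w : cone_obj (fres_of IA) (fres_of IB) j.+1 := (0, w).
have iol (a : R) w w' : io (a *: w + w') = a *: io w + io w'.
  by congr pair; rewrite /= scaler0 addr0.
apply: (small_ext hlocal (j := j) (B1 := fun h => exists2 z, cocyc m (res_diff IA) (j := j) z & s (f j z) h)
  (rho := fun a h => exists2 z, r z a & s (f j z) h)
  (sigma := fun c h => exists2 w, s w h & t (io w) c) _ _ _ _ _ _ _ sHA sHC).
- split; first by exists 0; [case: (lsub_cocyc m (res_diff IA) j)|rewrite linear0; case: sr].
  move=> a h h' [z Zz hz] [z' Zz' hz']; exists (a *: z + z').
    by case: (lsub_cocyc m (res_diff IA) j) => _; apply.
  by rewrite linearP; case: sr => _; apply.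
- split; first by exists 0; [case: rr|rewrite linear0; case: sr].
  move=> a x x' h h' [z Zz hz] [z' Zz' hz']; exists (a *: z + z').
    by case: rr => _; apply.
  by rewrite linearP; case: sr => _; apply.
- move=> h [z /rk/fB/sk s0 hs]; exact: lrel_uniq sr su hs s0.
- by move=> h [z Zz hz]; have /rd[a ha] := Zz; exists a, z.
- split.
    exists 0; first by case: sr.
    have -> : io 0 = 0 by []; by case: tr.
  move=> a c c' h h' [w hw tw] [w' hw' tw']; exists (a *: w + w').
    by case: sr => _; apply.
  by rewrite iol; case: tr => _; apply.
- move=> h [w hw /tk]; rewrite (cobound_coneS (I := fres_of IB) f) => -[z [tz Ez Bz]].
  exists z => //; rewrite -[f j z](subrK w) -[h]add0r.
  by apply: lrelD => //; apply/sk.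
- move=> h; have [w hw] := so h; have [tw Ew] : cocyc m (res_diff IB) (j := j) w.
    by apply/sd; exists h.
  have /td[c hc] : cocyc m (cone_diff (J := fres_of IA) (I := fres_of IB) f) (io w).
    apply/(cocyc_coneS (I := fres_of IB) f); rewrite linear0 linear0.
    by split=> //; case: (lsub_tors m (fobj (fres_of IA) j.+1)).
  by exists c, w.
Qed.

Lemma cohom_torsion M (I : injective_resolution M) j H :
  cohom (res_diff I) j H -> torsion_mod m H.
Proof.
move=> [r [rr rd ro ru rk]] h a am; have [z hz] := ro h.
have [tz _] : cocyc m (res_diff I) (j := j) z by apply/rd; exists h.
have [t Et] := tz a am; exists t; apply: ru; rewrite -Et; exact: lrelZ.
Qed.

(** For C = M/aM, the connecting map sends H^j(C) onto the kernel of a on H^(j+1)(M), and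
    [small_kernel] passes from this kernel to the whole module. Multiplication by a on the
    resolution itself serves as the chain map. *)
Lemma cohom_small_mul j M (C : lmodType R) a (q : {linear M -> C}) : a \in m ->
  (forall x : M, a *: x = 0 -> x = 0) -> (forall c, exists b, q b = c) ->
  (forall b, q b = 0 <-> exists x, a *: x = b) ->
  cohom_small j C -> cohom_small j.+1 M.
Proof.
move=> am inj qo qP sC I H cH.
have [phi phiE] := mul_lin M a.
have fex i : {f : {linear res_obj I i -> res_obj I i} | forall x, f x = a *: x}.
  by apply: cid; apply: mul_lin.
pose f i : {linear fobj (fres_of I) i -> fobj (fres_of I) i} := sval (fex i).
have fE i x : f i x = a *: x by apply: (svalP (fex i)).
have phi0 x : phi x = 0 -> x = 0 by rewrite phiE; apply: inj.
have qP' b : q b = 0 <-> exists x, phi x = b.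
  by rewrite qP; split=> -[x Ex]; exists x; rewrite ?phiE // -Ex phiE.
have f0 x : f 0%N (faug (fres_of I) x) = faug (fres_of I) (phi x).
  by rewrite fE phiE linearZ.
have fd i x : f i.+1 (fdiff (fres_of I) i x) = fdiff (fres_of I) i (f i x).
  by rewrite !fE linearZ.
have [HC [cC sHC]] := cone_small (IA := I) (IB := I) phi0 qo qP' f0 fd sC.
have [r [rr rd ro ru rk]] := cH; have [t [tr td to tu tk]] := cC.
have tH := cohom_torsion cH.
have [Z kZ] := kernel_exists H a; have [k [injk kP]] := kZ.
apply: (small_kernel hlocal tH am kZ).
pose D := cone_diff (J := fres_of I) (I := fres_of I) f.
apply: small_sq sHC.
exists (fun c z => exists u v, t ((u, v) : cone_obj (fres_of I) (fres_of I) j.+1) c /\ r u (k z)).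
split.
- split.
    exists 0, 0; rewrite linear0; split; [exact: (proj1 tr)|exact: (proj1 rr)].
  move=> b c c' z z' [u [v [h1 h2]]] [u' [v' [h1' h2']]].
  exists (b *: u + u'), (b *: v + v'); rewrite linearP; split.
    exact: (proj2 tr b _ _ _ _ h1 h1').
  exact: (proj2 rr b _ _ _ _ h2 h2').
- move=> z; have [u hu] := ro (k z).
  have [tu' Eu] : cocyc m (res_diff I) (j := j.+1) u by apply/rd; exists (k z).
  have /rk[v [tv Ev]] : r (a *: u) 0.
    have -> : 0 = a *: k z by symmetry; apply/kP; exists z.
    exact: lrelZ.
  have /td[c hc] : cocyc m D (j := j.+1) ((u, v) : cone_obj (fres_of I) (fres_of I) j.+1).
    by apply/(cocyc_coneS (I := fres_of I) f); split=> //; rewrite fE -Ev.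
  by exists c, u, v.
- move=> z [u [v [/tk]]]; rewrite (cobound_coneS (I := fres_of I) f) => -[w [tw Ew _]] h.
  apply: injk; rewrite linear0; apply: (lrel_uniq rr ru h); apply/rk.
  by exists w.
Qed.

Lemma cohom_eq0 M (I : injective_resolution M) j H : cohom (res_diff I) j H ->
  (forall z, cocyc m (res_diff I) (j := j) z -> cobound m (res_diff I) (j := j) z) ->
  small j H.
Proof.
move=> [r [rr rd ro ru rk]] ZB; apply: (small_zero charRp hlocal) => h.
have [z hz] := ro h; apply: (lrel_uniq rr ru hz); apply/rk/ZB/rd.
by exists h.
Qed.

Lemma cohom_small_torsion j M : torsion_mod m M -> cohom_small j.+1 M.
Proof.
move=> tM I H cH; apply: (cohom_eq0 cH).
apply: (exact_flasque hlocal _ _ _).2.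
- by move=> i; apply: (injective_flasque hlocal); apply: res_injective.
- apply: tors_ker_lifts => x /res_exact0[y <-]; exact/tors_lin/tM.
- exact: res_exactS.
Qed.

Lemma cohom0_sq M (I : injective_resolution M) H : torsion_mod m M ->
  cohom (res_diff I) 0 H -> sq M H.
Proof.
move=> tM [r [rr rd ro ru rk]]; exists (fun x h => r (res_aug I x) h); split.
- split; first by rewrite linear0; case: rr.
  by move=> a x x' y y' h h'; rewrite linearP; case: rr => _; apply.
- move=> h; have [z hz] := ro h; have [_ /res_exact0[x Ex]] : cocyc m (res_diff I) (j := 0) z.
    by apply/rd; exists h.
  by exists x; rewrite Ex.
- by move=> h; rewrite linear0; apply: ru.
Qed.

(** For R/Q with Q different from m, an element of m outside Q is regular: it makes H^0 vanish and
    reduces degree j + 1 to degree j. For Q = m the module is torsion, so that only H^0 remains. *)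
Lemma cohom_small_fg j M : fin_gen M -> cohom_small j M.
Proof.
have noeth := local_noetherian hlocal.
have dev i : (forall Q N, primeI Q -> cyclic_mod Q N -> cohom_small i N) ->
    forall M, fin_gen M -> cohom_small i M.
  move=> prim {}M fM.
  apply: (@devissage R noeth p charRp (cohom_small i) (fun a => a = 0)) fM.
  - by move=> A B C phi q inj qo qP; apply: cohom_small_ses qP.
  - move=> N N0 I H cH; apply: (cohom_eq0 cH); case: (i) => [|i'] z.
      by move=> [tz /res_exact0[y <-]]; rewrite [y]N0 linear0.
    apply: (exact_flasque hlocal _ _ _).2.
    + by move=> l; apply: (injective_flasque hlocal); apply: res_injective.
    + by apply: inj_lifts => x /res_exact0[y <-]; rewrite [y]N0 linear0.
    + exact: res_exactS.
  - by move=> Q N pQ _; apply: prim.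
  - by move=> a x ->; rewrite scale0r.
have notm Q : primeI Q -> Q <> (fun x => x \in m : Prop) -> exists a, a \in m /\ ~ Q a.
  move=> [iQ Q1 _] ne; apply: contrapT => nex; apply: ne.
  apply/funext => a; apply/propext; split=> [|am]; first exact: (proper_sub_m hlocal).
  by apply: contrapT => nQa; apply: nex; exists a.
have regular Q N a : primeI Q -> cyclic_mod Q N -> ~ Q a -> forall x : N, a *: x = 0 -> x = 0.
  move=> pQ [g [gen ann]] nQa x; have [c ->] := gen x; rewrite scalerA => /ann.
  by case: pQ => _ _ H /H[//|Qc]; apply/ann.
have tors_res N : cyclic_mod (fun x => x \in m : Prop) N -> torsion_mod m N.
  move=> [g [gen ann]] x a am; exists 1%N; have [c ->] := gen x.
  by rewrite expr1 scalerA mulrC -scalerA (ann a).2 // scaler0.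
elim: j M => [|j IHj] M; apply: dev => Q N pQ cN.
  have [EQ|/notm[//|a [am nQa]]] := pselect (Q = (fun x => x \in m : Prop)).
    rewrite EQ in cN; have [f [fo f0]] := cyclic_iso (cyclic_resfield hlocal) cN.
    move=> I H cH; apply: small_sq (small_resfield hlocal alphaP).
    exact: sq_trans (sq_surj fo) (cohom0_sq (tors_res N cN) cH).
  move=> I H cH; apply: (cohom_eq0 cH) => z [tz /res_exact0[y Ey]].
  have [t Et] := tz a am; have : a ^+ t *: y = 0.
    by apply: (res_aug0 (I := I)); rewrite linearZ /= Ey.
  rewrite -Ey; elim: (t) => [|u IHu]; first by rewrite expr0 scale1r => ->; rewrite linear0.
  by rewrite exprS -scalerA => /(regular Q N a pQ cN nQa)/IHu.
have [EQ|/notm[//|a [am nQa]]] := pselect (Q = (fun x => x \in m : Prop)).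
  by apply: cohom_small_torsion; apply: tors_res; rewrite -EQ.
have [f fE] := mul_lin N a.
have [C [q [qo qP]]] := quot_exists charRp (lsub_im f (@lsubT _ N)).
apply: (cohom_small_mul am (regular Q N a pQ cN nQa) qo).
  move=> b; rewrite qP; split=> [[x _ <-]|[x <-]]; first by exists x; rewrite fE.
  by exists x; rewrite ?fE.
apply: IHj; apply: (fin_gen_surj qo); have [g [gen _]] := cN.
by exists 1%N, (fun _ => g) => y; have [c ->] := gen y; exists (fun _ => c); rewrite big_ord1.
Qed.

Lemma tors_push n X (x : X) : @tors (push n X) x <-> tors x.
Proof.
have q0 : (0 < p ^ n)%N by rewrite expn_gt0 (p_gt0 charRp).
split=> tx a am; have [t Et] := tx a am.
  by exists (t * p ^ n)%N; rewrite exprM -(pushE charRp n).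
exists t; rewrite (pushE charRp n) -exprM.
by apply: pow_le_kill Et; rewrite leq_pmulr.
Qed.

(** The scalar a acts on F^n_* X as a^(p^n) does on X, and this is again an element of m. *)
Lemma flasque_push n X : flasque m (fun _ : X => True) -> flasque m (fun _ : push n X => True).
Proof.
have q0 : (0 < p ^ n)%N by rewrite expn_gt0 (p_gt0 charRp).
move=> fl b a bm am x _ gx.
have am' : a ^+ (p ^ n) \in m.
  have [im _ _] := m_prime hlocal.
  by rewrite -(prednK q0) exprSr; apply: (@idealM R (fun x => x \in m) _ _ im).
have gx' : gam b (x : X).
  by move=> c /gx[s]; rewrite (pushE charRp n) -exprM => Es; exists (s * p ^ n)%N.
have [y [t [_ gy Ey]]] := fl b _ bm am' (x : X) I gx'.
exists y, t; split=> //.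
  move=> c /gy[s Es]; exists s; rewrite (pushE charRp n) -exprM.
  by apply: pow_le_kill Es; rewrite leq_pmulr.
by rewrite !(pushE charRp n) -!exprM ![(_ * p ^ n)%N]mulnC !exprM.
Qed.

Lemma fres_push n M (J : fres M) : exists L : fres (push n M), forall j H,
  cohom (fdiff J) j H -> cohom (fdiff L) j (push n H).
Proof.
pose phi := frobenius_iter charRp n.
pose aug : {linear push n M -> push n (fobj J 0)} := sval (cid (lin_restrict phi (faug J))).
have augE (x : M) : aug x = faug J x := svalP (cid (lin_restrict phi (faug J))) x.
pose d i : {linear push n (fobj J i) -> push n (fobj J i.+1)} :=
  sval (cid (lin_restrict phi (fdiff J i))).
have dE i (x : fobj J i) : d i x = fdiff J i x := svalP (cid (lin_restrict phi (fdiff J i))) x.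
have fl i : flasque m (fun _ : push n (fobj J i) => True).
  by apply: flasque_push; apply: fres_flasque.
have a0 x : aug x = 0 -> x = 0 by rewrite augE; apply: fres_aug0.
have ex0 x : d 0 x = 0 <-> exists y, aug y = x.
  rewrite dE; split=> [/fres_exact0[y <-]|[y <-]]; first by exists y; rewrite augE.
  by rewrite augE; apply: fdiff0_aug.
have exS i x : d i.+1 x = 0 <-> exists y, d i y = x.
  rewrite dE; split=> [/fres_exactS[y <-]|[y <-]]; first by exists y; rewrite dE.
  by rewrite dE; apply: fdiffK.
exists (Fres (fdiff := d) fl a0 ex0 exS) => j H cH.
have := factor_restrict phi cH; rewrite /cohom /=.
have -> : cocyc m d (j := j) = cocyc m (fdiff J) (j := j).
  apply/funext => x; apply/propext; rewrite /cocyc dE.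
  by split=> -[/tors_push tx Ex]; split=> //; apply/tors_push.
have -> // : cobound m d (j := j) = cobound m (fdiff J) (j := j).
case: (j) => [//|i]; apply/funext => x; apply/propext.
by split=> -[y [/tors_push ty <-]]; exists y; rewrite dE; split=> //; apply/tors_push.
Qed.

Lemma is_local_cohomologyP j M H : is_local_cohomology m j M H ->
  exists I : injective_resolution M, cohom (res_diff I) j H.
Proof.
case=> I iso; exists I.
have EZ : @cocycles R m M I j = cocyc m (res_diff I) (j := j).
  apply/funext => x; apply/propext.
  by split=> -[/(torsionP hlocal) tx Ex]; split=> //; apply/(torsionP hlocal).
have EB : @coboundaries R m M I j = cobound m (res_diff I) (j := j).
  case: (j) => [//|i]; apply/funext => x; apply/propext.
  by split=> -[y [/(torsionP hlocal) ty Ey]]; exists y; split=> //; apply/(torsionP hlocal).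
rewrite EZ EB in iso; apply: subquot_iso_factor iso; first exact: lsub_cocyc.
by move=> x; apply: cobound_cocyc; apply: res_diffK.
Qed.

End CohomologySmall.

(** * From filtrations to [ell], and the final estimate *)

Section Ell.
Variable R : comNzRingType.
Implicit Types X N : lmodType R.

Lemma set_submod X (U : set X) : lsub U -> submod_closed (fun x => `[<U x>] : bool).
Proof.
move=> [U0 UD]; split; first exact/asboolP.
by move=> a x y /asboolP Ux /asboolP Uy; apply/asboolP/UD.
Qed.

Lemma filt_sets k (V : 'I_k -> lmodType R) X (U U' : set X) l :
  filt (fun N => exists v, V v = N) U U' l -> exists N : nat -> {pred X},
    [/\ forall i, (i <= l)%N -> submod_closed (N i),
        forall x, x \in N 0%N <-> U x,
        forall x, x \in N l <-> U' x
      & forall i, (i < l)%N -> {subset N i <= N i.+1} /\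
          exists v : 'I_k, subquot_iso [set x | x \in N i.+1]%classic
                                       [set x | x \in N i]%classic (V v)].
Proof.
elim=> {U U' l} [U lU|U U' U'' l N h [N' [lN' N0 Nl sN]] lU'' [v Ev] fac].
  exists (fun _ x => `[<U x>]); split=> //.
  - move=> i _; exact: set_submod.
  - by move=> x; split=> /asboolP.
  - by move=> x; split=> /asboolP.
have [lU lU' _] := filt_lsub h.
exists (fun i => if (i <= l)%N then N' i else fun x => `[<U'' x>]); split.
- move=> i _; case: leqP => [le|_]; first exact: lN'.
  exact: set_submod.
- by [].
- by move=> x; rewrite ltnn; split=> /asboolP.
- move=> i; rewrite ltnS => le; rewrite le.
  have [lt|ge] := ltnP i l; first exact: sN.
  have -> : i = l by lia.
  have EN : [set x | x \in N' l]%classic = U'.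
    by apply/funext => x; apply/propext; apply: Nl.
  have EU : [set x | x \in (fun x => `[<U'' x>] : bool)]%classic = U''.
    by apply/funext => x; apply/propext; split=> /asboolP.
  split; last by exists v; rewrite Ev EN EU; apply: factor_subquot_iso.
  move=> x /Nl Ux; apply/asboolP; have [r [rr d o u kr]] := fac.
  by apply/d; exists 0; apply/kr.
Qed.

Lemma filt_has_filtration k (V : 'I_k -> lmodType R) X l :
  filt (fun N => exists v, V v = N) (@zero_set R X) (fun _ => True) l ->
  has_filtration V X l.
Proof.
move=> /filt_sets [N [lN N0 Nl sN]].
exists N; split=> //; last by move=> x; apply/Nl.
by move=> x; apply/idP/eqP => /N0.
Qed.

Lemma ell_le k (V : 'I_k -> lmodType R) X l : has_filtration V X l ->
  (ell V X <= l%:R%:E)%E.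
Proof.
move=> h; rewrite /ell; case: pselect => [ex|[]]; last by exists l; apply/asboolP.
by case: ex_minnP => l' _ min; rewrite lee_fin ler_nat; apply/min/asboolP.
Qed.

End Ell.

(** The quotient is at most C (3/4)^n, and (3/4)^n <= 3/n by Bernoulli's inequality for 4/3. *)
Lemma little_o_of_growth (a : nat -> \bar rat) (b : nat -> nat) (C L : nat) :
  (forall n, ((2 * L) ^ n <= b n)%N) ->
  (forall n, exists l : nat, (a n <= l%:R%:E)%E /\ (2 ^ n * l <= C * (3 * L) ^ n)%N) ->
  is_little_o a b.
Proof.
move=> hb ha eps eps0.
have bern n : (3 ^ n * n <= 3 * 4 ^ n)%N.
  have : (3 ^ n * (n + 3) <= 3 * 4 ^ n)%N.
    elim: n => [|n IH]; first by [].
    by rewrite !expnS; move: IH; set A := (3 ^ n)%N; set B := (4 ^ n)%N; nia.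
  by apply: leq_trans; rewrite leq_mul2l leq_addr orbT.
have key n l : (2 ^ n * l <= C * (3 * L) ^ n)%N -> (n * l <= 3 * C * b n)%N.
  move=> hl; rewrite -(@leq_pmul2l (3 ^ n)) ?expn_gt0 //.
  have h1 : (3 ^ n * (n * l) <= 3 * (4 ^ n * l))%N.
    by rewrite mulnA [(3 * _)%N]mulnA; apply: leq_mul.
  apply: leq_trans h1 _.
  have -> : (4 ^ n * l = 2 ^ n * (2 ^ n * l))%N by rewrite mulnA -expnMn.
  have h2 : (2 ^ n * (2 ^ n * l) <= 2 ^ n * (C * (3 * L) ^ n))%N by rewrite leq_mul2l hl orbT.
  have E : (2 ^ n * (C * (3 * L) ^ n) = C * (3 ^ n * (2 * L) ^ n))%N.
    by rewrite !expnMn; ring.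
  rewrite E in h2.
  have h3 : (C * (3 ^ n * (2 * L) ^ n) <= C * (3 ^ n * b n))%N by rewrite !leq_mul2l hb !orbT.
  have := leq_trans h2 h3; lia.
pose n0 := (Num.bound ((3 * C)%:R / eps)).+1.
exists n0 => n le; have [l [al hl]] := ha n; apply: le_trans al _.
rewrite lee_fin.
have n_gt0 : (0 < n)%N by apply: leq_trans le.
have n0r : 0 < n%:R :> rat by rewrite ltr0n.
have h1 : (3 * C)%:R <= eps * n%:R :> rat.
  rewrite mulrC -ler_pdivrMr //; apply: ltW; apply: (lt_le_trans (archi_boundP _)).
    by rewrite divr_ge0 ?ler0n // ltW.
  by rewrite ler_nat; apply: leq_trans le; apply: leqnSn.
rewrite -(ler_pM2l n0r) -natrM.
apply: (@le_trans _ _ (3 * C * b n)%:R); first by rewrite ler_nat; apply: key.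
by rewrite natrM mulrA [n%:R * eps]mulrC; apply: ler_wpM2r.
Qed.

(** A prime that contains a^(p^n) contains a, so the same primes lie above both annihilators. *)
Lemma push_has_dim (R : comNzRingType) p (charRp : p \in [pchar R]) n (M : lmodType R) d :
  module_has_dim M d -> module_has_dim (frobenius_push charRp n M) d.
Proof.
have q0 : (0 < p ^ n)%N by rewrite expn_gt0 (p_gt0 charRp).
have chain l P : prime_chain (annihilator (frobenius_push charRp n M)) l P <->
    prime_chain (annihilator M) l P.
  split=> -[pP IP sP]; split=> // a aM.
    by apply: IP => x; rewrite (pushE charRp n) -(prednK q0) exprSr -scalerA aM scaler0.
  have : a ^+ (p ^ n) \in P 0%N.
    by apply: IP => x; rewrite -(pushE charRp n); apply: aM.
  have [_ PM] := pP 0%N (leq0n _); elim: (p ^ n)%N => [|k IH].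
    by rewrite expr0 => P1; have [[_ nP1 _] _] := pP 0%N (leq0n _); rewrite P1 in nP1.
  by rewrite exprS => /PM/orP[|/IH].
move=> [[P cP] max]; split; first by exists P; apply/chain.
by move=> l P' /chain/max.
Qed.

Lemma among_nth (R : comNzRingType) (s : seq (lmodType R)) (N x0 : lmodType R) :
  among s N -> exists i : 'I_(size s), nth x0 s i = N.
Proof.
elim: s => [|M s IH] //= [->|/IH[i Ei]]; first by exists ord0.
by exists (lift ord0 i).
Qed.

Lemma all_artinian_nth (R : comNzRingType) (s : seq (lmodType R)) (x0 : lmodType R) :
  all_artinian s -> forall i : 'I_(size s), artinian_module (nth x0 s i).
Proof.
elim: s => [|M s IH] a; first by case.
case=> -[|i] lt /=; first by apply: a; left.
by apply: (IH _ (Ordinal (lt : (i < size s)%N))) => N sN; apply: a; right.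
Qed.

Theorem theorem10p14 (p : nat) (R : comNzRingType) (m : {pred R})
    (K : fieldType) (pi : {rmorphism R -> K})
    (charRp : p \in [pchar R]%R) (d : nat) (M : lmodType R)
    (hlocal : is_local_ring m pi)
    (hF : F_finite charRp)
    (hdimR : ring_has_dim R d)
    (hfg : fin_gen M)
    (hdimM : module_has_dim M d) :
  strongly_lim_CM m pi (fun n : nat => frobenius_push charRp n M).
Proof.
pose k0 := resfield pi.
have [g [gen ann]] := cyclic_resfield hlocal.
have fk : fin_gen k0.
  by exists 1%N, (fun _ => g) => x; have [c ->] := gen x; exists (fun _ => c); rewrite big_ord1.
have [k [h hP]] := fin_gen_Phi hF fk.
have [im m1 _] := m_prime hlocal.
have [|alpha [ja la]] := @max_jumps R k0 (Phi charRp k0) (fun _ => True) k (@lsubT _ _).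
  apply: (length_generators charRp (m_prime hlocal) (cyclic_resfield hlocal) (g := h)) => //.
  apply: (Phi_killed im) => a x am; have [c ->] := gen x.
  by rewrite scalerA mulrC -scalerA (ann a).2 // scaler0.
have alpha0 : (0 < alpha)%N.
  apply: (la (fun _ => True)) => //; apply: jumps1 => //; first exact: lsub0.
  apply: (jump_resfield hlocal) => //; first exact: lsub0.
  by exists g; split=> // E; apply/m1/ann; rewrite scale1r.
have [E [e hE]] := hull_exists hlocal charRp.
have [I0] := injective_resolution_exists charRp M.
(* One list has to serve all degrees below d, so the lists of the single degrees are
   concatenated. *)
have [s [as_ sP]] : exists s, all_artinian s /\ forall j, (j < d)%N -> exists X C,
    cohom m (res_diff I0) j X /\ push_growth charRp alpha j X s C.
  elim: {+}d => [|i [s [as_ sP]]]; first by exists [::]; split=> [N []|].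
  have [X cX] := cohom_exists m charRp i (res_diffK (I := I0)).
  have sX := cohom_small_fg hlocal la hfg cX.
  have [s' [C [as' gX]]] := small_push_growth hlocal alpha0 hE sX.
  exists (s ++ s'); split; first exact: all_artinian_cat.
  move=> j; rewrite ltnS leq_eqVlt => /orP[/eqP ->|/sP[Y [C' [cY gY]]]].
    by exists X, C; split=> //; apply: push_growthW gX => N; apply: among_catr.
  by exists Y, C'; split=> //; apply: push_growthW gY => N; apply: among_catl.
exists d; split=> //.
- by move=> n; apply: fin_gen_push.
- by move=> n; apply: push_has_dim.
exists (size s), (fun i => nth k0 s i); split; first exact: all_artinian_nth.
move=> j jd H HP; have [X [C [cX gX]]] := sP j jd.
apply: (@little_o_of_growth _ _ C (p ^ j * alpha)) => n.
  apply: leq_trans (nu_push_ge hlocal hF hfg hdimM ja n).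
  case: n => [|n]; first by rewrite !expn0.
  rewrite leq_exp2r // mulnA leq_mul2r; apply/orP; right.
  have p2 : (2 <= p)%N by apply/prime_gt1/(pcharf_prime charRp).
  apply: (@leq_trans (p ^ j.+1)); first by rewrite expnS leq_mul2r p2 orbT.
  by rewrite leq_exp2l.
have [l [fl le]] := gX n; exists l; split=> //; apply: ell_le; apply: filt_has_filtration.
(* H n is given by an arbitrary injective resolution of F^n_* M; it is compared with F^n_* of the
   fixed resolution of M, and the filtration is carried over. *)
have [In cH] := is_local_cohomologyP hlocal (HP n).
have [L LP] := @fres_push _ _ _ _ _ charRp hlocal n _ (fres_of hlocal I0).
have [f [fo f0]] := fres_unique hlocal (LP j X cX) cH.
have lr : lrel (fun h x => f x = h).
  split; first exact: linear0.
  by move=> a y y' x x' <- <-; rewrite linearP.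
have ur : univalent (fun h x => f x = h) by move=> x /f0.
have := filt_pull lr ur (fun x => ex_intro _ (f x) erefl) fl.
have -> : (fun x => exists2 y, f y = x & zero_set y) = @zero_set R (H n).
  apply/funext => x; apply/propext; split=> [[y <- E0]|->].
    by rewrite (E0 : y = 0) /zero_set linear0.
  by exists 0; rewrite ?linear0.
have -> : (fun x => exists2 y, f y = x & True) = (fun _ : H n => True).
  apply/funext => x; apply/propext; split=> // _.
  by have [y Ey] := fo x; exists y.
by apply: filtW => N /(among_nth k0)[i Ei]; exists i.
Qed.
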